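(* Let $a<0$ be a real number. An admissible analytic ruled surface has a constant ratio $a$ of isotropic principal curvatures if and only if it is isotropic similar to a subset of either the hyperbolic paraboloid $z=x^2+ay^2$, or the helicoid $$r(u,v)=\begin{bmatrix}u\cos v\\ u\sin v\\ v\end{bmatrix},\qquad\text{if } a=-1,$$ or the surface $$r_a(u,v)=\begin{bmatrix}u\cos v\\ u\sin v\\ \exp\left(\frac{a+1}{\sqrt{|a|}}\,v\right)\end{bmatrix},\qquad\text{if } a\neq-1.$$
   Context: We work in $\mathbb{R}^3$ with coordinates $x,y,z$. A surface is an embedded connected 2-dimensional $C^3$ submanifold of $\mathbb{R}^3$, possibly with boundary and possibly non-compact. A surface is admissible if none of its tangent planes is parallel to the $z$-axis; it is then locally a graph $z=f(x,y)$. The isotropic principal curvatures $\kappa_1,\kappa_2$ at a point are the eigenvalues of the Hessian $\nabla^2 f$; $H=\frac{\kappa_1+\kappa_2}{2}$ and $K=\kappa_1\kappa_2$ are the isotropic mean and Gaussian curvatures. An admissible surface has a constant ratio $a$ of isotropic principal curvatures if $K\neq0$ and ($\kappa_1/\kappa_2=a$ or $\kappa_2/\kappa_1=a$) at each of its points; equivalently, $K\ne 0$ and $H^2/K=(a+1)^2/(4a)$. A general isotropic similarity is an invertible affine map $\mathbf{x}\mapsto A\mathbf{x}+\mathbf{b}$ of $\mathbb{R}^3$ with $A=\begin{pmatrix}\pm h_1&\mp h_2&0\\ h_2&h_1&0\\ c_1&c_2&c_3\end{pmatrix}$, $\mathbf b\in\mathbb{R}^3$, $h_1,h_2,c_1,c_2,c_3\in\mathbb{R}$.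 Two sets are isotropic similar if some general isotropic similarity takes one to the other. An analytic ruled surface is a (real-)analytic surface covered by an analytic one-parameter family of line segments; the lines containing these segments are the rulings. In the parametrizations above, $u$ and $v$ are real parameters. *)

(* Defs.v *)
From HB Require Import structures.
From mathcomp Require Import all_boot all_order all_algebra.
From mathcomp Require Import all_classical all_reals all_analysis.

Set Implicit Arguments.
Unset Strict Implicit.
Unset Printing Implicit Defensive.

Import Order.TTheory GRing.Theory Num.Theory.
Import numFieldNormedType.Exports.

Local Open Scope classical_set_scope.
Local Open Scope ring_scope.

Definition vec3 (R : realType) (x y z : R) : 'cV[R]_3 :=
  \col_(i < 3) [:: x; y; z]`_i.

Definition top_view (R : realType) (p : 'cV[R]_3) : 'cV[R]_2 :=
  usubmx (p : 'cV[R]_(2 + 1)).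

Definition height (R : realType) (p : 'cV[R]_3) : R := p 2%:R 0.

(* The domain [I] need not be open: at a point [t0] of [I] the expansion is only
   required to represent [g] on the part of [I] near [t0]. *)
Definition analytic_on (R : realType) (I : set R) (g : R -> R) : Prop :=
  forall t0, I t0 -> exists (c : nat -> R) (r : R), 0 < r /\
    forall t, I t -> `|t - t0| < r -> pseries c (t - t0) @ \oo --> g t.

Definition analytic_curve_on (R : realType) (n : nat) (I : set R)
    (g : R -> 'cV[R]_n) : Prop :=
  forall i, analytic_on I (fun t => g t i 0).

(* Near [w] the function is the sum of an absolutely convergent double power
   series, whose terms are grouped by total degree. *)
Definition analytic_at2 (R : realType) (f : 'cV[R]_2 -> R) (w : 'cV[R]_2) :
    Prop :=
  exists (c : nat -> nat -> R) (r : R), 0 < r /\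
    forall h : 'cV[R]_2, `|h| < r ->
      let term k i := c i (k - i)%N * h 0 0 ^+ i * h 1 0 ^+ (k - i) in
      cvgn (series (fun k => \sum_(i < k.+1) `|term k i|)) /\
      series (fun k => \sum_(i < k.+1) term k i) @ \oo --> f (w + h).

Definition half_plane (R : realType) : set 'cV[R]_2 :=
  [set w | 0 <= w 1 0].
Arguments half_plane : clear implicits.

(* [phi], restricted to the relatively open subset [V `&` half_plane R] of the
   closed half-plane, is a regular analytic parametrization of a relatively open
   subset of [S] and a homeomorphism onto it.  Taking [V] inside the open
   half-plane gives the charts at the interior points of [S].  At points of the
   boundary line of the half-plane, analyticity and ['d phi w] refer to the values
   of [phi] on all of [V], as usual for manifolds with boundary. *)
Definition analytic_chart (R : realType) (S : set 'cV[R]_3)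
    (V : set 'cV[R]_2) (phi : 'cV[R]_2 -> 'cV[R]_3) : Prop :=
  [/\ open V,
      forall w, V w -> forall i, analytic_at2 (fun w' => phi w' i 0) w,
      forall w, (V `&` half_plane R) w -> injective ('d phi w),
      exists W : set 'cV[R]_3,
        open W /\ phi @` (V `&` half_plane R) = S `&` W &
      exists psi : 'cV[R]_3 -> 'cV[R]_2,
        {within phi @` (V `&` half_plane R), continuous psi} /\
        forall w, (V `&` half_plane R) w -> psi (phi w) = w].

(* An embedded connected real-analytic (in particular C^3) surface, possibly with
   boundary and possibly non-compact. *)
Definition analytic_surface (R : realType) (S : set 'cV[R]_3) : Prop :=
  connected S /\
  forall p, S p -> exists V phi,
    analytic_chart S V phi /\ (phi @` (V `&` half_plane R)) p.

Definition tangent_plane (R : realType) (S : set 'cV[R]_3) (p : 'cV[R]_3) :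
    set 'cV[R]_3 :=
  [set v | exists V phi w, [/\ analytic_chart S V phi,
     (V `&` half_plane R) w, phi w = p & range ('d phi w) v]].

Definition admissible (R : realType) (S : set 'cV[R]_3) : Prop :=
  forall p, S p -> ~ tangent_plane S p (vec3 0 0 1).

(* The segments are nondegenerate, and they may be unbounded and may or may not
   contain their endpoints.  The analytic dependence on [t] is required of the
   ruling [{gamma t + s *: e t | s}]; the segment [J t] cut out of it is
   arbitrary. *)
Definition ruled (R : realType) (S : set 'cV[R]_3) : Prop :=
  exists (I : set R) (gamma e : R -> 'cV[R]_3) (J : R -> set R),
    [/\ is_interval I,
        analytic_curve_on I gamma,
        analytic_curve_on I e,
        forall t, I t -> [/\ e t != 0, is_interval (J t) &
          exists s1 s2, [/\ J t s1, J t s2 & s1 < s2]] &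
        S = [set p | exists t s, [/\ I t, J t s & p = gamma t + s *: e t]]].

(* For a surface with boundary, [f] is an analytic extension of the local graph to
   a full neighbourhood of the top view of [p]; the derivatives of [f] there are
   determined by [S]. *)
Definition local_graph (R : realType) (S : set 'cV[R]_3) (p : 'cV[R]_3)
    (f : 'cV[R]_2 -> R) : Prop :=
  [/\ S p, analytic_at2 f (top_view p) &
      exists W : set 'cV[R]_3, [/\ open W, W p &
        forall q, (S `&` W) q -> height q = f (top_view q)]].

Definition hessian (R : realType) (f : 'cV[R]_2 -> R) (w : 'cV[R]_2) :
    'M[R]_2 :=
  \matrix_(i, j) 'D_(delta_mx i 0) ('D_(delta_mx j 0) f) w.

(* The eigenvalues are taken with multiplicity. *)
Definition isotropic_principal_curvatures (R : realType) (S : set 'cV[R]_3)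
    (p : 'cV[R]_3) (k1 k2 : R) : Prop :=
  exists f, local_graph S p f /\
    char_poly (hessian f (top_view p)) = ('X - k1%:P) * ('X - k2%:P).

Definition constant_ratio (R : realType) (a : R) (S : set 'cV[R]_3) : Prop :=
  forall p, S p -> exists k1 k2, [/\ isotropic_principal_curvatures S p k1 k2,
    k1 * k2 != 0 & k1 / k2 = a \/ k2 / k1 = a].

(* [s] selects the upper ([false]) or lower ([true]) signs of the first row. *)
Definition isotropic_mx (R : realType) (s : bool) (h1 h2 c1 c2 c3 : R) :
    'M[R]_3 :=
  \matrix_(i < 3, j < 3)
    (nth [::] [:: [:: (-1) ^+ s * h1; - ((-1) ^+ s * h2); 0];
                  [:: h2; h1; 0];
                  [:: c1; c2; c3]] i)`_j.

Definition isotropic_similarity (R : realType) (T : 'cV[R]_3 -> 'cV[R]_3) :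
    Prop :=
  exists (s : bool) (h1 h2 c1 c2 c3 : R) (b : 'cV[R]_3),
    isotropic_mx s h1 h2 c1 c2 c3 \in unitmx /\
    forall x, T x = isotropic_mx s h1 h2 c1 c2 c3 *m x + b.

Definition isotropic_similar (R : realType) (A B : set 'cV[R]_3) : Prop :=
  exists T, isotropic_similarity T /\ T @` A = B.

Definition paraboloid (R : realType) (a : R) : set 'cV[R]_3 :=
  [set p | exists x y, p = vec3 x y (x ^+ 2 + a * y ^+ 2)].

Definition helicoid (R : realType) : set 'cV[R]_3 :=
  [set p | exists u v, p = vec3 (u * cos v) (u * sin v) v].
Arguments helicoid : clear implicits.

Definition exp_helicoid (R : realType) (a : R) : set 'cV[R]_3 :=
  [set p | exists u v, p = vec3 (u * cos v) (u * sin v)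
                                (expR ((a + 1) / Num.sqrt `|a| * v))].

(* Main.v *)
Require Import Defs.
From mathcomp Require Import all_boot all_order all_algebra.
From mathcomp Require Import ring lra.
From mathcomp Require Import all_classical all_reals all_analysis.
Import Order.TTheory GRing.Theory Num.Theory.
Import numFieldNormedType.Exports.
Local Open Scope classical_set_scope.
Local Open Scope ring_scope.

Set Implicit Arguments.
Unset Strict Implicit.
Unset Printing Implicit Defensive.

(** Why the theorem holds.

Let [e] be the direction of a ruling, [g + s * e] its points, and write [D], [w]
for the determinants of the top views of [e, g' + s * e'] and of [e, e'].  A ruling
is an asymptotic direction of the local graph, so in the basis [e, g' + s * e'] the
Hessian has only two unknown entries, and these are determinants of derivatives of
[g] and [e].  The constant ratio, that is, a constant value of [H ^+ 2 / K], then
becomes the equation [T = lam * D * M], where [lam ^+ 2 * - a = (a + 1) ^+ 2], [M]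
is the determinant of [e, g', e'], and [T] is a second-order expression
([hessian_ratio], [ruling_relation], [ruling_equation]).  It is polynomial of degree
two in the position [s], so it splits into three ordinary differential equations.

If [w] vanishes identically, the top views of the rulings are parallel, and the
equations give a quadratic function ([parallel_rulings]), up to similarity that of the
paraboloid.  If not, they say that after a shear
of the third coordinate all the rulings are horizontal, that their lines of striction
shrink to a point of the top view, so that all rulings meet one vertical axis, and
that the height [z] as a function of the turning angle [v] satisfies
[dz / dv = C - lam * z] ([turning_rulings]).  Hence [z] is linear in [v] when
[lam = 0], which means [a = -1], and exponential otherwise ([turning_closed_form]).
The equations hold at first on a small interval of parameters only; the identity
theorem for analytic functions extends their solutions to all of it.  If all
rulings lie over one line, the surface lies in a vertical plane and is not
admissible ([vertical_tangent]).  This direction is [ratio_ruled_surface].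

Conversely the property is local and invariant under similarities, so it is read off
from explicit local graphs.  For the paraboloid this is a quadratic polynomial.  The
other two models have the height [g (v)] at the angle [v], with [g' = kap * g + d]; away
from the axis their local graph is [g (v0 + atan (q / (1 + p)))] with linear forms
[p], [q], and its double power series is found by solving a linear differential
equation along each ray ([helical_expansion]).  Its terms of degree two give the
ratio ([helical_constant_ratio]).  On the axis the tangent planes of the models are
vertical, so an admissible surface does not meet it. *)

(** * Power series in one variable *)

Lemma bounded_series_cvg (R : realType) (u : nat -> R) (B : R) :
  (forall k, 0 <= u k) -> (forall N, \sum_(k < N) u k <= B) -> cvgn (series u).
Proof.
move=> u0 uB; apply: nondecreasing_is_cvgn.
  by apply: nondecreasing_series => n _ _; exact: u0.
by exists B => _ [n _ <-]; rewrite /series /= big_mkord.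
Qed.

Lemma cvg_series_ub (R : realType) (u : nat -> R) :
  (forall k, 0 <= u k) -> cvgn (series u) ->
  forall N, \sum_(k < N) u k <= limn (series u).
Proof.
move=> u0 cu N; rewrite -(big_mkord xpredT u).
apply: (nondecreasing_cvgn_le _ cu).
by apply: nondecreasing_series => n _ _; exact: u0.
Qed.

(** The terms of degree at least [m] carry a factor [(x / rho) ^+ m].  The weights
[b] are not the absolute values of the [u k], so that the bound also applies to the
homogeneous parts of a double power series. *)
Lemma series_tail_le (R : realType) (u b : nat -> R) (x rho B l : R) (m : nat) :
  0 <= x -> x <= rho -> 0 < rho ->
  (forall k, 0 <= b k) -> (forall k, `|u k| <= b k * x ^+ k) ->
  (forall N, \sum_(k < N) b k * rho ^+ k <= B) ->
  series u @ \oo --> l ->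
  `|l - \sum_(k < m) u k| <= B * (x / rho) ^+ m.
Proof.
move=> x0 xr r0 b0 ub bB ul.
have q0 : 0 <= x / rho by rewrite divr_ge0 // ltW.
have q1 : x / rho <= 1 by rewrite ler_pdivrMr // mul1r.
have step N : (m <= N)%N ->
    `|series u N - \sum_(k < m) u k| <= B * (x / rho) ^+ m.
  move=> mN; rewrite -(big_mkord xpredT u) [X in `|_ - X|](_ : _ = series u m) //.
  rewrite sub_series_geq //.
  apply: (le_trans (ler_norm_sum _ _ _)).
  apply: (@le_trans _ _ (\sum_(m <= k < N) b k * rho ^+ k * (x / rho) ^+ m)).
    apply: ler_sum_nat => k /andP[mk _].
    apply: (le_trans (ub k)); rewrite -mulrA ler_wpM2l //.
    have -> : x ^+ k = rho ^+ k * (x / rho) ^+ k.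
      by rewrite -exprMn mulrC divfK // gt_eqF.
    rewrite ler_wpM2l ?exprn_ge0 ?(ltW r0) //.
    by rewrite ler_wiXn2l.
  rewrite -mulr_suml ler_wpM2r ?exprn_ge0 //.
  apply: le_trans (bB N); rewrite -(big_mkord xpredT (fun k => b k * rho ^+ k)).
  rewrite (@big_cat_nat _ _ _ m 0) //= lerDr; apply: sumr_ge0 => k _.
  by rewrite mulr_ge0 // exprn_ge0 // ltW.
have cl : (fun N => `|series u N - \sum_(k < m) u k|) @ \oo -->
    `|l - \sum_(k < m) u k|.
  by apply: cvg_norm; apply: cvgB => //; exact: cvg_cst.
rewrite -(cvg_lim _ cl) //; apply: limr_le; first by apply/cvg_ex; exists `|l - \sum_(k < m) u k|.
by exists m.
Qed.

(** Absolute convergence for [`|x| < r], in the form of bounded partial sums: this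
is inherited by smaller coefficients and is easy to verify for explicit ones. *)
Definition coef_bounded (R : realType) (a : nat -> R) (r : R) :=
  forall rho, 0 <= rho -> rho < r ->
    exists B, forall N, \sum_(k < N) `|a k| * rho ^+ k <= B.

Lemma coef_bounded_pseries (R : realType) (a : nat -> R) (r : R) :
  coef_bounded a r <->
  forall rho, 0 <= rho -> rho < r -> cvgn (pseries (fun k => `|a k|) rho).
Proof.
split=> H rho r0 rr.
  have [B hB] := H _ r0 rr; apply: (bounded_series_cvg _ hB) => k.
  by rewrite mulr_ge0 // exprn_ge0.
exists (limn (pseries (fun k => `|a k|) rho)) => N.
apply: (@cvg_series_ub _ (fun k => `|a k| * rho ^+ k)); last exact: H.
by move=> k; rewrite mulr_ge0 // exprn_ge0.
Qed.

Lemma coef_bounded_cvg (R : realType) (a : nat -> R) (r x : R) :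
  coef_bounded a r -> `|x| < r -> cvgn (pseries a x).
Proof.
move=> /coef_bounded_pseries H xr; apply: normed_cvg.
have := H _ (normr_ge0 x) xr; rewrite /pseries /normed_series_of.
by under [in X in _ -> X]eq_fun do rewrite normrM normrX.
Qed.

Lemma cvg_coef_bounded (R : realType) (a : nat -> R) (r : R) :
  (forall x, 0 <= x -> x < r -> cvgn (pseries a x)) -> coef_bounded a r.
Proof.
move=> H; apply/coef_bounded_pseries => rho r0 rr.
have [y /andP[ry yr]] : exists y, rho < y < r.
  by exists ((rho + r) / 2); apply/andP; split; lra.
have y0 : 0 <= y by lra.
apply: (@is_cvg_pseries_inside_norm _ _ y); first exact: H.
by rewrite !ger0_norm.
Qed.

(** The factor [k] is absorbed by passing to a slightly larger radius. *)
Lemma coef_boundedMn (R : realType) (a : nat -> R) (r : R) :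
  coef_bounded a r -> coef_bounded (fun k => k%:R * a k) r.
Proof.
move=> H rho r0 rr.
have [y /andP[ry yr]] : exists y, rho < y < r.
  by exists ((rho + r) / 2); apply/andP; split; lra.
have y0 : 0 < y by lra.
have [B hB] := H y (ltW y0) yr.
set q := rho / y.
have q0 : 0 <= q by rewrite divr_ge0 // ltW.
have q1 : q < 1 by rewrite ltr_pdivrMr // mul1r.
have kq k : k%:R * q ^+ k * (1 - q) <= 1 - q ^+ k.
  elim: k => [|k IH]; first by rewrite expr0 !mul0r subrr.
  have qk0 : 0 <= q ^+ k by rewrite exprn_ge0.
  have qk1 : q ^+ k <= 1 by rewrite exprn_ile1 // ltW.
  have := ler_wpM2l q0 IH; rewrite exprS -natr1.
  have : q * q ^+ k * (1 - q) <= 1 * (1 - q).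
    by rewrite ler_wpM2r ?subr_ge0 ?(ltW q1) // mulr_ile1 // ltW.
  by nra.
exists (B / (1 - q)) => N.
apply: le_trans (_ : (\sum_(k < N) `|a k| * y ^+ k) / (1 - q) <= _); last first.
  by rewrite ler_wpM2r // invr_ge0 subr_ge0 ltW.
rewrite mulr_suml; apply: ler_sum => k _.
have -> : rho ^+ k = y ^+ k * q ^+ k by rewrite -exprMn mulrC divfK // gt_eqF.
rewrite normrM normr_nat.
have -> : k%:R * `|a k| * (y ^+ k * q ^+ k) = `|a k| * y ^+ k * (k%:R * q ^+ k).
  by ring.
rewrite ler_wpM2l ?mulr_ge0 ?exprn_ge0 ?(ltW y0) //.
rewrite -[_^-1]mul1r ler_pdivlMr ?subr_gt0 //; apply: le_trans (kq k) _.
by rewrite gerDl oppr_le0 exprn_ge0.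
Qed.

Definition power_series_at (R : realType) (g : R -> R) (t0 : R) (c : nat -> R)
    (r : R) :=
  0 < r /\ forall t, `|t - t0| < r -> pseries c (t - t0) @ \oo --> g t.

Definition analytic_at (R : realType) (g : R -> R) (t0 : R) :=
  exists c r, power_series_at g t0 c r.

Lemma power_series_bounded (R : realType) (g : R -> R) t0 c r :
  power_series_at g t0 c r -> coef_bounded c r.
Proof.
move=> [r0 H]; apply: cvg_coef_bounded => x x0 xr.
apply/cvg_ex; exists (g (t0 + x)).
have := H (t0 + x); rewrite addrAC subrr add0r ger0_norm //; exact.
Qed.

Lemma pseries_diffs_bounded (R : realType) (a : nat -> R) (r : R) :
  coef_bounded a r -> coef_bounded (pseries_diffs a) r.
Proof.
move=> H rho r0 rr.
have [rho0|rho0] := eqVneq rho 0.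
  exists `|pseries_diffs a 0| => -[|N]; first by rewrite big_ord0.
  rewrite big_ord_recl rho0 expr0 mulr1 big1 ?addr0 // => i _.
  by rewrite expr0n /= mulr0.
have rho_gt0 : 0 < rho by rewrite lt_def rho0.
have [B hB] := coef_boundedMn H r0 rr.
exists (B / rho) => N.
rewrite ler_pdivlMr //; apply: le_trans (hB N.+1).
rewrite big_ord_recl mul0r normr0 mul0r add0r mulr_suml.
by apply: ler_sum => k _; rewrite /pseries_diffs /= /bump /= add1n exprSr mulrA.
Qed.

Lemma power_series_is_derive (R : realType) (g : R -> R) t0 c r t :
  power_series_at g t0 c r -> `|t - t0| < r ->
  is_derive t 1 g (limn (pseries (pseries_diffs c) (t - t0))).
Proof.
move=> gc tr; have [r0 H] := gc.
have b0 := power_series_bounded gc.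
have b1 := pseries_diffs_bounded b0; have b2 := pseries_diffs_bounded b1.
have [K /andP[tK Kr]] : exists K : R, `|t - t0| < K < r.
  by exists ((`|t - t0| + r) / 2); apply/andP; split; lra.
have K0 : 0 < K by apply: le_lt_trans tK.
have nK : `|K| = K by rewrite gtr0_norm.
have D : is_derive (t - t0) (1 : R) (fun x => limn (pseries c x))
    (limn (pseries (pseries_diffs c) (t - t0))).
  by apply: (@pseries_snd_diffs _ _ K);
    [apply: coef_bounded_cvg b0 _|apply: coef_bounded_cvg b1 _|
     apply: coef_bounded_cvg b2 _|]; rewrite nK.
have Ds : is_derive t 1 (fun x => x - t0) 1.
  by apply: is_derive_eq; rewrite subr0.
have := @is_derive1_comp _ (fun x => limn (pseries c x)) (fun x => x - t0) t _ _ D Ds.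
rewrite mulr1; apply: near_eq_is_derive.
near=> x; rewrite /comp; apply/cvg_lim => //; apply: H.
near: x; apply/nbhs_ballP; exists (r - `|t - t0|) => /=; first by rewrite subr_gt0.
move=> y /=; rewrite /ball /= => ty.
rewrite (le_lt_trans (ler_distD t _ _)) // distrC -ltrBrDr //.
Unshelve. all: by end_near. Qed.

Lemma power_series_derive1 (R : realType) (g : R -> R) t0 c r :
  power_series_at g t0 c r -> power_series_at (derive1 g) t0 (pseries_diffs c) r.
Proof.
move=> gc; have [r0 _] := gc; split=> // t tr.
have D := power_series_is_derive gc tr.
rewrite derive1E (@derive_val _ _ _ _ _ _ _ D).
exact: (coef_bounded_cvg (pseries_diffs_bounded (power_series_bounded gc)) tr).
Qed.

Lemma pseries_at0 (R : realType) (c : nat -> R) : pseries c 0 @ \oo --> c 0%N.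
Proof.
rewrite -cvg_shiftS /=; have -> : (fun n => pseries c 0 n.+1) = cst (c 0%N).
  apply/funext => n; rewrite /pseries /series /= big_mkord big_ord_recl expr0 mulr1.
  by rewrite big1 ?addr0 // => i _; rewrite expr0n mulr0.
exact: cvg_cst.
Qed.

Lemma power_series_coef0 (R : realType) (g : R -> R) t0 c r :
  power_series_at g t0 c r -> c 0%N = g t0.
Proof.
move=> [r0 H]; have := H t0; rewrite subrr normr0 => /(_ r0) cg.
by apply: (cvg_unique _ (@pseries_at0 R c) cg).
Qed.

Lemma power_series_taylor (R : realType) (g : R -> R) t0 c r m :
  power_series_at g t0 c r ->
  exists C rho, 0 < rho /\ forall x, `|x| <= rho ->
    `|g (t0 + x) - \sum_(k < m) c k * x ^+ k| <= C * `|x| ^+ m.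
Proof.
move=> gc; have [r0 H] := gc.
have r2 : 0 < r / 2 by lra.
have [|B hB] := power_series_bounded gc (ltW r2); first by lra.
exists (B / (r / 2) ^+ m), (r / 2); split=> // x xr.
have xr' : `|x| < r by apply: le_lt_trans xr _; lra.
have := @series_tail_le R (fun k => c k * x ^+ k) (fun k => `|c k|) `|x| (r / 2)
  B (g (t0 + x)) m (normr_ge0 _) xr r2 (fun=> normr_ge0 _).
rewrite expr_div_n mulrA mulrAC; apply=> //; first by move=> k; rewrite normrM normrX.
have := H (t0 + x); rewrite addrAC subrr add0r; exact.
Qed.

Lemma analytic_is_derive (R : realType) (g : R -> R) t :
  analytic_at g t -> is_derive t 1 g ((derive1 g) t).
Proof.
move=> [c [r gc]]; have [r0 _] := gc.
have D := @power_series_is_derive _ _ _ _ _ t gc.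
rewrite subrr normr0 in D.
by rewrite derive1E; apply: derivableP; case: (D r0).
Qed.

Lemma analytic_derive1 (R : realType) (g : R -> R) t :
  analytic_at g t -> analytic_at (derive1 g) t.
Proof. by move=> [c [r gc]]; do 2 eexists; exact: power_series_derive1 gc. Qed.

Lemma analytic_continuous (R : realType) (g : R -> R) t :
  analytic_at g t -> {for t, continuous g}.
Proof.
move=> /analytic_is_derive [dg _]; apply: differentiable_continuous.
exact/derivable1_diffP.
Qed.

Lemma analytic_taylor2 (R : realType) (g : R -> R) t :
  analytic_at g t -> exists C rho, 0 < rho /\ forall x, `|x| <= rho ->
    `|g (t + x) - (g t + (derive1 g) t * x + derive1 (derive1 g) t / 2 * x ^+ 2)| <= C * `|x| ^+ 3.
Proof.
move=> [c [r gc]]; have [C [rho [r0 H]]] := power_series_taylor 3 gc.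
exists C, rho; split=> // x /H.
have <- := power_series_coef0 gc.
have <- := power_series_coef0 (power_series_derive1 gc).
have <- := power_series_coef0 (power_series_derive1 (power_series_derive1 gc)).
rewrite !big_ord_recl big_ord0 /bump /= /pseries_diffs.
by congr (`| _ - _ | <= _); field.
Qed.

Lemma analytic_cst (R : realType) (k t : R) : analytic_at (cst k) t.
Proof.
exists (fun n => if n is 0%N then k else 0), 1; split=> // x _.
rewrite -cvg_shiftS /=.
have -> : (fun n => pseries (fun n => if n is 0%N then k else 0) (x - t) n.+1)
    = cst k.
  apply/funext => n; rewrite /pseries /series /= big_mkord big_ord_recl expr0 mulr1.
  by rewrite big1 ?addr0 // => i _; rewrite mul0r.
exact: cvg_cst.
Qed.

Lemma analyticD (R : realType) (f g : R -> R) t :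
  analytic_at f t -> analytic_at g t -> analytic_at (fun x => f x + g x) t.
Proof.
move=> [c [r [r0 fc]]] [d [s [s0 gd]]].
exists (fun k => c k + d k), (Num.min r s); split; first by rewrite lt_min r0.
move=> x; rewrite lt_min => /andP[xr xs].
have -> : pseries (fun k => c k + d k) (x - t) = pseries c (x - t) + pseries d (x - t).
  apply/funext => n; rewrite fctE /pseries /series /= !big_mkord -big_split /=.
  by apply: eq_bigr => i _; rewrite mulrDl.
exact: cvgD (fc x xr) (gd x xs).
Qed.

Lemma triangular_sum (V : zmodType) (F : nat -> nat -> V) M :
  \sum_(n < M) \sum_(i < n.+1) F i (n - i)%N = \sum_(i < M) \sum_(j < M - i) F i j.
Proof.
elim: M => [|M IH]; first by rewrite !big_ord0.
rewrite big_ord_recr IH /= [RHS]big_ord_recr /= [X in _ = _ + X](_ : _ = F M 0%N).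
  rewrite [X in _ + X]big_ord_recr /= subnn addrA; congr (_ + _).
  rewrite -big_split /=; apply: eq_bigr => i _.
  by rewrite subSn ?(ltnW (ltn_ord i)) // big_ord_recr.
by rewrite subSnn big_ord_recl big_ord0 addr0.
Qed.

(** Mertens' product of two power series inside a common disc of convergence:
the tails of one factor decay geometrically, which beats the number of terms. *)
Lemma pseries_mul (R : realType) (c d : nat -> R) (r x U V : R) :
  coef_bounded c r -> coef_bounded d r -> `|x| < r ->
  pseries c x @ \oo --> U -> pseries d x @ \oo --> V ->
  pseries (fun n => \sum_(i < n.+1) c i * d (n - i)%N) x @ \oo --> U * V.
Proof.
move=> cr dr xr cU dV.
have [rho /andP[xrho rhor]] : exists rho : R, `|x| < rho < r.
  by exists ((`|x| + r) / 2); apply/andP; split; lra.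
have rho0 : 0 < rho by apply: le_lt_trans xrho.
have [A hA] := cr _ (ltW rho0) rhor; have [B hB] := dr _ (ltW rho0) rhor.
have B0 : 0 <= B by have := hB 0%N; rewrite big_ord0.
set q := `|x| / rho.
have q0 : 0 <= q by rewrite divr_ge0 // ltW.
have q1 : q < 1 by rewrite ltr_pdivrMr // mul1r.
have tail m : `|V - \sum_(k < m) d k * x ^+ k| <= B * q ^+ m.
  apply: (@series_tail_le R (fun k => d k * x ^+ k) (fun k => `|d k|) `|x| rho B) => //.
    exact: ltW.
  by move=> k; rewrite normrM normrX.
have xq k : `|x| ^+ k = rho ^+ k * q ^+ k.
  by rewrite -exprMn mulrC divfK // gt_eqF.
set w := fun n => _.
have bound M : `|pseries c x M * V - pseries w x M| <= A * B * q ^+ M.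
  rewrite /pseries /series /= !big_mkord.
  have -> : \sum_(k < M) w k * x ^+ k =
      \sum_(i < M) c i * x ^+ i * \sum_(j < M - i) d j * x ^+ j.
    rewrite [RHS](_ : _ = \sum_(i < M) \sum_(j < M - i)
        (c i * x ^+ i * (d j * x ^+ j))); last first.
      by apply: eq_bigr => i _; rewrite mulr_sumr.
    rewrite -(triangular_sum (fun i j => c i * x ^+ i * (d j * x ^+ j))).
    apply: eq_bigr => k _; rewrite /w mulr_suml; apply: eq_bigr => i _.
    have ki : (i <= k)%N by rewrite -ltnS.
    by rewrite -[in x ^+ k](subnKC ki) exprD; ring.
  rewrite mulr_suml -sumrB; apply: (le_trans (ler_norm_sum _ _ _)).
  apply: (@le_trans _ _ (\sum_(i < M) `|c i| * rho ^+ i * (B * q ^+ M))); last first.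
    rewrite -mulr_suml -mulrA ler_wpM2r // mulr_ge0 // exprn_ge0 //.
  apply: ler_sum => i _; rewrite -mulrBr normrM normrM normrX xq.
  have iM : (i <= M)%N by exact: ltnW.
  have -> : q ^+ M = q ^+ i * q ^+ (M - i) by rewrite -exprD subnKC.
  have -> : `|c i| * rho ^+ i * (B * (q ^+ i * q ^+ (M - i))) =
    `|c i| * (rho ^+ i * q ^+ i) * (B * q ^+ (M - i)) by ring.
  apply: ler_wpM2l; last exact: tail.
  by rewrite !mulr_ge0 ?exprn_ge0 // ltW.
have c1 : (fun M => pseries c x M * V - pseries w x M) @ \oo --> 0.
  apply/norm_cvg0P; apply: (@squeeze_cvgr _ _ _ _ (cst 0) (fun M => A * B * q ^+ M)).
  - by near=> M; rewrite normr_ge0 bound.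
  - exact: cvg_cst.
  - rewrite -[X in _ --> X](mulr0 (A * B)); apply: cvgM; first exact: cvg_cst.
    by apply: cvg_expr; rewrite ger0_norm.
have c2 : (fun M => pseries c x M * V) @ \oo --> U * V by apply: cvgM => //; exact: cvg_cst.
have c3 := cvgB c2 c1; rewrite subr0 in c3.
have e : pseries w x = (fun M => pseries c x M * V) -
    (fun M => pseries c x M * V - pseries w x M).
  by apply/funext => M; rewrite !fctE subKr.
by rewrite e; exact: c3.
Unshelve. all: by end_near. Qed.

Lemma analyticM (R : realType) (f g : R -> R) t :
  analytic_at f t -> analytic_at g t -> analytic_at (fun x => f x * g x) t.
Proof.
move=> [c [r fc]] [d [s gd]]; have [r0 fc'] := fc; have [s0 gd'] := gd.
exists (fun n => \sum_(i < n.+1) c i * d (n - i)%N), (Num.min r s).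
split=> [|x xrs]; first by rewrite lt_min r0.
have := xrs; rewrite lt_min => /andP[xr xs].
apply: (@pseries_mul _ _ _ (Num.min r s)) => //; last 2 first.
- exact: fc'.
- exact: gd'.
- move=> rho rho0 rhom; apply: (power_series_bounded fc) => //.
  by apply: lt_le_trans rhom _; rewrite ge_min lexx.
- move=> rho rho0 rhom; apply: (power_series_bounded gd) => //.
  by apply: lt_le_trans rhom _; rewrite ge_min lexx orbT.
Qed.

Lemma analyticN (R : realType) (f : R -> R) t :
  analytic_at f t -> analytic_at (fun x => - f x) t.
Proof.
move=> fa; rewrite (_ : (fun x => _) = fun x => cst (-1) x * f x).
  by apply: analyticM => //; exact: analytic_cst.
by apply/funext => x; rewrite mulN1r.
Qed.

(** Near a zero the first nonzero term of the expansion dominates the rest. *)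
Lemma analytic_isolated_zeros (R : realType) (g : R -> R) (t0 : R) :
  analytic_at g t0 ->
  (forall e, 0 < e -> exists x, [/\ x != t0, `|x - t0| < e & g x = 0]) ->
  \forall x \near t0, g x = 0.
Proof.
move=> [c [r gc]] zeros; have [r0 gl] := gc.
have [c0|] := pselect (forall k, c k = 0).
  apply/nbhs_ballP; exists r => //= x; rewrite /ball /= distrC => xr.
  apply: (cvg_unique _ (gl _ xr)) => //=.
  have -> : pseries c (x - t0) = cst 0; last exact: cvg_cst.
  by apply/funext => n; rewrite /pseries /series /= big1 // => i _; rewrite c0 mul0r.
move/existsNP => [k0 /eqP ck0].
have exk : exists k, c k != 0 by exists k0.
have := ex_minnP exk => -[k ck kmin].
have [C [rho [rho0 H]]] := power_series_taylor k.+1 gc.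
have e0 : 0 < Num.min rho (`|c k| / (`|C| + 1)).
  by rewrite lt_min rho0 divr_gt0 ?normr_gt0 // ltr_wpDl.
have [x [xt0 xe gx]] := zeros _ e0.
move: xe; rewrite lt_min => /andP[xrho xc].
have := H _ (ltW xrho); rewrite [t0 + _]addrC subrK gx sub0r normrN big_ord_recr /=.
rewrite big1 => [|i _]; last first.
  by have [->|/kmin] := eqVneq (c i) 0; [rewrite mul0r|rewrite leqNgt ltn_ord].
rewrite add0r normrM normrX exprSr mulrCA mulrC ler_pM2l; last first.
  by rewrite exprn_gt0 // normr_gt0 subr_eq0.
move=> cC; exfalso; move: xc; rewrite ltr_pdivlMr ?ltr_wpDl // => xc.
have : C * `|x - t0| <= `|C| * `|x - t0| by rewrite ler_wpM2r // ler_norm.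
have := normr_ge0 (x - t0).
by lra.
Qed.

(** The points near which [g] vanishes form an open subset of [I]; it is closed
by [analytic_isolated_zeros], applied at its limit points. *)
Lemma identity_theorem_near (R : realType) (I : set R) (g : R -> R) (t0 : R) :
  is_interval I -> (forall t, I t -> analytic_at g t) -> I t0 ->
  (\forall x \near t0, g x = 0) -> forall t, I t -> \forall x \near t, g x = 0.
Proof.
move=> /connected_intervalP cI ga It0 g0.
suff <- : I `&` [set t | \forall x \near t, g x = 0] = I by move=> t [].
set Z := [set t | _].
apply: cI; first by exists t0.
  by exists Z => //; exact: open_interior.
exists (closure (I `&` Z)); first exact: closed_closure.
apply/seteqP; split=> [t [It Zt]|t [It clt]].
  by split=> //; apply: subset_closure.
split=> //; apply: analytic_isolated_zeros; first exact: ga.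
move=> e e0; have [y [[Iy Zy] ye]] := clt _ (nbhsx_ballx t e e0).
have : \forall x \near y, ball t e x /\ g x = 0.
  near=> x; split; last by near: x.
  by near: x; apply: open_nbhs_nbhs; split=> //; exact: ball_open.
move=> /nbhs_ballP [d /= d0 Hd].
have [yt|yt] := eqVneq y t.
  have : ball y d (y + d / 2).
    by rewrite /ball /= opprD addNKr normrN gtr0_norm; lra.
  move=> /Hd [b1 b2]; exists (y + d / 2); split=> //.
    by rewrite -yt -subr_eq0 addrAC subrr add0r; apply/eqP; lra.
  by rewrite distrC.
have [b1 b2] := Hd y (ballxx y d0); exists y; split=> //.
by rewrite distrC.
Unshelve. all: by end_near. Qed.

Lemma identity_theorem (R : realType) (I : set R) (g : R -> R) (a b : R) :
  is_interval I -> (forall t, I t -> analytic_at g t) ->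
  a < b -> `]a, b[ `<=` I -> (forall t, a < t < b -> g t = 0) ->
  forall t, I t -> \forall x \near t, g x = 0.
Proof.
move=> iI ga ab abI g0.
have mab : a < (a + b) / 2 < b by apply/andP; split; lra.
apply: (@identity_theorem_near _ _ _ ((a + b) / 2)) => //.
  by apply: abI; rewrite /= in_itv.
near=> x; apply: g0.
have : x \in `]a, b[ by near: x; apply: near_in_itvoo; rewrite in_itv.
by rewrite in_itv.
Unshelve. all: by end_near. Qed.

(** * Analytic functions on an interval *)

Lemma near_subinterval (R : realType) (I : set R) (t1 : R) (Q : R -> Prop) :
  is_interval I -> (exists x y, [/\ I x, I y & x < y]) -> I t1 ->
  (\forall t \near t1, Q t) ->
  exists al be, al < be /\ forall t, al < t < be -> I t /\ Q t.
Proof.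
move=> iI [x [y [Ix Iy xy]]] It1 /nbhs_ballP [d /= d0 Hd].
have [z [Iz zt]] : exists z, I z /\ z != t1.
  have [e|e] := eqVneq x t1; last by exists x.
  by exists y; split=> //; rewrite -e gt_eqF.
have HQ t : `|t - t1| < d -> Q t by move=> td; apply: Hd; rewrite /ball /= distrC.
have [zlt|] := ltP z t1.
  exists (Num.max z (t1 - d)), t1; split; first by rewrite gt_max zlt /=; lra.
  move=> t; rewrite gt_max => /andP[/andP[zt1 dt] tt1]; split.
    by apply: (iI z t1) => //; rewrite !ltW.
  by apply: HQ; rewrite ltr_norml; apply/andP; split; lra.
rewrite le_eqVlt eq_sym (negbTE zt) /= => tz.
exists t1, (Num.min z (t1 + d)); split; first by rewrite lt_min tz /=; lra.
move=> t; rewrite lt_min => /andP[t1t /andP[tz' td]]; split.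
  by apply: (iI t1 z) => //; rewrite !ltW.
by apply: HQ; rewrite ltr_norml; apply/andP; split; lra.
Qed.

(** Outside [I] the extension is the power series expanded at the nearest point of
[I], which is an endpoint; so both one-sided germs become two-sided ones. *)
Lemma analytic_extension (R : realType) (I : set R) (g : R -> R) :
  is_interval I -> (exists x y, [/\ I x, I y & x < y]) -> analytic_on I g ->
  exists h, (forall t, I t -> h t = g t) /\ (forall t, I t -> analytic_at h t).
Proof.
move=> iI [x0 [y0 [Ix0 Iy0 xy0]]] ga.
pose P t (cr : (nat -> R) * R) := I t -> 0 < cr.2 /\
    forall x, I x -> `|x - t| < cr.2 -> pseries cr.1 (x - t) @ \oo --> g x.
have : forall t, exists cr, P t cr.
  move=> t; have [/ga [c [r [r0 H]]]|nI] := pselect (I t); first by exists (c, r).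
  by exists (fun=> 0, 0).
move=> /choice [cr Hcr].
pose near_pt t := xget 0 [set a | I a /\ forall x, I x -> `|a - t| <= `|x - t|].
have near_ptI t : I t -> near_pt t = t.
  move=> It; have : (exists a, I a /\ forall x, I x -> `|a - t| <= `|x - t|).
    by exists t; split=> // x _; rewrite subrr normr0.
  move=> ex; have [_ /(_ t It)] := xgetPex 0 ex; rewrite -/(near_pt t).
  by rewrite subrr normr0 normr_le0 subr_eq0 => /eqP.
pose h t := limn (pseries (cr (near_pt t)).1 (t - near_pt t)).
have hg t : I t -> h t = g t.
  move=> It; rewrite /h near_ptI //.
  have [r0 H] := Hcr t It; apply/cvg_lim => //; apply: H => //.
  by rewrite subrr normr0.
exists h; split=> // t0 It0.
have [r0 H] := Hcr t0 It0; set r := (cr t0).2 in r0 H.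
have [x1 Ix1 [x1t0 x1r]] : exists2 x, I x & x != t0 /\ `|x - t0| < r.
  have nr : \forall x \near t0, `|x - t0| < r.
    by apply/nbhs_ballP; exists r => //= x; rewrite /ball /= distrC.
  have [al [be [ab abI]]] := near_subinterval iI (ex_intro _ x0 (ex_intro _ y0 (And3 Ix0 Iy0 xy0))) It0 nr.
  have [e|e] := eqVneq ((al + be) / 2) t0.
    have [|Iz zr] := abI (al + (be - al) / 4); first by apply/andP; split; lra.
    by exists (al + (be - al) / 4) => //; split=> //; rewrite -e; apply/eqP; lra.
  have [|Iz zr] := abI ((al + be) / 2); first by apply/andP; split; lra.
  by exists ((al + be) / 2).
have [dl dl0 Hdl] : exists2 d, 0 < d &
    forall t, t0 - d < t -> t < t0 -> ~ I t -> forall x, I x -> t0 <= x.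
  have [[x [Ix xt0]]|no] := pselect (exists x, I x /\ x < t0).
    exists (t0 - x); first lra.
    by move=> t t1 t2 []; apply: (iI x t0) => //; apply/andP; split; lra.
  exists 1 => // t _ _ _ x Ix; rewrite leNgt; apply/negP => xt.
  by apply: no; exists x.
have [dr dr0 Hdr] : exists2 d, 0 < d &
    forall t, t < t0 + d -> t0 < t -> ~ I t -> forall x, I x -> x <= t0.
  have [[x [Ix xt0]]|no] := pselect (exists x, I x /\ t0 < x).
    exists (x - t0); first lra.
    by move=> t t1 t2 []; apply: (iI t0 x) => //; apply/andP; split; lra.
  exists 1 => // t _ _ _ x Ix; rewrite leNgt; apply/negP => xt.
  by apply: no; exists x.
have x1pos : 0 < `|x1 - t0| by rewrite normr_gt0 subr_eq0.
exists (cr t0).1, (Num.min `|x1 - t0| (Num.min dl dr)); split.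
  by rewrite !lt_min x1pos dl0.
move=> t; rewrite !lt_min => /and3P[tx tdl tdr].
have tr : `|t - t0| < r by apply: lt_trans x1r.
have [It|nIt] := pselect (I t); first by rewrite hg //; exact: H.
have pi_t : near_pt t = t0.
  have cand : (forall x, I x -> `|t0 - t| <= `|x - t|) ->
      I (near_pt t) /\ forall x, I x -> `|near_pt t - t| <= `|x - t|.
    move=> Ht; have : exists a, I a /\ forall x, I x -> `|a - t| <= `|x - t|.
      by exists t0.
    by move=> ex; exact: (xgetPex 0 ex).
  have [tt0|t0t|e] := ltgtP t t0; last by case: nIt; rewrite e.
    have low : forall x, I x -> t0 <= x.
      by apply: (Hdl t) => //; move: tdl; rewrite ltr_norml => /andP[]; lra.
    have [|Ip /(_ t0 It0)] := cand.
      by move=> x /low tx0; rewrite !ger0_norm; lra.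
    have := low _ Ip => l1; rewrite !ger0_norm; lra.
  have up : forall x, I x -> x <= t0.
    by apply: (Hdr t) => //; move: tdr; rewrite ltr_norml => /andP[]; lra.
  have [|Ip /(_ t0 It0)] := cand.
    by move=> x /up tx0; rewrite !ler0_norm; lra.
  have := up _ Ip => l1; rewrite !ler0_norm; lra.
rewrite /h pi_t.
have : cvgn (pseries (cr t0).1 (t - t0)) by
  apply: (@is_cvg_pseries_inside _ _ (x1 - t0)) => //; apply/cvg_ex; exists (g x1); exact: H.
exact.
Qed.

Lemma is_derive0_cst (R : realType) (I : set R) (f : R -> R) :
  is_interval I -> (forall t, I t -> is_derive t 1 f 0) ->
  forall x y, I x -> I y -> f x = f y.
Proof.
move=> iI df x y Ix Iy.
wlog xy : x y Ix Iy / x <= y.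
  by move=> H; have [|/ltW] := leP x y; [exact: H|move=> yx; apply/esym; exact: H].
have Ixy z : z \in `[x, y] -> I z by rewrite in_itv /= => zxy; exact: (iI x y).
have [||c _ e] := @MVT_segment R f (cst 0) x y xy.
- by move=> z zxy; apply: df; apply: Ixy; apply: subset_itv_oo_cc.
- apply: derivable_within_continuous => z zxy; by have [] := df z (Ixy _ zxy).
by move: e; rewrite mul0r => /eqP; rewrite subr_eq0 => /eqP.
Qed.

(** Gronwall's argument: [Z ^+ 2] times [expR (2 * K * x)] is nondecreasing, and
times [expR (- 2 * K * x)] it is nonincreasing; the first forces [Z] to vanish to the
left of its zero, the second to the right. *)
Lemma linear_ode_zero (R : realType) (I : set R) (Z dZ : R -> R) (K t1 : R) :
  is_interval I -> I t1 -> (forall t, I t -> is_derive t 1 Z (dZ t)) ->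
  (forall t, I t -> `|dZ t| <= K * `|Z t|) -> Z t1 = 0 ->
  forall t, I t -> Z t = 0.
Proof.
move=> iI It1 dZt bZ Z0 t It.
pose F s (x : R) := Z x ^+ 2 * expR (s * (2 * K) * x).
have dF s x : I x -> is_derive x 1 (F s)
    ((2 * (Z x * dZ x) + s * (2 * K) * Z x ^+ 2) * expR (s * (2 * K) * x)).
  move=> Ix; have dz := dZt _ Ix; apply: is_derive_eq.
  by rewrite /GRing.scale /=; ring.
have bound x : I x -> `|Z x * dZ x| <= K * Z x ^+ 2.
  move=> Ix; rewrite normrM mulrC -(real_normK (num_real (Z x))) expr2 mulrA.
  by rewrite ler_wpM2r // bZ.
have Fpos s : 0 <= F s t by rewrite /F mulr_ge0 ?sqr_ge0 ?expR_ge0.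
have F1 s : F s t1 = 0 by rewrite /F Z0 expr0n mul0r.
suff [s Fs] : exists s, F s t <= 0.
  have : F s t == 0 by rewrite eq_le Fs Fpos.
  by rewrite /F mulf_eq0 (gt_eqF (expR_gt0 _)) orbF sqrf_eq0 => /eqP.
have cF s x y : x <= y -> I x -> I y -> exists2 c, I c & F s y - F s x =
    ((2 * (Z c * dZ c) + s * (2 * K) * Z c ^+ 2) * expR (s * (2 * K) * c)) * (y - x).
  move=> xy Ix Iy.
  have Ixy z : z \in `[x, y] -> I z by rewrite in_itv /= => zxy; exact: (iI x y).
  have [||c cxy e] := @MVT_segment R (F s) (fun c =>
      (2 * (Z c * dZ c) + s * (2 * K) * Z c ^+ 2) * expR (s * (2 * K) * c)) x y xy.
  - by move=> z zxy; apply: dF; apply: Ixy; apply: subset_itv_oo_cc.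
  - by apply: derivable_within_continuous => z zxy; have [] := dF s z (Ixy _ zxy).
  by exists c => //; exact: Ixy.
have [tt1|/ltW t1t] := leP t t1.
  exists 1; have [c Ic e] := cF 1 _ _ tt1 It It1.
  move: e; rewrite F1 sub0r => /eqP; rewrite eqr_oppLR => /eqP ->.
  rewrite oppr_le0 mulr_ge0 ?subr_ge0 // mulr_ge0 ?expR_ge0 //.
  have := bound _ Ic; rewrite ler_norml => /andP[]; lra.
exists (-1); have [c Ic e] := cF (-1) _ _ t1t It1 It.
move: e; rewrite F1 subr0 => ->.
rewrite mulr_le0_ge0 ?subr_ge0 // mulr_le0_ge0 ?expR_ge0 //.
have := bound _ Ic; rewrite ler_norml => /andP[]; lra.
Qed.

(** * Double power series *)

Lemma coord_le_norm (R : realType) m n (h : 'M[R]_(m, n)) i j : `|h i j| <= `|h|.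
Proof.
rewrite [leRHS]mx_normrE.
exact: (@le_bigmax _ _ _ 0 (fun ij : 'I_m * 'I_n => `|h ij.1 ij.2|) (i, j)).
Qed.

Lemma norm_lt_coord (R : realType) m n (h : 'M[R]_(m, n)) r :
  0 < r -> (forall i j, `|h i j| < r) -> `|h| < r.
Proof. by move=> r0 H; rewrite [ltLHS]mx_normrE; apply/bigmax_ltP; split. Qed.

Lemma norm_le_coord (R : realType) m n (h : 'M[R]_(m, n)) r :
  0 <= r -> (forall i j, `|h i j| <= r) -> `|h| <= r.
Proof. by move=> r0 H; rewrite [leLHS]mx_normrE; apply/bigmax_leP; split. Qed.

Definition vec2 (R : realType) (x y : R) : 'cV[R]_2 := \col_(i < 2) [:: x; y]`_i.

Lemma vec2E (R : realType) (h : 'cV[R]_2) : h = vec2 (h 0 0) (h 1 0).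
Proof.
apply/colP => i; rewrite !mxE; case: i => -[|[|//]] i /=.
  by congr (h _ _); apply/val_inj.
by congr (h _ _); apply/val_inj.
Qed.

Lemma vec2_0 (R : realType) (x y : R) : vec2 x y 0 0 = x.
Proof. by rewrite mxE. Qed.

Lemma vec2_1 (R : realType) (x y : R) : vec2 x y 1 0 = y.
Proof. by rewrite mxE. Qed.

Lemma norm_vec2_lt (R : realType) (x y r : R) :
  `|x| < r -> `|y| < r -> `|vec2 x y| < r.
Proof.
move=> xr yr; apply: norm_lt_coord; first by apply: le_lt_trans xr.
move=> i j; rewrite ord1 mxE; case: i => -[|[|//]] i /=; by [].
Qed.

Definition hpart (R : realType) (c : nat -> nat -> R) (k : nat) (x y : R) :=
  \sum_(i < k.+1) c i (k - i)%N * x ^+ i * y ^+ (k - i).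

Definition hnorm (R : realType) (c : nat -> nat -> R) (k : nat) : R :=
  \sum_(i < k.+1) `|c i (k - i)%N|.

Lemma hnorm_ge0 (R : realType) (c : nat -> nat -> R) k : 0 <= hnorm c k.
Proof. exact: sumr_ge0. Qed.

Lemma hpart_abs (R : realType) (c : nat -> nat -> R) k x y m :
  `|x| <= m -> `|y| <= m ->
  \sum_(i < k.+1) `|c i (k - i)%N * x ^+ i * y ^+ (k - i)| <= hnorm c k * m ^+ k.
Proof.
move=> xm ym; have m0 : 0 <= m by apply: le_trans xm.
rewrite mulr_suml; apply: ler_sum => i _.
have ik : (i <= k)%N by rewrite -ltnS.
rewrite !normrM !normrX -mulrA ler_wpM2l // -[in leRHS](subnKC ik) exprD.
by rewrite ler_pM ?exprn_ge0 //; apply: lerXn2r; rewrite ?qualifE /=.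
Qed.

Lemma hpart_le (R : realType) (c : nat -> nat -> R) k x y m :
  `|x| <= m -> `|y| <= m -> `|hpart c k x y| <= hnorm c k * m ^+ k.
Proof.
by move=> xm ym; apply: le_trans (hpart_abs c k xm ym); exact: ler_norm_sum.
Qed.

Definition power_series2_at (R : realType) (f : 'cV[R]_2 -> R) (w : 'cV[R]_2)
    (c : nat -> nat -> R) (r : R) :=
  [/\ 0 < r, coef_bounded (hnorm c) r & forall h : 'cV[R]_2, `|h| < r ->
    series (fun k => hpart c k (h 0 0) (h 1 0)) @ \oo --> f (w + h)].

Lemma analytic_at2P (R : realType) (f : 'cV[R]_2 -> R) (w : 'cV[R]_2) :
  analytic_at2 f w <-> exists c r, power_series2_at f w c r.
Proof.
split=> [[c [r [r0 H]]]|[c [r [r0 cb H]]]]; exists c, r.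
  split=> // [|h /H[]//]; apply: cvg_coef_bounded => x x0 xr.
  have hx : `|vec2 x x| < r by rewrite norm_vec2_lt ?ger0_norm.
  have [+ _] := H _ hx; rewrite vec2_0 vec2_1.
  rewrite /pseries (_ : (fun k => \sum_(i < k.+1) _) = fun k => hnorm c k * x ^+ k) //.
  apply/funext => k; rewrite mulr_suml; apply: eq_bigr => i _.
  have ik : (i <= k)%N by rewrite -ltnS.
  by rewrite !normrM !normrX (ger0_norm x0) -mulrA -exprD subnKC.
split=> // h hr; split; last exact: H.
have [B hB] := cb _ (normr_ge0 h) hr.
apply: (@bounded_series_cvg _ _ B) => [k|N]; first exact: sumr_ge0.
apply: le_trans (hB N); apply: ler_sum => k _.
rewrite (ger0_norm (hnorm_ge0 _ _)) //.
by apply: hpart_abs; exact: coord_le_norm.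
Qed.

Lemma power_series2_taylor (R : realType) (f : 'cV[R]_2 -> R) w c r m :
  power_series2_at f w c r -> exists C rho, [/\ 0 <= C, 0 < rho &
   forall x y s, `|x| <= s -> `|y| <= s -> s <= rho ->
    `|f (w + vec2 x y) - \sum_(k < m) hpart c k x y| <= C * s ^+ m].
Proof.
move=> [r0 cb H].
have r2 : 0 < r / 2 by lra.
have [|B hB] := cb _ (ltW r2); first by lra.
have B0 : 0 <= B by have := hB 0%N; rewrite big_ord0.
exists (B / (r / 2) ^+ m), (r / 2); split=> // [|x y s xs ys sr].
  by rewrite divr_ge0 ?exprn_ge0 // ltW.
have s0 : 0 <= s by apply: le_trans xs.
have hs : `|vec2 x y| < r by apply: norm_vec2_lt; lra.
have := @series_tail_le R (fun k => hpart c k x y) (fun k => `|hnorm c k|) s (r / 2)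
  B (f (w + vec2 x y)) m s0 sr r2 (fun=> normr_ge0 _).
rewrite expr_div_n mulrA mulrAC; apply=> //.
  by move=> k; rewrite (ger0_norm (hnorm_ge0 _ _)) // hpart_le.
by have := H _ hs; rewrite vec2_0 vec2_1.
Qed.

(** A quadratic bound on the remainder is what survives the limit of the partial
sums of a series. *)
Lemma is_derive_quadratic (R : realType) (V W : normedModType R) (f : V -> W)
    (x v : V) (l : W) (B eta : R) : 0 < eta ->
  (forall e : R, `|e| < eta -> `|f (x + e *: v) - f x - e *: l| <= B * e ^+ 2) ->
  is_derive x v f l.
Proof.
move=> eta0 H.
suff L : h^-1 *: ((f \o shift x) (h *: v) - f x) @[h --> 0^'] --> l.
  by split; [apply/cvg_ex; exists l|exact: cvg_lim].
apply/cvgrPdist_le => eps eps0.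
near=> h.
have h0 : h != 0 by near: h; exact: nbhs_dnbhs_neq.
have hn : 0 < `|h| by rewrite normr_gt0.
have heta : `|h| < eta.
  near: h; apply/nbhs_ballP; exists eta => //= y; rewrite /ball /= sub0r normrN //.
have hB : `|h| <= eps / (`|B| + 1).
  near: h; apply/nbhs_ballP; exists (eps / (`|B| + 1)) => /=.
    by rewrite divr_gt0 // ltr_wpDl.
  by move=> y; rewrite /ball /= sub0r normrN => /ltW.
rewrite -normrN opprB /= [h *: v + x]addrC.
have -> : h^-1 *: (f (x + h *: v) - f x) - l =
    h^-1 *: (f (x + h *: v) - f x - h *: l).
  by rewrite [RHS]scalerBr scalerA mulVf // scale1r.
rewrite normrZ normfV ler_pdivrMl //.
apply: (le_trans (H _ heta)).
have : `|h| * (`|B| + 1) <= eps by rewrite -ler_pdivlMr // ltr_wpDl.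
rewrite -(real_normK (num_real h)) expr2 mulrA [B * _]mulrC -mulrA ler_pM2l //.
have := ler_wpM2r (ltW hn) (ler_norm B); rewrite mulrDr mulr1; lra.
Unshelve. all: by end_near. Qed.

(** Induction on [i]; multiplying by [rho ^+ 2] instead of lowering the power of
[rho] makes the bound uniform in [i], including [i = 0] and [i = 1]. *)
Lemma monomial_derive_le (R : realType) (x e rho : R) (i : nat) :
  0 < rho -> `|x| <= rho -> `|x + e| <= rho ->
  rho ^+ 2 * `|(x + e) ^+ i - x ^+ i - e * (i%:R * x ^+ i.-1)| <=
  e ^+ 2 * (i%:R ^+ 2 * rho ^+ i).
Proof.
move=> rho0 xr xer; elim: i => [|i IH].
  by rewrite !expr0 subrr mul0r mulr0 subrr normr0 expr0n mul0r !mulr0.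
have -> : (x + e) ^+ i.+1 - x ^+ i.+1 - e * (i.+1%:R * x ^+ i.+1.-1) =
    (x + e) * ((x + e) ^+ i - x ^+ i - e * (i%:R * x ^+ i.-1))
    + e ^+ 2 * (i%:R * x ^+ i.-1).
  case: i {IH} => [|i] /=; first by rewrite !expr0 !expr1; ring.
  by rewrite -[in LHS]natr1 !exprS; ring.
have T2 : rho ^+ 2 * `|e ^+ 2 * (i%:R * x ^+ i.-1)| <= e ^+ 2 * (i%:R * rho ^+ i.+1).
  case: i {IH} => [|i]; first by rewrite !mul0r !mulr0 normr0 mulr0.
  rewrite normrM normrX real_normK ?num_real // normrM normr_nat normrX.
  rewrite [leLHS](_ : _ = e ^+ 2 * (i.+1%:R * (`|x| ^+ i * rho ^+ 2))); last by ring.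
  rewrite [leRHS](_ : _ = e ^+ 2 * (i.+1%:R * (rho ^+ i * rho ^+ 2))); last first.
    by rewrite -[i.+2]addn2 exprD.
  rewrite ler_wpM2l ?sqr_ge0 // ler_wpM2l // ler_wpM2r ?sqr_ge0 //.
  by rewrite lerXn2r // qualifE /= ltW.
apply: le_trans (ler_wpM2l (sqr_ge0 rho) (ler_normD _ _)) _.
rewrite mulrDr normrM.
have T1 : rho ^+ 2 * (`|x + e| * `|(x + e) ^+ i - x ^+ i - e * (i%:R * x ^+ i.-1)|)
   <= rho * (e ^+ 2 * (i%:R ^+ 2 * rho ^+ i)).
  by rewrite mulrCA ler_pM // mulr_ge0 ?sqr_ge0.
apply: le_trans (lerD T1 T2) _.
have -> : rho * (e ^+ 2 * (i%:R ^+ 2 * rho ^+ i)) + e ^+ 2 * (i%:R * rho ^+ i.+1) =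
  e ^+ 2 * ((i%:R ^+ 2 + i%:R) * rho ^+ i.+1) by rewrite [rho ^+ i.+1]exprS; ring.
rewrite ler_wpM2l ?sqr_ge0 // ler_wpM2r ?exprn_ge0 ?(ltW rho0) //.
have := ler0n R i; rewrite -natr1; nra.
Qed.

Section termwise.
Variables (R : realType) (f : 'cV[R]_2 -> R) (w : 'cV[R]_2).
Variables (c c' : nat -> nat -> R) (r : R) (v : 'cV[R]_2).

Let D k x y := if k is k'.+1 then hpart c' k' x y else 0.

Hypothesis fc : power_series2_at f w c r.
Hypothesis c'r : coef_bounded (hnorm c') r.
Hypothesis v1 : `|v| <= 1.
Hypothesis estimate : forall rho x y e k, 0 < rho -> `|x| <= rho -> `|y| <= rho ->
  `|x + e * v 0 0| <= rho -> `|y + e * v 1 0| <= rho ->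
  rho ^+ 2 * `|hpart c k (x + e * v 0 0) (y + e * v 1 0) - hpart c k x y
     - e * D k x y| <= e ^+ 2 * (k%:R ^+ 2 * (hnorm c k * rho ^+ k)).

(** Differentiation term by term: the second-order remainders of the homogeneous
parts are summable inside the disc of convergence. *)
Lemma termwise_is_derive h : `|h| < r ->
  is_derive (w + h) v f (limn (series (fun k => hpart c' k (h 0 0) (h 1 0)))).
Proof.
move=> hr; have [r0 cr H] := fc.
have [rho /andP[hrho rhor]] : exists rho : R, `|h| < rho < r.
  by exists ((`|h| + r) / 2); apply/andP; split; lra.
have rho0 : 0 < rho by apply: le_lt_trans hrho.
set L := limn _.
have cL : series (fun k => hpart c' k (h 0 0) (h 1 0)) @ \oo --> L.
  have [B hB] := c'r (ltW rho0) rhor.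
  apply: normed_cvg; apply: (@bounded_series_cvg _ _ B) => [k|N]; first exact: normr_ge0.
  apply: le_trans (hB N); apply: ler_sum => k _.
  rewrite ger0_norm ?hnorm_ge0 //; apply: hpart_le.
    by apply: le_trans (coord_le_norm _ _ _) (ltW hrho).
  by apply: le_trans (coord_le_norm _ _ _) (ltW hrho).
have [B hB] := coef_boundedMn (coef_boundedMn cr) (ltW rho0) rhor.
apply: (@is_derive_quadratic _ _ _ _ _ _ _ (B / rho ^+ 2) (rho - `|h|)).
  by rewrite subr_gt0.
move=> e eh; rewrite -(addrA w h).
have ev : `|h + e *: v| <= rho.
  apply: (le_trans (ler_normD _ _)); rewrite normrZ.
  by have := ler_wpM2l (normr_ge0 e) v1; rewrite mulr1; lra.
have step N : `|series (fun k => hpart c k ((h + e *: v) 0 0) ((h + e *: v) 1 0)) N.+1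
    - series (fun k => hpart c k (h 0 0) (h 1 0)) N.+1
    - e * series (fun k => hpart c' k (h 0 0) (h 1 0)) N| <= B / rho ^+ 2 * e ^+ 2.
  rewrite /series /= !big_mkord.
  have -> : \sum_(k < N) hpart c' k (h 0 0) (h 1 0) =
      \sum_(k < N.+1) D k (h 0 0) (h 1 0).
    by rewrite big_ord_recl /= add0r.
  rewrite mulr_sumr -!sumrB mulrAC ler_pdivlMr ?exprn_gt0 // mulrC.
  apply: le_trans (ler_wpM2l (sqr_ge0 rho) (ler_norm_sum _ _ _)) _.
  rewrite mulr_sumr [leRHS]mulrC; apply: le_trans (ler_wpM2l (sqr_ge0 e) (hB N.+1)).
  rewrite mulr_sumr; apply: ler_sum => k _.
  have co i : `|h i 0| <= rho by apply: le_trans (coord_le_norm _ _ _) (ltW hrho).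
  have ce i : `|(h + e *: v) i 0| <= rho by apply: le_trans (coord_le_norm _ _ _) ev.
  have := @estimate rho (h 0 0) (h 1 0) e k rho0 (co 0) (co 1).
  have := ce 0; have := ce 1; rewrite !mxE => c1 c0 /(_ c0 c1).
  by rewrite !normrM !normr_nat ger0_norm ?hnorm_ge0 // expr2 !mulrA.
have lims : (fun N => `|series (fun k => hpart c k ((h + e *: v) 0 0) ((h + e *: v) 1 0)) N.+1
    - series (fun k => hpart c k (h 0 0) (h 1 0)) N.+1
    - e * series (fun k => hpart c' k (h 0 0) (h 1 0)) N|) @ \oo -->
    `|f (w + (h + e *: v)) - f (w + h) - e * L|.
  apply: cvg_norm; apply: cvgB; first apply: cvgB.
  - by rewrite (cvg_shiftS (series _)); apply: H; exact: le_lt_trans rhor.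
  - by rewrite (cvg_shiftS (series _)); exact: H.
  - by apply: cvgM => //; exact: cvg_cst.
change (`|f (w + (h + e *: v)) - f (w + h) - e * L| <= B / rho ^+ 2 * e ^+ 2).
rewrite -(cvg_lim _ lims) //; apply: limr_le; first by apply/cvg_ex; eexists; exact: lims.
by near=> N; exact: step.
Unshelve. all: by end_near. Qed.

Lemma termwise_power_series2 : power_series2_at ('D_v f) w c' r.
Proof.
have [r0 cr H] := fc; split=> // h hr.
have := termwise_is_derive hr => D1; rewrite (@derive_val _ _ _ _ _ _ _ D1).
apply: normed_cvg; have [B hB] := c'r (normr_ge0 h) hr.
apply: (@bounded_series_cvg _ _ B) => [k|N]; first exact: normr_ge0.
apply: le_trans (hB N); apply: ler_sum => k _.
by rewrite ger0_norm ?hnorm_ge0 //; apply: hpart_le; exact: coord_le_norm.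
Qed.

End termwise.

Definition coef_dx (R : realType) (c : nat -> nat -> R) i j := i.+1%:R * c i.+1 j.
Definition coef_dy (R : realType) (c : nat -> nat -> R) i j := j.+1%:R * c i j.+1.

Lemma hnorm_dx (R : realType) (c : nat -> nat -> R) k :
  hnorm (coef_dx c) k <= pseries_diffs (hnorm c) k.
Proof.
rewrite /pseries_diffs /hnorm mulr_sumr [leRHS]big_ord_recl.
apply: ler_wpDl; first by rewrite mulr_ge0.
apply: ler_sum => i _; rewrite /coef_dx normrM normr_nat /= /bump /= add1n subSS.
by rewrite ler_wpM2r // ler_nat.
Qed.

Lemma hpart_swap (R : realType) (c : nat -> nat -> R) k x y :
  hpart (fun i j => c j i) k y x = hpart c k x y.
Proof.
rewrite /hpart [LHS](reindex_inj rev_ord_inj) /=; apply: eq_bigr => i _.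
have ik : (i <= k)%N by rewrite -ltnS.
by rewrite subSS subKn // mulrAC.
Qed.

Lemma hnorm_swap (R : realType) (c : nat -> nat -> R) k :
  hnorm (fun i j => c j i) k = hnorm c k.
Proof.
rewrite /hnorm [LHS](reindex_inj rev_ord_inj) /=; apply: eq_bigr => i _.
have ik : (i <= k)%N by rewrite -ltnS.
by rewrite subSS subKn.
Qed.

Lemma hnorm_dy (R : realType) (c : nat -> nat -> R) k :
  hnorm (coef_dy c) k <= pseries_diffs (hnorm c) k.
Proof.
rewrite -hnorm_swap; apply: (le_trans (hnorm_dx (fun i j => c j i) k)).
by rewrite /pseries_diffs hnorm_swap.
Qed.

Lemma coef_bounded_le (R : realType) (a b : nat -> R) r :
  (forall k, `|a k| <= `|b k|) -> coef_bounded b r -> coef_bounded a r.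
Proof.
move=> ab br rho rho0 rhor; have [B hB] := br _ rho0 rhor.
exists B => N; apply: le_trans (hB N); apply: ler_sum => k _.
by rewrite ler_wpM2r // exprn_ge0.
Qed.

Lemma coef_bounded_dx (R : realType) (c : nat -> nat -> R) r :
  coef_bounded (hnorm c) r -> coef_bounded (hnorm (coef_dx c)) r.
Proof.
move=> /pseries_diffs_bounded; apply: coef_bounded_le => k.
rewrite ger0_norm ?hnorm_ge0 //; apply: le_trans (hnorm_dx c k) (ler_norm _).
Qed.

Lemma coef_bounded_dy (R : realType) (c : nat -> nat -> R) r :
  coef_bounded (hnorm c) r -> coef_bounded (hnorm (coef_dy c)) r.
Proof.
move=> /pseries_diffs_bounded; apply: coef_bounded_le => k.
rewrite ger0_norm ?hnorm_ge0 //; apply: le_trans (hnorm_dy c k) (ler_norm _).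
Qed.

Lemma hpart_dx (R : realType) (c : nat -> nat -> R) k x y :
  hpart (coef_dx c) k x y =
  \sum_(i < k.+2) c i (k.+1 - i)%N * (i%:R * x ^+ i.-1) * y ^+ (k.+1 - i).
Proof.
rewrite big_ord_recl !mul0r mulr0 mul0r add0r; apply: eq_bigr => i _.
by rewrite /coef_dx /= /bump /= add1n subSS; ring.
Qed.

Lemma estimate_dx (R : realType) (c : nat -> nat -> R) rho x y e k : 0 < rho ->
  `|x| <= rho -> `|y| <= rho -> `|x + e| <= rho ->
  rho ^+ 2 * `|hpart c k (x + e) y - hpart c k x y
     - e * (if k is k'.+1 then hpart (coef_dx c) k' x y else 0)|
  <= e ^+ 2 * (k%:R ^+ 2 * (hnorm c k * rho ^+ k)).
Proof.
move=> rho0 xr yr xer.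
have -> : (if k is k'.+1 then hpart (coef_dx c) k' x y else 0) =
    \sum_(i < k.+1) c i (k - i)%N * (i%:R * x ^+ i.-1) * y ^+ (k - i).
  case: k => [|k]; last exact: hpart_dx.
  by rewrite big_ord_recl big_ord0 !mul0r mulr0 mul0r addr0.
rewrite mulr_sumr -!sumrB.
apply: le_trans (ler_wpM2l (sqr_ge0 rho) (ler_norm_sum _ _ _)) _.
rewrite mulr_suml !mulr_sumr; apply: ler_sum => i _.
have ik : (i <= k)%N by rewrite -ltnS.
have -> : c i (k - i)%N * (x + e) ^+ i * y ^+ (k - i) -
   c i (k - i)%N * x ^+ i * y ^+ (k - i) -
   e * (c i (k - i)%N * (i%:R * x ^+ i.-1) * y ^+ (k - i)) =
  c i (k - i)%N * y ^+ (k - i) * ((x + e) ^+ i - x ^+ i - e * (i%:R * x ^+ i.-1)).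
  by ring.
rewrite normrM mulrCA.
apply: le_trans (ler_wpM2l (normr_ge0 _) (monomial_derive_le i rho0 xr xer)) _.
rewrite normrM normrX.
have -> : e ^+ 2 * (k%:R ^+ 2 * (`|c i (k - i)%N| * rho ^+ k)) =
  (`|c i (k - i)%N| * rho ^+ (k - i)) * (e ^+ 2 * (k%:R ^+ 2 * rho ^+ i)).
  have -> : rho ^+ k = rho ^+ i * rho ^+ (k - i) by rewrite -exprD subnKC.
  by ring.
apply: ler_pM.
- by rewrite mulr_ge0 // exprn_ge0.
- by rewrite mulr_ge0 ?sqr_ge0 // mulr_ge0 ?sqr_ge0 // exprn_ge0 // ltW.
- rewrite ler_wpM2l //; apply: lerXn2r; rewrite ?qualifE //=; exact: ltW.
rewrite ler_wpM2l ?sqr_ge0 // ler_wpM2r ?exprn_ge0 ?(ltW rho0) //.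
by apply: lerXn2r; rewrite ?qualifE /= ?ler0n ?ler_nat.
Qed.

Lemma estimate_dy (R : realType) (c : nat -> nat -> R) rho x y e k : 0 < rho ->
  `|x| <= rho -> `|y| <= rho -> `|y + e| <= rho ->
  rho ^+ 2 * `|hpart c k x (y + e) - hpart c k x y
     - e * (if k is k'.+1 then hpart (coef_dy c) k' x y else 0)|
  <= e ^+ 2 * (k%:R ^+ 2 * (hnorm c k * rho ^+ k)).
Proof.
move=> rho0 xr yr yer; have := estimate_dx (fun i j => c j i) k rho0 yr xr yer.
rewrite (hpart_swap c k x (y + e)) (hpart_swap c k x y) (hnorm_swap c).
by case: k => [|k] //; rewrite -(hpart_swap (coef_dy c)).
Qed.

Lemma norm_delta_mx (R : realType) (i : 'I_2) : `|delta_mx i 0 : 'cV[R]_2| <= 1.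
Proof.
by apply: norm_le_coord => // k j; rewrite mxE; case: (_ && _); rewrite ?normr1 ?normr0.
Qed.

Lemma power_series2_dx (R : realType) (f : 'cV[R]_2 -> R) w c r :
  power_series2_at f w c r ->
  power_series2_at ('D_(delta_mx 0 0) f) w (coef_dx c) r.
Proof.
move=> fc; have [_ cr _] := fc.
apply: (termwise_power_series2 fc (coef_bounded_dx cr) (norm_delta_mx _ _)).
by move=> rho x y e k; rewrite !mxE /= mulr1 mulr0 addr0 => *; exact: estimate_dx.
Qed.

Lemma power_series2_dy (R : realType) (f : 'cV[R]_2 -> R) w c r :
  power_series2_at f w c r ->
  power_series2_at ('D_(delta_mx 1 0) f) w (coef_dy c) r.
Proof.
move=> fc; have [_ cr _] := fc.
apply: (termwise_power_series2 fc (coef_bounded_dy cr) (norm_delta_mx _ _)).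
by move=> rho x y e k; rewrite !mxE /= mulr1 mulr0 addr0 => *; exact: estimate_dy.
Qed.

Lemma power_series2_at0 (R : realType) (f : 'cV[R]_2 -> R) w c r :
  power_series2_at f w c r -> f w = c 0%N 0%N.
Proof.
move=> [r0 _ H]; have := H 0; rewrite normr0 addr0 => /(_ r0) cf.
apply: (cvg_unique _ cf) => //.
pose u := series (fun k => hpart c k ((0 : 'cV[R]_2) 0 0) ((0 : 'cV[R]_2) 1 0)).
suff e : (fun n => u n.+1) = cst (c 0%N 0%N).
  have cu : (fun n => u n.+1) @ \oo --> c 0%N 0%N by rewrite e; exact: cvg_cst.
  have cu' : u @ \oo --> c 0%N 0%N by move: cu; rewrite (cvg_shiftS u).
  exact: cu'.
apply/funext => n; rewrite /u /series /= big_mkord big_ord_recl /=.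
rewrite /hpart big_ord_recl big_ord0 !expr0 !mulr1 addr0 big1 ?addr0 // => i _.
apply: big1 => -[[|j] jlt] _ /=; rewrite !mxE.
  by rewrite subn0 [X in _ * X]expr0n /= mulr0.
by rewrite [X in _ * X * _]expr0n /= mulr0 mul0r.
Qed.

Lemma hessianE (R : realType) (f : 'cV[R]_2 -> R) w c r :
  power_series2_at f w c r ->
  [/\ hessian f w 0 0 = 2 * c 2%N 0%N, hessian f w 0 1 = c 1%N 1%N,
      hessian f w 1 0 = c 1%N 1%N & hessian f w 1 1 = 2 * c 0%N 2%N].
Proof.
move=> fc; rewrite !mxE.
have fx := power_series2_dx fc; have fy := power_series2_dy fc.
rewrite (power_series2_at0 (power_series2_dx fx)) (power_series2_at0 (power_series2_dy fx)).
rewrite (power_series2_at0 (power_series2_dx fy)) (power_series2_at0 (power_series2_dy fy)).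
by rewrite /coef_dx /coef_dy !mul1r.
Qed.

(** * Vertical tangent planes *)

Lemma hpart0 (R : realType) (c : nat -> nat -> R) x y : hpart c 0 x y = c 0%N 0%N.
Proof. by rewrite /hpart big_ord_recl big_ord0 !expr0 !mulr1 addr0. Qed.

Lemma hpart1 (R : realType) (c : nat -> nat -> R) x y :
  hpart c 1 x y = c 1%N 0%N * x + c 0%N 1%N * y.
Proof. by rewrite /hpart !big_ord_recl big_ord0 /=; ring. Qed.

Lemma hpart2 (R : realType) (c : nat -> nat -> R) x y :
  hpart c 2 x y = c 2%N 0%N * x ^+ 2 + c 1%N 1%N * x * y + c 0%N 2%N * y ^+ 2.
Proof. by rewrite /hpart !big_ord_recl big_ord0 /=; ring. Qed.

Lemma mulmx2_continuous (R : realType) n (A : 'M[R]_(n, 2)) :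
  continuous (mulmx A : 'cV[R]_2 -> 'cV[R]_n).
Proof.
apply/(@linear_bounded_continuous _ _ _ (mulmx A : {linear 'cV[R]_2 -> 'cV[R]_n})).
apply/linear_boundedP; near=> K => h /=.
apply: (@le_trans _ _ (2 * `|A| * `|h|)).
  apply: norm_le_coord => [|i j]; first by rewrite !mulr_ge0.
  rewrite mxE !big_ord_recl big_ord0 addr0 ord1.
  have e k : `|A i k * h k 0| <= `|A| * `|h|.
    by rewrite normrM ler_pM // coord_le_norm.
  apply: (le_trans (ler_normD _ _)).
  have := e ord0; have := e (lift ord0 ord0); lra.
rewrite ler_wpM2r //; near: K; apply: nbhs_pinfty_ge; exact: num_real.
Unshelve. all: by end_near. Qed.

Lemma differentiable_of_bound (R : realType) (V W : normedModType R) (f : V -> W)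
    (df : {linear V -> W}) (x : V) : continuous df ->
  (forall eps, 0 < eps ->
     \forall h \near (0 : V), `|f (x + h) - f x - df h| <= eps * `|h|) ->
  differentiable f x.
Proof.
move=> cdf H.
have expansion : f \o shift x = cst (f x) + df +o_ 0 id.
  apply/eqaddoP => eps /H; apply: filterS => h.
  by rewrite !fctE /= [h + x]addrC opprD addrA.
by apply/diff_locallyP; rewrite (diff_unique cdf expansion).
Qed.

Lemma analytic_differentiable (R : realType) n (phi : 'cV[R]_2 -> 'cV[R]_n) w :
  (forall i, analytic_at2 (fun w' => phi w' i 0) w) -> differentiable phi w.
Proof.
move=> /(_ _)/analytic_at2P => H.
have /choice [c Hc] := H.
pose A : 'M[R]_(n, 2) := \matrix_(i, j) if j == 0 then c i 1%N 0%N else c i 0%N 1%N.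
have bound i : exists C rho, [/\ 0 <= C, 0 < rho & forall h, `|h| <= rho ->
    `|phi (w + h) i 0 - phi w i 0 - (A *m h) i 0| <= C * `|h| ^+ 2].
  have [r fc] := Hc i; have [C [rho [C0 r0 Ht]]] := power_series2_taylor 2 fc.
  exists C, rho; split=> // h hr.
  have := Ht (h 0 0) (h 1 0) `|h| (coord_le_norm _ _ _) (coord_le_norm _ _ _) hr.
  rewrite -vec2E !big_ord_recl big_ord0 addr0 hpart0 /bump /= hpart1.
  rewrite (power_series2_at0 fc) !mxE !big_ord_recl big_ord0 addr0 !mxE /= opprD addrA.
  have -> : lift ord0 ord0 = 1 :> 'I_2 by apply/val_inj.
  by [].
apply: (@differentiable_of_bound _ _ _ _ (mulmx A : {linear 'cV[R]_2 -> 'cV[R]_n})).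
  exact: mulmx2_continuous.
move=> eps eps0.
suff : \forall h \near (0 : 'cV[R]_2), forall i,
    `|phi (w + h) i 0 - phi w i 0 - (A *m h) i 0| <= eps * `|h|.
  apply: filterS => h Hh; apply: norm_le_coord; first by rewrite mulr_ge0 // ltW.
  move=> i j; rewrite ord1; have := Hh i.
  by rewrite ![in X in _ -> X]mxE [in X in X -> _]mxE.
refine (@filter_forall _ 'I_n (fun i h => is_true (`|phi (w + h) i 0 - phi w i 0 - (A *m h) i 0| <= eps * `|h|)) (nbhs (0 : 'cV[R]_2)) _ _) => i.
have [C [rho [C0 rho0 Hb]]] := bound i.
apply/nbhs_ballP; exists (Num.min rho (eps / (C + 1))) => /=.
  by rewrite lt_min rho0 divr_gt0 // ltr_wpDl.
move=> h; rewrite -ball_normE /= sub0r normrN lt_min => /andP[hr hC].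
apply: le_trans (Hb _ (ltW hr)) _; rewrite expr2 mulrA ler_wpM2r //.
move: hC; rewrite ltr_pdivlMr ?ltr_wpDl // => /ltW; apply: le_trans.
by rewrite mulrC ler_wpM2l // lerDl.
Qed.

Lemma vec3E (R : realType) (p : 'cV[R]_3) : p = vec3 (p 0 0) (p 1 0) (p 2%:R 0).
Proof.
apply/colP => i; rewrite !mxE; case: i => -[|[|[|//]]] i /=;
  by congr (p _ _); apply/val_inj.
Qed.

Lemma vec3_inj (R : realType) (x y z x' y' z' : R) :
  vec3 x y z = vec3 x' y' z' -> [/\ x = x', y = y' & z = z'].
Proof.
move=> /colP e; have := e 0; have := e 1; have := e 2%:R.
by rewrite !mxE /=.
Qed.

(** The top view of [D] has rank at most one, so it kills some nonzero vector; as [D]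
is injective, it takes this vector to a nonzero vertical one. *)
Lemma vertical_in_range (R : realType) (D : {linear 'cV[R]_2 -> 'cV[R]_3}) (l0 l1 : R) :
  injective D -> (l0 != 0 \/ l1 != 0) ->
  (forall v, l0 * D v 0 0 + l1 * D v 1 0 = 0) -> range D (vec3 0 0 1).
Proof.
move=> Dinj l Dl.
suff [v v0 [D0 D1]] : exists2 v, v != 0 & D v 0 0 = 0 /\ D v 1 0 = 0.
  have Dv : D v 2%:R 0 != 0.
    apply/negP => /eqP D2; case/negP: v0; apply/eqP/Dinj.
    by rewrite linear0 (vec3E (D v)) D0 D1 D2 [RHS]vec3E !mxE.
  exists ((D v 2%:R 0)^-1 *: v) => //; rewrite linearZ /=.
  have e k i : (k *: D v) i 0 = k * D v i 0 by rewrite mxE.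
  by rewrite [LHS]vec3E !e D0 D1 !mulr0 mulVf.
have ker i : exists2 v, v != 0 & D v i 0 = 0.
  set e0 := vec2 1 0 : 'cV[R]_2; set e1 := vec2 0 1 : 'cV[R]_2.
  have v2_0 x y : (x != 0 \/ y != 0) -> vec2 x y != 0 :> 'cV[R]_2.
    move=> xy; apply/eqP => /colP e; have := e 0; have := e 1; rewrite !mxE /= => y0 x0.
    by case: xy; rewrite ?x0 ?y0 eqxx.
  have [b0|b0] := eqVneq (D e0 i 0) 0.
    by exists e0 => //; apply: v2_0; left; exact: oner_neq0.
  exists (vec2 (D e1 i 0) (- D e0 i 0)); first by apply: v2_0; right; rewrite oppr_eq0.
  rewrite [vec2 _ _](_ : _ = D e1 i 0 *: e0 - D e0 i 0 *: e1).
    by rewrite linearB !linearZ !mxE; ring.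
  by rewrite [RHS]vec2E !mxE /= !mulr1 !mulr0 subr0 sub0r.
case: l => l; [have [v v0 Dv] := ker 1|have [v v0 Dv] := ker 0]; exists v => //; split=> //;
  by have /eqP := Dl v; rewrite Dv mulr0 ?addr0 ?add0r mulf_eq0 (negbTE l) => /eqP.
Qed.

(** Differentiating the relation at [p], where it holds with the factors
[q - p] equal to zero, shows that the top views of all tangent vectors lie on one
line.  This covers surfaces in a vertical plane (constant [m0], [m1]) and the points
of a helicoid on its axis.  At the boundary of [S] one-sided derivatives suffice: they
determine the differential of the chart on a half-plane, hence everywhere. *)
Lemma vertical_tangent (R : realType) (S : set 'cV[R]_3) p (m0 m1 : 'cV[R]_3 -> R) :
  analytic_surface S -> S p -> {for p, continuous m0} -> {for p, continuous m1} ->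
  (m0 p != 0 \/ m1 p != 0) ->
  (forall q, S q -> m0 q * (q 0 0 - p 0 0) + m1 q * (q 1 0 - p 1 0) = 0) ->
  tangent_plane S p (vec3 0 0 1).
Proof.
move=> [_ charts] Sp c0 c1 mp rel.
have [V [phi [chart [w Vw wp]]]] := charts p Sp.
have [oV an inj [W [oW img]] _] := chart.
exists V, phi, w; split=> //.
have Vw1 : V w by case: Vw.
have dphi := analytic_differentiable (an _ Vw1).
apply: (@vertical_in_range _ ('d phi w) (m0 p) (m1 p)) => //; first exact: inj.
have half (v : 'cV[R]_2) : 0 <= v 1 0 -> m0 p * ('d phi w v) 0 0 + m1 p * ('d phi w v) 1 0 = 0.
  move=> v0.
  have quot : h^-1 *: (phi (h *: v + w) - phi w) @[h --> 0^'+] --> 'd phi w v.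
    rewrite -deriveE //; apply: cvg_dnbhs_at_right; exact: (diff_derivable (v := v) dphi).
  have path : h *: v + w @[h --> (0:R)^'+] --> w.
    apply: cvg_at_right_filter; rewrite -[X in _ --> X]add0r -(scale0r v).
    by apply: cvgD; [apply: cvgZ; [exact: cvg_id|exact: cvg_cst]|exact: cvg_cst].
  have phic : phi (h *: v + w) @[h --> (0:R)^'+] --> p.
    by rewrite -wp; exact: (cvg_comp _ _ path (differentiable_continuous dphi)).
  have m0c := cvg_comp _ _ phic c0; have m1c := cvg_comp _ _ phic c1.
  have coord i : (h^-1 *: (phi (h *: v + w) - phi w)) i 0 @[h --> (0:R)^'+] -->
      ('d phi w v) i 0.
    by apply: (cvg_comp _ _ quot (@coord_continuous R 3 1 i 0 ('d phi w v))).
  have lim0 : m0 (phi (h *: v + w)) * (h^-1 *: (phi (h *: v + w) - phi w)) 0 0 +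
     m1 (phi (h *: v + w)) * (h^-1 *: (phi (h *: v + w) - phi w)) 1 0 @[h --> (0:R)^'+]
     --> m0 p * ('d phi w v) 0 0 + m1 p * ('d phi w v) 1 0.
    by apply: cvgD; apply: cvgM => //; exact: coord.
  apply: (cvg_unique _ lim0) => //.
  apply: (@cvg_trans _ (cst 0 @ (0:R)^'+)); last exact: cvg_cst.
  apply: near_eq_cvg; near=> h.
  have h0 : 0 < h by near: h; exact: nbhs_right_gt.
  have Sq : S (phi (h *: v + w)).
    have : (phi @` (V `&` half_plane R)) (phi (h *: v + w)).
      exists (h *: v + w) => //; split.
        near: h; apply: path; apply: open_nbhs_nbhs; split=> //.
      rewrite /half_plane /= !mxE; apply: addr_ge0; last by case: Vw.
      by rewrite mulr_ge0 // ltW.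
    by rewrite img => -[].
  have := rel _ Sq; rewrite -wp => e.
  have qe i : (h^-1 *: (phi (h *: v + w) - phi w)) i 0 =
      h^-1 * (phi (h *: v + w) i 0 - phi w i 0) by rewrite !mxE.
  rewrite !qe.
  rewrite mulrCA [X in _ = _ + X]mulrCA -mulrDr e mulr0 //.
move=> v; have [v0|/ltW v0] := leP 0 (v 1 0); first exact: half.
have := half (- v); rewrite linearN !mxE oppr_ge0 => /(_ v0); lra.
Unshelve. all: by end_near. Qed.

(** * Second-order contact *)

Definition bigO0 (R : realType) (m : nat) (F : R -> R) :=
  exists C rho, [/\ 0 <= C, 0 < rho &
    forall x, `|x| <= rho -> `|F x| <= C * `|x| ^+ m].

Lemma bigO0_ext (R : realType) m (F G : R -> R) : F =1 G -> bigO0 m F -> bigO0 m G.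
Proof. by move=> e [C [r [C0 r0 H]]]; exists C, r; split=> // x /H; rewrite e. Qed.

Lemma bigO0D (R : realType) m (F G : R -> R) :
  bigO0 m F -> bigO0 m G -> bigO0 m (fun x => F x + G x).
Proof.
move=> [C [r [C0 r0 H]]] [C' [r' [C0' r0' H']]].
exists (C + C'), (Num.min r r'); split; [exact: addr_ge0|by rewrite lt_min r0|].
move=> x; rewrite le_min => /andP[xr xr'].
by apply: (le_trans (ler_normD _ _)); rewrite mulrDl lerD // ?H ?H'.
Qed.

Lemma bigO0M (R : realType) m n (F G : R -> R) :
  bigO0 m F -> bigO0 n G -> bigO0 (m + n) (fun x => F x * G x).
Proof.
move=> [C [r [C0 r0 H]]] [C' [r' [C0' r0' H']]].
exists (C * C'), (Num.min r r'); split; [exact: mulr_ge0|by rewrite lt_min r0|].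
move=> x; rewrite le_min => /andP[xr xr'].
rewrite normrM exprD [leRHS](_ : _ = (C * `|x| ^+ m) * (C' * `|x| ^+ n)); last by ring.
by rewrite ler_pM ?H ?H'.
Qed.

Lemma bigO0_monomial (R : realType) m (k : R) : bigO0 m (fun x => k * x ^+ m).
Proof. by exists `|k|, 1; split=> // x _; rewrite normrM normrX. Qed.

Lemma bigO0Z (R : realType) m (k : R) (F : R -> R) :
  bigO0 m F -> bigO0 m (fun x => k * F x).
Proof.
move=> HF; apply: (@bigO0_ext _ (0 + m) (fun x => (k * x ^+ 0) * F x)).
  by move=> x; rewrite expr0 mulr1.
by apply: bigO0M => //; exact: bigO0_monomial.
Qed.

Lemma bigO0N (R : realType) m (F : R -> R) : bigO0 m F -> bigO0 m (fun x => - F x).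
Proof. by move=> HF; apply: (bigO0_ext _ (bigO0Z (-1) HF)) => x; rewrite mulN1r. Qed.

Lemma bigO0W (R : realType) m n (F : R -> R) : (n <= m)%N -> bigO0 m F -> bigO0 n F.
Proof.
move=> nm [C [r [C0 r0 H]]]; exists C, (Num.min r 1); split=> //.
  by rewrite lt_min r0 ltr01.
move=> x; rewrite le_min => /andP[xr x1]; apply: le_trans (H _ xr) _.
by rewrite ler_wpM2l // ler_wiXn2l.
Qed.

Definition clusters_at0 (R : realType) (A : set R) :=
  forall e, 0 < e -> exists x, [/\ x != 0, `|x| < e & A x].

Lemma bigO0_coef0 (R : realType) m (k : R) (F : R -> R) (A : set R) :
  bigO0 m.+1 F -> clusters_at0 A -> (forall x, A x -> k * x ^+ m + F x = 0) -> k = 0.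
Proof.
move=> [C [r [C0 r0 H]]] acc eq; apply/eqP/negPn/negP => k0.
have e0 : 0 < Num.min r (`|k| / (C + 1)).
  by rewrite lt_min r0 divr_gt0 ?normr_gt0 // ltr_wpDl.
have [x [x0 xe Ax]] := acc _ e0; move: xe; rewrite lt_min => /andP[xr xk].
have xp : 0 < `|x| by rewrite normr_gt0.
have /eqP := eq _ Ax; rewrite addr_eq0 => /eqP e.
have := H _ (ltW xr); rewrite -normrN -e normrM normrX exprSr mulrCA mulrC.
rewrite ler_pM2l ?exprn_gt0 // => kC; move: xk; rewrite ltr_pdivlMr ?ltr_wpDl //.
by nra.
Qed.

(** Inserting the curve into the expansion of [f] leaves a polynomial of degree two
that is of third order on the points of [A]; as these accumulate at [0], its
coefficients vanish one after the other. *)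
Lemma contact2 (R : realType) (f : 'cV[R]_2 -> R) w c r (X Y Z : R -> R) (A : set R)
    (a0 a1 a2 b0 b1 b2 : R) :
  power_series2_at f w c r -> clusters_at0 A ->
  bigO0 3 (fun x => X x - (a0 * x + b0 * x ^+ 2)) ->
  bigO0 3 (fun x => Y x - (a1 * x + b1 * x ^+ 2)) ->
  bigO0 3 (fun x => Z x - (a2 * x + b2 * x ^+ 2)) ->
  (forall x, A x -> f (w + vec2 (X x) (Y x)) = f w + Z x) ->
  a2 = c 1%N 0%N * a0 + c 0%N 1%N * a1 /\
  b2 = c 1%N 0%N * b0 + c 0%N 1%N * b1 + c 2%N 0%N * a0 ^+ 2
       + c 1%N 1%N * a0 * a1 + c 0%N 2%N * a1 ^+ 2.
Proof.
move=> fc acc HX HY HZ HA.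
have lin a b (G : R -> R) : bigO0 3 (fun x => G x - (a * x + b * x ^+ 2)) ->
    bigO0 1 G /\ bigO0 2 (fun x => G x - a * x).
  move=> HG; have b2' := bigO0_monomial 2 b; have b1' := bigO0_monomial 1 a.
  have G2 : bigO0 2 (fun x => G x - a * x).
    apply: (bigO0_ext _ (bigO0D (@bigO0W _ 3 2 _ isT HG) b2')) => x /=; ring.
  split=> //; apply: (bigO0_ext _ (bigO0D (@bigO0W _ 2 1 _ isT G2) b1')) => x /=.
  by rewrite expr1 subrK.
have [X1 X2] := lin _ _ _ HX; have [Y1 Y2] := lin _ _ _ HY.
have prod a a' (F G : R -> R) : bigO0 1 F -> bigO0 1 G -> bigO0 2 (fun x => F x - a * x) ->
    bigO0 2 (fun x => G x - a' * x) -> bigO0 3 (fun x => F x * G x - a * a' * x ^+ 2).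
  move=> F1 G1 F2 G2.
  apply: (bigO0_ext _ (bigO0D (bigO0M F2 G1) (bigO0M (bigO0_monomial 1 a) G2))) => x.
  by rewrite expr1; ring.
have taylor : bigO0 3 (fun x => f (w + vec2 (X x) (Y x)) - f w
    - (c 1%N 0%N * X x + c 0%N 1%N * Y x)
    - (c 2%N 0%N * X x ^+ 2 + c 1%N 1%N * X x * Y x + c 0%N 2%N * Y x ^+ 2)).
  have [C [rho [C0 rho0 HT]]] := power_series2_taylor 3 fc.
  have [K [s [K0 s0 HK]]] := X1; have [K' [s' [K0' s0' HK']]] := Y1.
  pose m := Num.max K K'.
  have m0 : 0 <= m by rewrite le_max K0.
  exists (C * m ^+ 3), (Num.min (Num.min s s') (rho / (m + 1))); split.
  - by rewrite mulr_ge0 // exprn_ge0.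
  - by rewrite !lt_min s0 s0' divr_gt0 // ltr_wpDl.
  move=> x; rewrite !le_min => /andP[/andP[xs xs'] xm].
  have Xm : `|X x| <= m * `|x|.
    apply: le_trans (HK _ xs) _; rewrite expr1 ler_wpM2r // le_max lexx //.
  have Ym : `|Y x| <= m * `|x|.
    apply: le_trans (HK' _ xs') _; rewrite expr1 ler_wpM2r // le_max lexx orbT //.
  have mx : m * `|x| <= rho.
    move: xm; rewrite ler_pdivlMr ?ltr_wpDl //; apply: le_trans.
    by rewrite mulrC ler_wpM2l // lerDl.
  have := HT _ _ _ Xm Ym mx; rewrite !big_ord_recl big_ord0 /bump /= addr0.
  rewrite hpart0 hpart1 hpart2 (power_series2_at0 fc) exprMn -mulrA.
  by congr (`| _ | <= _); ring.
have XX := prod _ _ _ _ X1 X1 X2 X2; have XY := prod _ _ _ _ X1 Y1 X2 Y2.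
have YY := prod _ _ _ _ Y1 Y1 Y2 Y2.
pose q := c 2%N 0%N * a0 ^+ 2 + c 1%N 1%N * a0 * a1 + c 0%N 2%N * a1 ^+ 2.
pose k1 := c 1%N 0%N * a0 + c 0%N 1%N * a1 - a2.
pose k2 := c 1%N 0%N * b0 + c 0%N 1%N * b1 + q - b2.
have rest : bigO0 3 (fun x => f (w + vec2 (X x) (Y x)) - f w - Z x
    - (k1 * x + k2 * x ^+ 2)).
  have S1 := bigO0D taylor (bigO0D (bigO0Z (c 1%N 0%N) HX) (bigO0Z (c 0%N 1%N) HY)).
  have S2 := bigO0D (bigO0Z (c 2%N 0%N) XX) (bigO0D (bigO0Z (c 1%N 1%N) XY) (bigO0Z (c 0%N 2%N) YY)).
  apply: (bigO0_ext _ (bigO0D (bigO0D S1 S2) (bigO0N HZ))) => x.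
  by rewrite /k1 /k2 /q; ring.
pose F x := f (w + vec2 (X x) (Y x)) - f w - Z x.
have F0 x : A x -> F x = 0 by move=> /HA; rewrite /F => ->; ring.
have k10 : k1 = 0.
  apply: (@bigO0_coef0 _ 1 k1 (fun x => k2 * x ^+ 2 + (F x - (k1 * x + k2 * x ^+ 2))) A) => //.
    by apply: bigO0D; [exact: bigO0_monomial|exact: bigO0W rest].
  by move=> x /F0 ->; rewrite expr1; ring.
have k20 : k2 = 0.
  apply: (@bigO0_coef0 _ 2 k2 (fun x => F x - (k1 * x + k2 * x ^+ 2)) A) => //.
  by move=> x /F0 ->; rewrite k10; ring.
by move: k10 k20; rewrite /k1 /k2 /q => /subr0_eq <- /subr0_eq <-; split=> //; ring.
Qed.

Definition det3 (R : comNzRingType) (a b c : R * R * R) :=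
  let: (a0, a1, a2) := a in let: (b0, b1, b2) := b in let: (c0, c1, c2) := c in
  a0 * (b1 * c2 - b2 * c1) - a1 * (b0 * c2 - b2 * c0) + a2 * (b0 * c1 - b1 * c0).

(** The curves with velocities [x + k * e] and accelerations [y + 2 * k * f] lie on
the graph up to second order; [k = 0] and [k = 1] give the values of the Hessian form
[h] on [(x, x)] and [(x, e)].  In the basis [e, x] of the top view [h (e, e) = 0],
[h (e, x) = M / D] and [h (x, x) = N / D], so that the trace of [h] is [T / D ^+ 3]
and its determinant is [- M ^+ 2 / D ^+ 4]. *)
Lemma hessian_ratio (R : realType) (a P Q c20 c11 c02 : R)
    (e0 e1 e2 f0 f1 f2 x0 x1 x2 y0 y1 y2 : R) :
  a * (2 * c20 + 2 * c02) ^+ 2 =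
    (a + 1) ^+ 2 * (2 * c20 * (2 * c02) - c11 ^+ 2) ->
  2 * c20 * (2 * c02) - c11 ^+ 2 < 0 ->
  e2 = P * e0 + Q * e1 -> c20 * e0 ^+ 2 + c11 * e0 * e1 + c02 * e1 ^+ 2 = 0 ->
  (forall k, `|k| <= 1 -> x2 + k * e2 = P * (x0 + k * e0) + Q * (x1 + k * e1) /\
    y2 / 2 + k * f2 = P * (y0 / 2 + k * f0) + Q * (y1 / 2 + k * f1)
      + c20 * (x0 + k * e0) ^+ 2 + c11 * (x0 + k * e0) * (x1 + k * e1)
      + c02 * (x1 + k * e1) ^+ 2) ->
  let D := e0 * x1 - e1 * x0 in
  let M := det3 (e0, e1, e2) (x0, x1, x2) (f0, f1, f2) in
  let N := det3 (e0, e1, e2) (x0, x1, x2) (y0, y1, y2) in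
  let T := (e0 ^+ 2 + e1 ^+ 2) * N - 2 * (e0 * x0 + e1 * x1) * M in
  D != 0 -> M != 0 /\ a * T ^+ 2 = - (a + 1) ^+ 2 * D ^+ 2 * M ^+ 2.
Proof.
move=> + K0' e2E asym0 contact D M N T D0.
have [|x2E y2E'] := contact 0; first by rewrite normr0.
have [|_ f2E'] := contact 1; first by rewrite normr1.
rewrite !mul0r !addr0 in x2E y2E'; rewrite !mul1r in f2E'.
pose A := 2 * c20; pose C := 2 * c02; pose B := c11.
rewrite -/A -/C -/B => ratio; have K0 : A * C - B ^+ 2 != 0 by rewrite lt_eqF.
have asym : A * e0 ^+ 2 + 2 * B * e0 * e1 + C * e1 ^+ 2 = 0.
  by rewrite -[RHS](mulr0 2) -asym0 /A /B /C; ring.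
have f2E : f2 = P * f0 + Q * f1 + (A * x0 * e0 + B * (x0 * e1 + x1 * e0) + C * x1 * e1).
  rewrite -[LHS](addKr (y2 / 2)) f2E' y2E' -[RHS]addr0 -asym0 /A /B /C; ring.
have y2E : y2 = P * y0 + Q * y1 + (A * x0 ^+ 2 + 2 * B * x0 * x1 + C * x1 ^+ 2).
  by rewrite -[LHS](divfK (_ : 2 != 0)) ?pnatr_eq0 // y2E' /A /B /C; field.
pose m := A * x0 * e0 + B * (x0 * e1 + x1 * e0) + C * x1 * e1.
have ME : M = m * D by rewrite /M /det3 /D /m e2E x2E f2E; ring.
have NE : N = (A * x0 ^+ 2 + 2 * B * x0 * x1 + C * x1 ^+ 2) * D.
  by rewrite /N /det3 /D e2E x2E y2E; ring.
have detE : (A * C - B ^+ 2) * D ^+ 2 = - m ^+ 2.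
  transitivity ((A * e0 ^+ 2 + 2 * B * e0 * e1 + C * e1 ^+ 2)
     * (A * x0 ^+ 2 + 2 * B * x0 * x1 + C * x1 ^+ 2) - m ^+ 2).
    by rewrite /D /m; ring.
  by rewrite asym mul0r sub0r.
have TE : T = (A + C) * D ^+ 3.
  transitivity ((A + C) * D ^+ 3 -
     (A * e0 ^+ 2 + 2 * B * e0 * e1 + C * e1 ^+ 2) * (x0 ^+ 2 + x1 ^+ 2) * D).
    by rewrite /T ME NE /D /m; ring.
  by rewrite asym !mul0r subr0.
split.
  rewrite ME mulf_neq0 //; apply/eqP => m0; move/eqP: detE.
  by rewrite m0 expr0n oppr0 mulf_eq0 sqrf_eq0 (negbTE K0) (negbTE D0).
rewrite TE ME; transitivity (a * (A + C) ^+ 2 * D ^+ 6); first by ring.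
rewrite ratio; transitivity ((a + 1) ^+ 2 * ((A * C - B ^+ 2) * D ^+ 2) * D ^+ 4).
  by ring.
by rewrite detE; ring.
Qed.

(** * The ratio of curvatures along rulings *)

Lemma top_viewE (R : realType) (p : 'cV[R]_3) : top_view p = vec2 (p 0 0) (p 1 0).
Proof.
apply/colP => i; rewrite !mxE; case: i => -[|[|//]] i /=;
  by congr (p _ _); apply/val_inj.
Qed.

Lemma det_mx2E (R : comNzRingType) (A : 'M[R]_2) :
  \det A = A 0 0 * A 1 1 - A 0 1 * A 1 0.
Proof.
rewrite (expand_det_row A 0) !big_ord_recl big_ord0 /cofactor !det_mx11 !mxE /=.
rewrite addr0 !expr0 !expr1 !mul1r mulN1r mulrN.
by congr (_ * A _ _ - A _ _ * A _ _); apply/val_inj.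
Qed.

Lemma char_poly2P (R : realType) (A : 'M[R]_2) (k1 k2 : R) :
  char_poly A = ('X - k1%:P) * ('X - k2%:P) <->
  k1 + k2 = A 0 0 + A 1 1 /\ k1 * k2 = A 0 0 * A 1 1 - A 0 1 * A 1 0.
Proof.
have tr : \tr A = A 0 0 + A 1 1.
  rewrite /mxtrace !big_ord_recl big_ord0 addr0.
  by congr (_ + A _ _); apply/val_inj.
have c1 := @char_poly_trace _ _ A isT; have c0 := char_poly_det A.
rewrite det_mx2E /= expr2 mulrNN !mul1r in c0.
rewrite tr /= in c1.
have prod : ('X - k1%:P) * ('X - k2%:P) = 'X^2 - (k1 + k2)%:P * 'X + (k1 * k2)%:P :> {poly R}.
  by rewrite polyCD polyCM; ring.
split=> [e|[e1 e0]].
  move: c0 c1; rewrite e prod !coefD !coefN !coefCM !coefX !coefXn !coefC /=.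
  by move=> c0 c1; split; lra.
rewrite prod; apply/polyP => i; rewrite !coefD !coefN !coefCM !coefX !coefXn !coefC.
case: i => [|[|[|i]]] /=.
- by rewrite c0; lra.
- by rewrite c1; lra.
- have /monicP := char_poly_monic A; rewrite /lead_coef size_char_poly /= => ->; lra.
- by rewrite nth_default ?size_char_poly //; lra.
Qed.

Lemma ratio_symmetric (R : realType) (a k1 k2 : R) : k1 * k2 != 0 ->
  k1 / k2 = a \/ k2 / k1 = a -> a * (k1 + k2) ^+ 2 = (a + 1) ^+ 2 * (k1 * k2).
Proof.
rewrite mulf_eq0 negb_or => /andP[k10 k20] [<-|<-]; by field.
Qed.

Lemma ratio_eigenvalues (R : realType) (a T K : R) : a < 0 -> K < 0 ->
  a * T ^+ 2 = (a + 1) ^+ 2 * K ->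
  exists k1 k2, [/\ k1 + k2 = T, k1 * k2 = K & k1 / k2 = a].
Proof.
move=> a0 K0 e; pose q := Num.sqrt (K / a).
have q0 : 0 < K / a by rewrite nmulr_rgt0 // invr_lt0.
have q2 : a * q ^+ 2 = K by rewrite sqr_sqrtr ?ltW // mulrC divfK // lt_eqF.
have qn : q != 0 by rewrite gt_eqF // sqrtr_gt0.
have /eqP : T ^+ 2 = ((a + 1) * q) ^+ 2.
  by apply: (mulfI (x := a)); [rewrite lt_eqF|rewrite e -q2; ring].
rewrite eqf_sqr => /orP[/eqP ->|/eqP ->]; [exists (a * q), q|exists (- (a * q)), (- q)].
  by split; [ring|rewrite -q2; ring|rewrite mulfK].
by split; [ring|rewrite -q2; ring|rewrite invrN mulrNN mulfK].
Qed.

(** With the trace [2 * H] and the determinant [K] of the Hessian this is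
[a * (2 * H) ^+ 2 = (a + 1) ^+ 2 * K] and [K < 0], a condition that is symmetric in
the two curvatures and does not mention them. *)
Definition ratio_coef (R : realType) (a : R) (c : nat -> nat -> R) :=
  a * (2 * c 2%N 0%N + 2 * c 0%N 2%N) ^+ 2 =
    (a + 1) ^+ 2 * (2 * c 2%N 0%N * (2 * c 0%N 2%N) - c 1%N 1%N ^+ 2) /\
  2 * c 2%N 0%N * (2 * c 0%N 2%N) - c 1%N 1%N ^+ 2 < 0.

Lemma constant_ratio_coef (R : realType) (a : R) (S : set 'cV[R]_3) p :
  a < 0 -> constant_ratio a S -> S p ->
  exists f c r, [/\ local_graph S p f, power_series2_at f (top_view p) c r &
    ratio_coef a c].
Proof.
move=> a0 ratio Sp; have [k1 [k2 [[f [lg cp]] K0 rat]]] := ratio p Sp.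
have [_ /analytic_at2P [c [r fc]] _] := lg.
exists f, c, r; split=> //.
have [h00 h01 h10 h11] := hessianE fc.
move/char_poly2P: cp; rewrite h00 h01 h10 h11 -!expr2 => -[tr det].
rewrite /ratio_coef -tr -det; split; first exact: ratio_symmetric.
move: K0; rewrite mulf_eq0 negb_or => /andP[k10 k20].
case: rat => e.
  by rewrite -(divfK k20 k1) e -mulrA -expr2 pmulr_llt0 // exprn_even_gt0.
by rewrite -(divfK k10 k2) e mulrCA -expr2 pmulr_llt0 // exprn_even_gt0.
Qed.

Lemma coef_constant_ratio (R : realType) (a : R) (S : set 'cV[R]_3) : a < 0 ->
  (forall p, S p -> exists f c r, [/\ local_graph S p f,
     power_series2_at f (top_view p) c r & ratio_coef a c]) ->
  constant_ratio a S.
Proof.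
move=> a0 H p Sp; have [f [c [r [lg fc [e K0]]]]] := H p Sp.
have [k1 [k2 [tr det rat]]] := ratio_eigenvalues a0 K0 e.
exists k1, k2; split; [|by rewrite det lt_eqF|by left].
exists f; split=> //; apply/char_poly2P.
have [h00 h01 h10 h11] := hessianE fc.
by rewrite h00 h01 h10 h11 -!expr2.
Qed.

Lemma bigO0_taylor2 (R : realType) (g : R -> R) t : analytic_at g t ->
  bigO0 3 (fun x => g (t + x) - (g t + derive1 g t * x + derive1 (derive1 g) t / 2 * x ^+ 2)).
Proof.
move=> /analytic_taylor2 [C [rho [rho0 H]]]; exists `|C|, rho; split=> // x /H xr.
by apply: (le_trans xr); rewrite ler_wpM2r ?exprn_ge0 // ler_norm.
Qed.

Definition ruling_point (R : realType) (g e : 'I_3 -> R -> R) (t s : R) : 'cV[R]_3 :=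
  \col_i (g i t + s * e i t).

Lemma nbhs_coord (R : realType) n (p : 'cV[R]_n) (W : set 'cV[R]_n) : nbhs p W ->
  exists2 eps, 0 < eps & forall q : 'cV[R]_n, (forall i, `|q i 0 - p i 0| < eps) -> W q.
Proof.
move=> /nbhs_ballP [eps /= eps0 H]; exists eps => // q Hq; apply: H.
rewrite -ball_normE /=; apply: norm_lt_coord => // i j.
have -> : (p - q) i j = p i 0 - q i 0 by rewrite ord1 !mxE.
by rewrite distrC.
Qed.

(** The curve has to lie on [S] only at parameters accumulating at [0]. *)
Lemma curve_contact (R : realType) (S : set 'cV[R]_3) p f c r (q : R -> 'cV[R]_3)
    (A : set R) (a b : 'I_3 -> R) :
  local_graph S p f -> power_series2_at f (top_view p) c r ->
  clusters_at0 A -> (forall x, A x -> S (q x)) ->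
  (forall i, bigO0 3 (fun x => q x i 0 - p i 0 - (a i * x + b i * x ^+ 2))) ->
  a 2%:R = c 1%N 0%N * a 0 + c 0%N 1%N * a 1 /\
  b 2%:R = c 1%N 0%N * b 0 + c 0%N 1%N * b 1 + c 2%N 0%N * a 0 ^+ 2
       + c 1%N 1%N * a 0 * a 1 + c 0%N 2%N * a 1 ^+ 2.
Proof.
move=> [Sp _ [W [oW Wp graph]]] fc acc AS HO.
have [|eps eps0 HW] := @nbhs_coord _ _ p W; first exact: open_nbhs_nbhs.
have [rho rho0 small] : exists2 rho, 0 < rho & forall x, `|x| < rho -> W (q x).
  have each i : exists2 rho, 0 < rho & forall x, `|x| < rho -> `|q x i 0 - p i 0| < eps.
    have : bigO0 1 (fun x => q x i 0 - p i 0).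
      apply: (bigO0_ext _ (bigO0D (@bigO0W _ 3 1 _ isT (HO i)) (bigO0D (bigO0_monomial 1 (a i))
        (@bigO0W _ 2 1 _ isT (bigO0_monomial 2 (b i)))))) => x /=.
      by rewrite expr1 subrK.
    move=> [C [rho [C0 rho0 HC]]]; exists (Num.min rho (eps / (C + 1))).
      by rewrite lt_min rho0 divr_gt0 // ltr_wpDl.
    move=> x; rewrite lt_min => /andP[xr xe]; apply: le_lt_trans (HC _ (ltW xr)) _.
    move: xe; rewrite expr1 ltr_pdivlMr ?ltr_wpDl //; apply: le_lt_trans.
    by rewrite mulrC ler_wpM2l // lerDl.
  have [r0 r00 H0] := each 0; have [r1 r10 H1] := each 1; have [r2 r20 H2] := each 2%:R.
  exists (Num.min r0 (Num.min r1 r2)); first by rewrite !lt_min r00 r10.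
  move=> x; rewrite !lt_min => /and3P[x0 x1 x2]; apply: HW => i.
  have : [\/ i = 0, i = 1 | i = 2%:R].
    case: i => -[|[|[|//]]] i; [apply: Or31|apply: Or32|apply: Or33]; exact/val_inj.
  by case=> ->; [exact: H0|exact: H1|exact: H2].
apply: (@contact2 _ f (top_view p) c r (fun x => q x 0 0 - p 0 0) (fun x => q x 1 0 - p 1 0)
   (fun x => q x 2%:R 0 - p 2%:R 0) (A `&` [set x | `|x| < rho])) => //.
  move=> e e0; have [|x [x0]] := acc (Num.min e rho); first by rewrite lt_min e0.
  by rewrite lt_min => /andP[xe xr] Ax; exists x.
move=> x [Ax /= xr].
have -> : top_view p + vec2 (q x 0 0 - p 0 0) (q x 1 0 - p 1 0) = top_view (q x).
  by rewrite !top_viewE [LHS]vec2E !mxE /= !subrKC.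
have hq := graph (q x) (conj (AS _ Ax) (small _ xr)).
have hp := graph p (conj Sp Wp).
by rewrite -hq -hp /height subrKC.
Qed.

Lemma bigO0_ruling (R : realType) (g e : 'I_3 -> R -> R) (t s k : R) i :
  analytic_at (g i) t -> analytic_at (e i) t ->
  bigO0 3 (fun x => ruling_point g e (t + x) (s + k * x) i 0 - ruling_point g e t s i 0
    - ((derive1 (g i) t + s * derive1 (e i) t + k * e i t) * x
       + ((derive1 (derive1 (g i)) t + s * derive1 (derive1 (e i)) t) / 2
          + k * derive1 (e i) t) * x ^+ 2)).
Proof.
move=> /bigO0_taylor2 Hg /bigO0_taylor2 He.
have He2 := bigO0D (@bigO0W _ 3 2 _ isT He)
  (bigO0_monomial 2 (derive1 (derive1 (e i)) t / 2)).
apply: (bigO0_ext _ (bigO0D (bigO0D Hg (bigO0Z s He)) (bigO0M (bigO0_monomial 1 k) He2))) => x.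
rewrite !mxE.
move: (derive1 (derive1 (g i)) t) (derive1 (derive1 (e i)) t) (derive1 (g i) t)
  (derive1 (e i) t) (g i (t + x)) (e i (t + x)) (g i t) (e i t) => *; ring.
Qed.

(** [Df], [Mf], [Nf], [Tf] are the [D], [M], [N], [T] of
[hessian_ratio] at the point [s] of the ruling [t]: there [x = g' + s * e'],
[y = g'' + s * e''] and [f = e']. *)
Section invariants.
Variables (R : realType) (g e : 'I_3 -> R -> R).

Definition top_norm2 t := e 0 t ^+ 2 + e 1 t ^+ 2.
Definition wr t := e 0 t * derive1 (e 1) t - e 1 t * derive1 (e 0) t.
Definition drift t := e 0 t * derive1 (g 1) t - e 1 t * derive1 (g 0) t.
Definition Df t s := drift t + s * wr t.
Definition Mf t := det3 (e 0 t, e 1 t, e 2%:R t)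
  (derive1 (g 0) t, derive1 (g 1) t, derive1 (g 2%:R) t)
  (derive1 (e 0) t, derive1 (e 1) t, derive1 (e 2%:R) t).
Definition Nf t s := det3 (e 0 t, e 1 t, e 2%:R t)
  (derive1 (g 0) t + s * derive1 (e 0) t, derive1 (g 1) t + s * derive1 (e 1) t,
   derive1 (g 2%:R) t + s * derive1 (e 2%:R) t)
  (derive1 (derive1 (g 0)) t + s * derive1 (derive1 (e 0)) t,
   derive1 (derive1 (g 1)) t + s * derive1 (derive1 (e 1)) t,
   derive1 (derive1 (g 2%:R)) t + s * derive1 (derive1 (e 2%:R)) t).
Definition Tf t s := top_norm2 t * Nf t s -
  2 * (e 0 t * (derive1 (g 0) t + s * derive1 (e 0) t) +
       e 1 t * (derive1 (g 1) t + s * derive1 (e 1) t)) * Mf t.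

End invariants.

Section relation.
Variables (R : realType) (a : R) (S : set 'cV[R]_3) (g e : 'I_3 -> R -> R).
Variables (t s1 s2 s : R).
Hypothesis a0 : a < 0.
Hypothesis ratio : constant_ratio a S.
Hypothesis s12 : s1 < s < s2.

Lemma ruling_asymptotic f c r : (forall s', s1 < s' < s2 -> S (ruling_point g e t s')) ->
  local_graph S (ruling_point g e t s) f ->
  power_series2_at f (top_view (ruling_point g e t s)) c r ->
  e 2%:R t = c 1%N 0%N * e 0 t + c 0%N 1%N * e 1 t /\
  c 2%N 0%N * e 0 t ^+ 2 + c 1%N 1%N * e 0 t * e 1 t + c 0%N 2%N * e 1 t ^+ 2 = 0.
Proof.
move=> St lg fc.
have [|||E1 E2] := @curve_contact _ S _ f c r (fun x => ruling_point g e t (s + x))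
   [set x | s1 < s + x < s2] (fun i => e i t) (fun=> 0) lg fc.
- move=> d d0; have [m [m0 md ms]] : exists m, [/\ 0 < m, m <= d & m <= s2 - s].
    exists (Num.min d (s2 - s)); rewrite !ge_min !lexx orbT; split=> //.
    by rewrite lt_min d0; have /andP[_] := s12; rewrite subr_gt0.
  have /andP[ss1 ss2] := s12.
  exists (m / 2); split; [by rewrite gt_eqF //; lra| |rewrite /=; apply/andP; split; lra].
  by rewrite ger0_norm; lra.
- by move=> x /= xs; exact: St.
- move=> i; apply: (bigO0_ext _ (bigO0_monomial 3 0)) => x; rewrite !mxE; ring.
by split; [exact: E1|move: E2; rewrite !mulr0 !add0r => /esym].
Qed.

(** The first-order part of [ruling_asymptotic] makes the third coordinate of [e] a
linear function of the others. *)
Lemma ruling_not_vertical : (forall s', s1 < s' < s2 -> S (ruling_point g e t s')) ->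
  (exists i, e i t != 0) -> e 0 t != 0 \/ e 1 t != 0.
Proof.
move=> St [i ei]; have [f [c [r [lg fc _]]]] := constant_ratio_coef a0 ratio (St _ s12).
have [e2 _] := ruling_asymptotic St lg fc.
have [e0|e0] := eqVneq (e 0 t) 0; last by left.
have [e1|e1] := eqVneq (e 1 t) 0; last by right.
move: e2; rewrite e0 e1 !mulr0 addr0 => e2; exfalso; move/eqP: ei; apply.
case: i => -[|[|[|//]]] i; [rewrite -e0|rewrite -e1|rewrite -e2];
  by congr (e _ t); apply/val_inj.
Qed.

Variable E : set R.
Hypothesis ga : forall i, analytic_at (g i) t.
Hypothesis ea : forall i, analytic_at (e i) t.
Hypothesis ES : forall t' s', E t' -> s1 < s' < s2 -> S (ruling_point g e t' s').
Hypothesis Et : E t.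
Hypothesis Eacc : forall d, 0 < d -> exists t', [/\ t' != t, `|t' - t| < d & E t'].

Let x i := derive1 (g i) t + s * derive1 (e i) t.
Let y i := derive1 (derive1 (g i)) t + s * derive1 (derive1 (e i)) t.
Let f' i := derive1 (e i) t.

(** Applied to the curves that leave the ruling at [s] and pass to the ruling [t + x]
at [s + k * x], with slope [k] between [-1] and [1]. *)
Lemma ruling_relation : Df g e t s != 0 -> Mf g e t != 0 /\
  a * Tf g e t s ^+ 2 = - (a + 1) ^+ 2 * Df g e t s ^+ 2 * Mf g e t ^+ 2.
Proof.
move=> D0; have [f [c [r [lg fc [rat K0]]]]] := constant_ratio_coef a0 ratio (ES Et s12).
have [e2 asym] := ruling_asymptotic (fun s' => ES Et (s' := s')) lg fc.
have contact k : `|k| <= 1 ->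
    x 2%:R + k * e 2%:R t = c 1%N 0%N * (x 0 + k * e 0 t) + c 0%N 1%N * (x 1 + k * e 1 t) /\
    y 2%:R / 2 + k * f' 2%:R = c 1%N 0%N * (y 0 / 2 + k * f' 0) +
      c 0%N 1%N * (y 1 / 2 + k * f' 1) + c 2%N 0%N * (x 0 + k * e 0 t) ^+ 2
       + c 1%N 1%N * (x 0 + k * e 0 t) * (x 1 + k * e 1 t)
       + c 0%N 2%N * (x 1 + k * e 1 t) ^+ 2.
  move=> k1.
  apply: (@curve_contact _ S _ f c r (fun d => ruling_point g e (t + d) (s + k * d))
   [set d | E (t + d) /\ s1 < s + k * d < s2] (fun i => x i + k * e i t)
   (fun i => y i / 2 + k * f' i) lg fc).
  - move=> d d0; have /andP[ss1 ss2] := s12; have [|t' [t't td Et']] := Eacc (d := Num.min d (Num.min (s2 - s) (s - s1))).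
      by rewrite !lt_min d0 /=; apply/andP; split; lra.
    move: td; rewrite !lt_min => /and3P[td ts2 ts1].
    exists (t' - t); split; [by rewrite subr_eq0|by []|split; first by rewrite subrKC].
    have : `|k * (t' - t)| <= `|t' - t| by rewrite normrM ler_piMl.
    by rewrite ler_norml => /andP[? ?]; apply/andP; split; lra.
  - by move=> d [Ed sd]; exact: ES.
  - by move=> i; exact: bigO0_ruling.
have := hessian_ratio rat K0 e2 asym contact.
have -> : e 0 t * x 1 - e 1 t * x 0 = Df g e t s.
  rewrite /Df /drift /wr /x.
  move: (e 0 t) (e 1 t) (derive1 (g 1) t) (derive1 (g 0) t) (derive1 (e 1) t)
    (derive1 (e 0) t) => *; ring.
have -> : det3 (e 0 t, e 1 t, e 2%:R t) (x 0, x 1, x 2%:R) (f' 0, f' 1, f' 2%:R) = Mf g e t.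
  rewrite /Mf /det3 /x /f'.
  move: (e 0 t) (e 1 t) (e 2%:R t) (derive1 (g 1) t) (derive1 (g 0) t)
    (derive1 (g 2%:R) t) (derive1 (e 1) t) (derive1 (e 0) t) (derive1 (e 2%:R) t) => *.
  by ring.
by move/(_ D0).
Qed.

End relation.

Lemma analyticX (R : realType) (f : R -> R) n t :
  analytic_at f t -> analytic_at (fun x => f x ^+ n) t.
Proof.
move=> fa; elim: n => [|n IH]; first exact: analytic_cst.
have -> : (fun x => f x ^+ n.+1) = (fun x => f x * f x ^+ n).
  by apply/funext => x; rewrite exprS.
exact: analyticM.
Qed.

Ltac analytic :=
  cbv beta;
  lazymatch goal with
  | |- analytic_at (fun x => @?F x + @?G x) ?t => apply (@analyticD _ F G t); analytic
  | |- analytic_at (fun x => - @?F x) ?t => apply (@analyticN _ F t); analytic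
  | |- analytic_at (fun x => @?F x * @?G x) ?t => apply (@analyticM _ F G t); analytic
  | |- analytic_at (fun x => @?F x ^+ ?n) ?t => apply (@analyticX _ F n t); analytic
  | |- analytic_at (fun x => derive1 ?f x) ?t => apply (@analytic_derive1 _ f t); analytic
  | |- analytic_at (derive1 ?f) ?t => apply (@analytic_derive1 _ f t); analytic
  | |- analytic_at (fun x => ?f x) ?t => change (analytic_at f t); analytic
  | |- analytic_at (fun _ => ?k) ?t => exact (@analytic_cst _ k t)
  | H : forall i, analytic_at (?f i) ?t |- analytic_at (?f ?i) ?t => exact (H i)
  | |- _ => assumption
  end.

Lemma itvoo_uncountable (R : realType) (a b : R) : a < b -> ~ countable `]a, b[.
Proof.
move=> ab /countable_lebesgue_measure0.
by rewrite lebesgue_measure_itv /= lte_fin ab -EFinB => -[] /eqP; rewrite subr_eq0 gt_eqF.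
Qed.

(** The segments cut out of nearby rulings may be unrelated; but for all but
countably many parameters [t] infinitely many rulings accumulating at that of [t]
share an interval of positions with it.  Otherwise [t] is isolated among the
parameters whose segments contain a given rational interval, and this interval with a
rational neighbourhood of [t] determines [t]. *)
Lemma accumulating_rulings (R : realType) (I : set R) (J : R -> set R) (a b : R) :
  a < b -> (forall t, a < t < b -> I t) ->
  (forall t, I t -> is_interval (J t) /\ exists s1 s2, [/\ J t s1, J t s2 & s1 < s2]) ->
  exists t s1 s2 (E : set R), [/\ a < t < b, s1 < s2, E t,
    forall t' s, E t' -> s1 < s < s2 -> I t' /\ J t' s &
    forall d, 0 < d -> exists t', [/\ t' != t, `|t' - t| < d & E t']].
Proof.
move=> ab abI HJ; apply: contrapT => no.
pose E (q1 q2 : rat) := [set t | I t /\ forall s, ratr q1 < s < ratr q2 -> J t s].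
pose P t (q : rat * rat * (rat * rat)) :=
   [/\ ratr q.1.1 < ratr q.1.2 :> R, E q.1.1 q.1.2 t, ratr q.2.1 < t < ratr q.2.2 &
    forall t', E q.1.1 q.1.2 t' -> ratr q.2.1 < t' < ratr q.2.2 -> t' = t].
have isolated t : a < t < b -> exists q, P t q.
  move=> tab; have It := abI _ tab.
  have [iJ [s1 [s2 [J1 J2 s12]]]] := HJ _ It.
  have [q1] := rat_in_itvoo s12; rewrite in_itv /= => /andP[s1q q1s].
  have [q2] := rat_in_itvoo q1s; rewrite in_itv /= => /andP[q12 q2s].
  have Et : E q1 q2 t.
    split=> // s /andP[sq1 sq2]; apply: (iJ s1 s2) => //.
    by rewrite !ltW //; [apply: lt_trans q2s|apply: lt_trans sq1].
  have [d [d0 Hd]] : exists d, 0 < d /\ forall t', E q1 q2 t' -> `|t' - t| < d -> t' = t.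
    apply: contrapT => nod; apply: no; exists t, (ratr q1), (ratr q2), (E q1 q2).
    split=> // [t' s [It' Ht'] sq|d d0]; first by split=> //; exact: Ht'.
    apply: contrapT => nt'; apply: nod; exists d; split=> // t' Et' td.
    by apply: contrapT => /eqP t't; apply: nt'; exists t'.
  have [|r1] := @rat_in_itvoo R (t - d) t; first lra.
  rewrite in_itv /= => /andP[r1d r1t].
  have [|r2] := @rat_in_itvoo R t (t + d); first lra.
  rewrite in_itv /= => /andP[r2t r2d].
  exists ((q1, q2), (r1, r2)); split=> //=; first by rewrite r1t.
  move=> t' Et' /andP[t1 t2]; apply: Hd => //.
  by rewrite ltr_norml; apply/andP; split; lra.
have /choice [q Hq] : forall t, exists q, a < t < b -> P t q.
  move=> t; have [/isolated [q Hq]|nt] := boolP (a < t < b); first by exists q.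
  by exists (0, 0, (0, 0)).
apply: (itvoo_uncountable ab); apply/countable_injP.
exists (fun t => pickle (q t)) => t t'; rewrite !inE /= !in_itv /= => tab tab'.
move=> /(pcan_inj pickleK) qq.
have [_ _ _ Ht] := Hq _ tab; have [_ Et' rt' _] := Hq _ tab'.
by apply/esym/Ht; rewrite qq.
Qed.

Lemma poly_zero_on_itv (R : realType) (p : {poly R}) (s1 s2 : R) : s1 < s2 ->
  (forall s, s1 < s < s2 -> p.[s] = 0) -> p = 0.
Proof.
move=> s12 H; apply/eqP/negPn/negP => p0.
pose pts := [seq s1 + (s2 - s1) / (k.+2)%:R | k <- iota 0 (size p)].
have := max_poly_roots (rs := pts) p0; rewrite size_map size_iota ltnn => F.
suff : false by []; apply: F.
  apply/allP => s /mapP [k _ ->]; apply/eqP/H.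
  have k0 : 0 < (k.+2)%:R :> R by rewrite ltr0n.
  have d0 : 0 < (s2 - s1) / (k.+2)%:R by rewrite divr_gt0 // subr_gt0.
  have d1 : (s2 - s1) / (k.+2)%:R < s2 - s1.
    by rewrite ltr_pdivrMr // ltr_pMr ?subr_gt0 // ltr1n.
  move: ((s2 - s1) / (k.+2)%:R) d0 d1 => z z0 z1.
  by apply/andP; split; lra.
rewrite map_inj_uniq ?iota_uniq // => i j /addrI /mulfI.
have s0 : s2 - s1 != 0 by rewrite subr_eq0 gt_eqF.
by move=> /(_ s0) /invr_inj /eqP; rewrite eqr_nat => /eqP [].
Qed.

Section analytic_invariants.
Variables (R : realType) (g e : 'I_3 -> R -> R) (t0 : R).
Hypothesis ga : forall i, analytic_at (g i) t0.
Hypothesis ea : forall i, analytic_at (e i) t0.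

Lemma analytic_wr : analytic_at (wr e) t0.
Proof. by rewrite /wr; analytic. Qed.

Lemma analytic_drift : analytic_at (drift g e) t0.
Proof. by rewrite /drift; analytic. Qed.

Lemma analytic_Df s : analytic_at (Df g e ^~ s) t0.
Proof. by have aw := analytic_wr; have ad := analytic_drift; rewrite /Df; analytic. Qed.

Lemma analytic_Mf : analytic_at (Mf g e) t0.
Proof. by rewrite /Mf /det3; analytic. Qed.

Lemma analytic_Tf s : analytic_at (Tf g e ^~ s) t0.
Proof. by have aM := analytic_Mf; rewrite /Tf /Nf /top_norm2 /det3; analytic. Qed.

End analytic_invariants.

Lemma itvoo_is_interval (R : realType) (al be : R) : is_interval [set t | al < t < be].
Proof.
move=> x y /= /andP[ax _] /andP[_ yb] z /andP[xz zy].
by rewrite (lt_le_trans ax xz) (le_lt_trans zy yb).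
Qed.

Lemma itvoo_two_points (R : realType) (al be : R) : al < be ->
  exists x y, [/\ [set t | al < t < be] x, [set t | al < t < be] y & x < y].
Proof.
move=> ab; exists (al + (be - al) / 3), (al + 2 * (be - al) / 3).
by split=> /=; [apply/andP; split; lra|apply/andP; split; lra|lra].
Qed.

Lemma analytic_near_neq0 (R : realType) (f : R -> R) t :
  analytic_at f t -> f t != 0 -> \forall x \near t, f x != 0.
Proof.
move=> /analytic_continuous fc f0.
have : \forall y \near f t, y != 0 by exact: open_nbhs_nbhs (conj (@open_neq _ _) f0).
exact: fc.
Qed.

Lemma Df_poly (R : realType) (g e : 'I_3 -> R -> R) t :
  exists p : {poly R}, forall s, p.[s] = Df g e t s.
Proof.
exists ((drift g e t)%:P + 'X * (wr e t)%:P) => s.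
by rewrite !(hornerD, hornerM, hornerC, hornerX).
Qed.

Lemma horner_det3 (R : realType) (a0 a1 a2 b0 b1 b2 c0 c1 c2 : {poly R}) s :
  (det3 (a0, a1, a2) (b0, b1, b2) (c0, c1, c2)).[s] =
  det3 (a0.[s], a1.[s], a2.[s]) (b0.[s], b1.[s], b2.[s]) (c0.[s], c1.[s], c2.[s]).
Proof. by rewrite /det3 /= !(hornerD, hornerN, hornerM). Qed.

Lemma Tf_poly (R : realType) (g e : 'I_3 -> R -> R) t :
  exists p : {poly R}, forall s, p.[s] = Tf g e t s.
Proof.
rewrite /Tf /Nf.
move: (top_norm2 e t) (Mf g e t) (e 0 t) (e 1 t) (e 2%:R t) (derive1 (g 0) t)
  (derive1 (g 1) t) (derive1 (g 2%:R) t) (derive1 (e 0) t) (derive1 (e 1) t)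
  (derive1 (e 2%:R) t) (derive1 (derive1 (g 0)) t) (derive1 (derive1 (g 1)) t)
  (derive1 (derive1 (g 2%:R)) t) (derive1 (derive1 (e 0)) t) (derive1 (derive1 (e 1)) t)
  (derive1 (derive1 (e 2%:R)) t).
move=> n m e0 e1 e2 g0 g1 g2 f0 f1 f2 h0 h1 h2 k0 k1 k2.
have [l lE] : exists l : R -> R -> {poly R}, forall u v s, (l u v).[s] = u + s * v.
  exists (fun u v => u%:P + 'X * v%:P) => u v s.
  by rewrite hornerD hornerM !hornerC hornerX.
exists (n%:P * det3 (e0%:P, e1%:P, e2%:P) (l g0 f0, l g1 f1, l g2 f2)
   (l h0 k0, l h1 k1, l h2 k2) - 2%:P * (e0%:P * l g0 f0 + e1%:P * l g1 f1) * m%:P) => s.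
by rewrite hornerD hornerN hornerM horner_det3 !lE !hornerM hornerD !hornerM !lE !hornerC.
Qed.

Section global.
Variables (R : realType) (a : R) (S : set 'cV[R]_3) (I : set R) (J : R -> set R).
Variables g e : 'I_3 -> R -> R.
Hypothesis a0 : a < 0.
Hypothesis ratio : constant_ratio a S.
Hypothesis iI : is_interval I.
Hypothesis I2 : exists x y, [/\ I x, I y & x < y].
Hypothesis ga : forall t, I t -> forall i, analytic_at (g i) t.
Hypothesis ea : forall t, I t -> forall i, analytic_at (e i) t.
Hypothesis HJ : forall t, I t ->
  is_interval (J t) /\ exists s1 s2, [/\ J t s1, J t s2 & s1 < s2].
Hypothesis IJS : forall t s, I t -> J t s -> S (ruling_point g e t s).
Hypothesis enz : forall t, I t -> exists i, e i t != 0.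

Lemma top_norm2_gt0 t : I t -> 0 < top_norm2 e t.
Proof.
move=> It; have [iJ [s1 [s2 [J1 J2 s12]]]] := HJ It.
have mid : s1 < (s1 + s2) / 2 < s2 by apply/andP; split; lra.
have St s' : s1 < s' < s2 -> S (ruling_point g e t s').
  by move=> /andP[s1s ss2]; apply: IJS => //; apply: (iJ s1 s2) => //; rewrite !ltW.
have [h|h] := ruling_not_vertical a0 ratio mid St (enz It).
  by apply: ltr_pwDl; rewrite ?sqr_ge0 // lt_def sqrf_eq0 h sqr_ge0.
by apply: ltr_wpDl; rewrite ?sqr_ge0 // lt_def sqrf_eq0 h sqr_ge0.
Qed.

Let G t s := a * Tf g e t s ^+ 2 + (a + 1) ^+ 2 * Df g e t s ^+ 2 * Mf g e t ^+ 2.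

(** [ruling_relation] gives the relation for infinitely many positions [s] on the
ruling, except where [Df] vanishes; as polynomials in [s], both sides then agree. *)
Lemma generic_relation al be : al < be -> (forall t, al < t < be -> I t) ->
  (forall t, al < t < be -> exists s, Df g e t s != 0) ->
  exists2 t, al < t < be & Mf g e t != 0 /\ forall s, G t s = 0.
Proof.
move=> ab abI HD.
have [t [s1 [s2 [E [tab s12 Et EJ Eacc]]]]] := accumulating_rulings ab abI HJ.
exists t => //.
have It := abI _ tab.
have ES t' s' : E t' -> s1 < s' < s2 -> S (ruling_point g e t' s').
  by move=> Et' ss; have [It' Js] := EJ _ _ Et' ss; exact: IJS.
have rel s : s1 < s < s2 -> Df g e t s != 0 -> Mf g e t != 0 /\ G t s = 0.
  move=> ss Ds.
  have [M0 r] := ruling_relation a0 ratio ss (ga It) (ea It) ES Et Eacc Ds.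
  by split=> //; rewrite /G r !mulNr addNr.
have [pD HpD] := Df_poly g e t; have [pT HpT] := Tf_poly g e t.
have [s Ds] := HD _ tab.
have pD0 : pD != 0 by apply/eqP => p0; move: Ds; rewrite -HpD p0 horner0 eqxx.
split.
  apply/eqP => M0; move/eqP: pD0; apply; apply: (poly_zero_on_itv s12) => s' ss.
  rewrite HpD; apply/eqP/negPn/negP => /(rel _ ss) [].
  by rewrite M0 eqxx.
pose pG := a%:P * pT ^+ 2 + ((a + 1) ^+ 2)%:P * pD ^+ 2 * (Mf g e t ^+ 2)%:P.
have HpG s' : pG.[s'] = G t s' by rewrite /pG /G !(hornerD, hornerN, hornerM, hornerC, horner_exp) HpT HpD.
have : pD * pG = 0.
  apply: (poly_zero_on_itv s12) => s' ss; rewrite hornerM HpD HpG.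
  have [->|/(rel _ ss) [_ ->]] := eqVneq (Df g e t s') 0; first by rewrite mul0r.
  by rewrite mulr0.
move/eqP; rewrite mulf_eq0 (negbTE pD0) /= => /eqP pG0 s'.
by rewrite -HpG pG0 horner0.
Qed.

(** The relation [G = 0] of [generic_relation] holds on a dense set of parameters,
hence everywhere; there it factors, and by continuity one of the two signs of
[lam] holds on a whole subinterval. *)
Lemma ruling_equation : (exists2 t, I t & wr e t != 0 \/ drift g e t != 0) ->
  exists al be lam, [/\ al < be, lam ^+ 2 * - a = (a + 1) ^+ 2,
    (forall t, al < t < be -> [/\ I t, Mf g e t != 0 &
       forall s, Tf g e t s = lam * Df g e t s * Mf g e t]) &
    (forall t, I t -> wr e t = 0) \/ (forall t, al < t < be -> wr e t != 0)].
Proof.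
move=> [t1 It1 wd].
have [al [be [ab abH]]] : exists al be, al < be /\ forall t, al < t < be ->
    I t /\ (exists s, Df g e t s != 0) /\ ((forall t, I t -> wr e t = 0) \/ wr e t != 0).
  have [w0|] := pselect (forall t, I t -> wr e t = 0).
    have d1 : drift g e t1 != 0 by case: wd => //; rewrite w0 // eqxx.
    have [al [be [ab H]]] := near_subinterval iI I2 It1
      (analytic_near_neq0 (analytic_drift (ga It1) (ea It1)) d1).
    exists al, be; split=> // t /H [It d]; split=> //; split; last by left.
    by exists 0; rewrite /Df mul0r addr0.
  move=> /existsNP [t2] /not_implyP [It2 /eqP w2].
  have [al [be [ab H]]] := near_subinterval iI I2 It2
    (analytic_near_neq0 (analytic_wr (ea It2)) w2).
  exists al, be; split=> // t /H [It w]; split=> //; split; last by right.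
  have [d|d] := eqVneq (drift g e t) 0; last by exists 0; rewrite /Df mul0r addr0.
  by exists 1; rewrite /Df d mul1r add0r.
have abI t : al < t < be -> I t by move=> /abH [].
have aTDM s t k : al < t < be ->
    analytic_at (fun t => Tf g e t s + k * Df g e t s * Mf g e t) t /\ analytic_at (G ^~ s) t.
  move=> /abI It; have aT := analytic_Tf (ga It) (ea It) s.
  have aD := analytic_Df (ga It) (ea It) s; have aM := analytic_Mf (ga It) (ea It).
  by split; rewrite /G; analytic.
have G0 t s : al < t < be -> G t s = 0.
  move=> tab; apply/eqP/negPn/negP => Gn0.
  have [_ Ga] := aTDM s t 0 tab.
  have [al' [be' [ab' H]]] := near_subinterval (@itvoo_is_interval _ al be)
    (itvoo_two_points ab) tab (analytic_near_neq0 Ga Gn0).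
  have [t' t'ab [_ Gz]] : exists2 t, al' < t < be' & Mf g e t != 0 /\ forall s, G t s = 0.
    apply: generic_relation => // t'' /H [t'ab _]; first exact: abI.
    by have [_ []] := abH _ t'ab.
  by have [_] := H _ t'ab; rewrite Gz eqxx.
have [t2 t2ab [M2 _]] : exists2 t, al < t < be & Mf g e t != 0 /\ forall s, G t s = 0.
  by apply: generic_relation => // t /abH [_ []].
have [al1 [be1 [ab1 H1]]] := near_subinterval (@itvoo_is_interval _ al be)
    (itvoo_two_points ab) t2ab
    (analytic_near_neq0 (analytic_Mf (ga (abI _ t2ab)) (ea (abI _ t2ab))) M2).
have sa : 0 < Num.sqrt (- a) by rewrite sqrtr_gt0 oppr_gt0.
have [lam0 lam02] : exists lam0, lam0 ^+ 2 * - a = (a + 1) ^+ 2.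
  exists ((a + 1) / Num.sqrt (- a)); rewrite expr_div_n sqr_sqrtr ?oppr_ge0 ?ltW //.
  by rewrite divfK // oppr_eq0 lt_eqF.
have sign t : al1 < t < be1 ->
    (forall s, Tf g e t s + - lam0 * Df g e t s * Mf g e t = 0) \/
    (forall s, Tf g e t s + lam0 * Df g e t s * Mf g e t = 0).
  move=> /H1 [/= tab _].
  have [pD HpD] := Df_poly g e t; have [pT HpT] := Tf_poly g e t.
  pose p1 := pT + (- lam0)%:P * pD * (Mf g e t)%:P; pose p2 := pT + lam0%:P * pD * (Mf g e t)%:P.
  have Hp1 s : p1.[s] = Tf g e t s + - lam0 * Df g e t s * Mf g e t.
    by rewrite /p1 !(hornerD, hornerN, hornerM, hornerC, horner_exp) HpT HpD.
  have Hp2 s : p2.[s] = Tf g e t s + lam0 * Df g e t s * Mf g e t.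
    by rewrite /p2 !(hornerD, hornerN, hornerM, hornerC, horner_exp) HpT HpD.
  have : p1 * p2 = 0.
    apply: (poly_zero_on_itv (ltr01 : 0 < 1 :> R)) => s _.
    rewrite hornerM Hp1 Hp2; have := G0 t s tab; rewrite /G -lam02.
    move: (Tf _ _ _ _) (Df _ _ _ _) (Mf _ _ _) => T D M Geq.
    have an : a != 0 by rewrite lt_eqF.
    by apply: (mulfI an); rewrite mulr0 -Geq; ring.
  move/eqP; rewrite mulf_eq0 => /orP[/eqP p0|/eqP p0]; [left|right] => s.
    by rewrite -Hp1 p0 horner0.
  by rewrite -Hp2 p0 horner0.
have wrH t : al1 < t < be1 -> (forall t, I t -> wr e t = 0) \/ wr e t != 0.
  by move=> /H1 [/abH [_ [_]]].
have [all1|] := pselect (forall t, al1 < t < be1 ->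
    forall s, Tf g e t s + - lam0 * Df g e t s * Mf g e t = 0).
  exists al1, be1, lam0; split=> // [t tab|].
    have [/= tab' M0] := H1 _ tab; split=> //; first exact: abI.
    by move=> s; apply/eqP; rewrite -subr_eq0 -!mulNr all1.
  have [w0|nw] := pselect (forall t, I t -> wr e t = 0); first by left.
  by right=> t /wrH [].
move=> /existsNP [t3] /not_implyP [t3ab] /existsNP [s3 /eqP n3].
have [/= t3ab' _] := H1 _ t3ab.
have [F3 _] := aTDM s3 _ (- lam0) t3ab'.
have [al2 [be2 [ab2 H2]]] := near_subinterval (@itvoo_is_interval _ al1 be1)
    (itvoo_two_points ab1) t3ab (analytic_near_neq0 F3 n3).
exists al2, be2, (- lam0); split=> //.
- by rewrite sqrrN.
- move=> t /H2 [/= tab1 n]; have [/= tab' M0] := H1 _ tab1; split=> //; first exact: abI.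
  move=> s; have [/(_ s3) h|h] := sign _ tab1; first by move: n; rewrite h eqxx.
  by apply/eqP; rewrite !mulNr -addr_eq0 h.
- have [w0|nw] := pselect (forall t, I t -> wr e t = 0); first by left.
  by right=> t /H2 [/= /wrH []].
Qed.

End global.

(** * The differential equations of the rulings *)

Lemma is_derive_div (R : realType) (f g : R -> R) (t df dg : R) :
  is_derive t 1 f df -> is_derive t 1 g dg -> g t != 0 ->
  is_derive t 1 (fun x => f x / g x) ((df * g t - f t * dg) / g t ^+ 2).
Proof.
move=> fd gd g0; have gV := is_deriveV g0 gd.
apply: is_derive_eq; rewrite /GRing.scale /=; by field.
Qed.

Lemma is_derive0_itv (R : realType) (al be : R) (F : R -> R) : al < be ->
  (forall t, al < t < be -> is_derive t 1 F 0) ->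
  exists k, forall t, al < t < be -> F t = k.
Proof.
move=> ab HF; exists (F ((al + be) / 2)) => t tab.
apply: (is_derive0_cst (@itvoo_is_interval _ al be) HF) => //.
by rewrite /=; apply/andP; split; lra.
Qed.

Lemma ruling_equation_coef (R : realType) (n m lam d w e0 e1 e2 g0 g1 g2 f0 f1 f2
    h0 h1 h2 k0 k1 k2 : R) :
  (forall s, n * det3 (e0, e1, e2) (g0 + s * f0, g1 + s * f1, g2 + s * f2)
      (h0 + s * k0, h1 + s * k1, h2 + s * k2)
    - 2 * (e0 * (g0 + s * f0) + e1 * (g1 + s * f1)) * m = lam * (d + s * w) * m) ->
  [/\ n * det3 (e0, e1, e2) (g0, g1, g2) (h0, h1, h2) - 2 * (e0 * g0 + e1 * g1) * m
        = lam * d * m,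
      n * (det3 (e0, e1, e2) (g0, g1, g2) (k0, k1, k2)
           + det3 (e0, e1, e2) (f0, f1, f2) (h0, h1, h2))
        - 2 * (e0 * f0 + e1 * f1) * m = lam * w * m &
      n * det3 (e0, e1, e2) (f0, f1, f2) (k0, k1, k2) = 0].
Proof.
move=> H.
set c0 := n * det3 _ (g0, g1, g2) (h0, h1, h2) - _.
set c1 := n * (_ + _) - _; set c2 := n * _.
have E s : c0 - lam * d * m + s * (c1 - lam * w * m) + s ^+ 2 * c2 = 0.
  by have /eqP := H s; rewrite -subr_eq0 => /eqP <-; rewrite /c0 /c1 /c2 /det3; ring.
have E0 := E 0; have E1 := E 1; have E2 := E (-1).
by split; move: E0 E1 E2; clearbody c0 c1 c2; move=> *; lra.
Qed.

Section ode.
Variables (R : realType) (al be lam : R).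
Variables (g0 g1 g2 e0 e1 e2 dg0 dg1 dg2 de0 de1 de2 : R -> R).
Variables (hg0 hg1 hg2 he0 he1 he2 : R -> R).
Hypothesis ab : al < be.
Let O t := al < t < be.
Let derives f df := forall t, O t -> is_derive t (1 : R) f (df t : R).
Hypotheses (Dg0 : derives g0 dg0) (Dg1 : derives g1 dg1) (Dg2 : derives g2 dg2).
Hypotheses (De0 : derives e0 de0) (De1 : derives e1 de1) (De2 : derives e2 de2).
Hypotheses (Hg0 : derives dg0 hg0) (Hg1 : derives dg1 hg1) (Hg2 : derives dg2 hg2).
Hypotheses (He0 : derives de0 he0) (He1 : derives de1 he1) (He2 : derives de2 he2).

Let m t := det3 (e0 t, e1 t, e2 t) (dg0 t, dg1 t, dg2 t) (de0 t, de1 t, de2 t).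
Let w t := e0 t * de1 t - e1 t * de0 t.
Let d t := e0 t * dg1 t - e1 t * dg0 t.
Let n t := e0 t ^+ 2 + e1 t ^+ 2.
Hypothesis n0 : forall t, O t -> n t != 0.
Hypothesis m0 : forall t, O t -> m t != 0.
Hypothesis eqn : forall t, O t -> forall s,
  n t * det3 (e0 t, e1 t, e2 t)
    (dg0 t + s * de0 t, dg1 t + s * de1 t, dg2 t + s * de2 t)
    (hg0 t + s * he0 t, hg1 t + s * he1 t, hg2 t + s * he2 t)
  - 2 * (e0 t * (dg0 t + s * de0 t) + e1 t * (dg1 t + s * de1 t)) * m t
  = lam * (d t + s * w t) * m t.

(** In the top view the rulings are the lines [y = const], along which the surface
is [z = G y + x * H y]; the equation says that [H] is affine and [G] quadratic. *)
Lemma parallel_rulings : (forall t, O t -> e1 t = 0) -> (forall t, O t -> de1 t = 0) ->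
  (forall t, O t -> he1 t = 0) ->
  exists A B nu k, A != 0 /\ forall t, O t ->
    e2 t = e0 t * (A * g1 t + B) /\
    g2 t - g0 t * (A * g1 t + B) = lam * A / 2 * g1 t ^+ 2 + nu * g1 t + k.
Proof.
move=> e10 de10 he10.
pose q t := e0 t * de2 t - e2 t * de0 t.
have Hm t : O t -> m t = dg1 t * q t.
  by move=> Ot; rewrite /m /q /det3 e10 // de10 //; ring.
have nz t : O t -> [/\ e0 t != 0, dg1 t != 0 & q t != 0].
  move=> Ot; have := m0 Ot; rewrite Hm // mulf_eq0 negb_or => /andP[n1 n2].
  split=> //; have := n0 Ot; rewrite /n e10 // expr0n addr0.
  by rewrite sqrf_eq0.
have Dq t : O t -> is_derive t 1 q (e0 t * he2 t - e2 t * he0 t).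
  move=> Ot; have d1 := De0 Ot; have d2 := De2 Ot; have d3 := He0 Ot; have d4 := He2 Ot.
  by apply: is_derive_eq; rewrite /GRing.scale /=; ring.
(* [A] is the slope of [H], because [e2 / e0 = H (g1)]. *)
have [A HA] : exists A, forall t, O t -> q t / (e0 t ^+ 2 * dg1 t) = A.
  apply: (is_derive0_itv ab) => t Ot; have [e00 dg10 _] := nz _ Ot.
  have d1 := De0 Ot; have d2 := Hg1 Ot; have d3 := Dq _ Ot.
  have D : is_derive t 1 (fun x => e0 x ^+ 2 * dg1 x)
      (2 * e0 t * de0 t * dg1 t + e0 t ^+ 2 * hg1 t).
    by apply: is_derive_eq; rewrite /GRing.scale /=; ring.
  have den0 : e0 t ^+ 2 * dg1 t != 0 by rewrite mulf_neq0 ?expf_neq0.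
  apply: (is_derive_eq (is_derive_div d3 D den0)).
  have [_ c1 _] := ruling_equation_coef (eqn Ot).
  move: c1; rewrite -/(m t) Hm // /n /w /det3 /q e10 // de10 // he10 // => c1.
  apply/eqP; rewrite mulf_eq0; apply/orP; left; apply/eqP.
  move: c1; move: (e0 t) (e2 t) (de0 t) (de2 t) (he0 t) (he2 t) (dg0 t) (dg1 t) (dg2 t)
    (hg0 t) (hg1 t) (hg2 t) (g1 t) => E0 E2 F0 F2 K0 K2 G0 G1 G2 H0 H1 H2 _ c1.
  match type of c1 with ?l = ?r => transitivity (l - r); first ring end.
  by rewrite c1 subrr.
have qA t : O t -> q t = A * (e0 t ^+ 2 * dg1 t).
  move=> Ot; have [e00 dg10 _] := nz _ Ot.
  by rewrite -(HA _ Ot) divfK // mulf_neq0 ?expf_neq0.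
have A0 : A != 0.
  have Om : O ((al + be) / 2) by rewrite /O !midf_lt.
  have [_ _] := nz _ Om; rewrite qA // mulf_eq0 negb_or => /andP[].
  by [].
have [B HB] : exists B, forall t, O t -> e2 t / e0 t - A * g1 t = B.
  apply: (is_derive0_itv ab) => t Ot; have [e00 dg10 _] := nz _ Ot.
  have d3 := is_derive_div (De2 Ot) (De0 Ot) e00; have d4 := Dg1 Ot.
  apply: is_derive_eq; rewrite /GRing.scale /=.
  have := qA _ Ot; rewrite /q => qe.
  have -> : de2 t * e0 t - e2 t * de0 t = A * (e0 t ^+ 2 * dg1 t) by rewrite -qe; ring.
  by field.
have e2E t : O t -> e2 t = e0 t * (A * g1 t + B).
  move=> Ot; have [e00 _ _] := nz _ Ot; rewrite -(HB _ Ot).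
  by rewrite [A * _ + _]addrC subrK mulrC divfK.
pose G t := g2 t - g0 t * (A * g1 t + B).
pose dG t := dg2 t - dg0 t * (A * g1 t + B) - A * g0 t * dg1 t.
pose hG t := hg2 t - hg0 t * (A * g1 t + B) - 2 * A * dg0 t * dg1 t - A * g0 t * hg1 t.
have DG t : O t -> is_derive t 1 G (dG t).
  move=> Ot; have d1 := Dg0 Ot; have d2 := Dg1 Ot; have d3 := Dg2 Ot.
  by apply: is_derive_eq; rewrite /GRing.scale /= /dG; ring.
have HG t : O t -> is_derive t 1 dG (hG t).
  move=> Ot; have d1 := Dg0 Ot; have d2 := Dg1 Ot; have d3 := Hg2 Ot.
  have d4 := Hg0 Ot; have d5 := Hg1 Ot.
  by apply: is_derive_eq; rewrite /GRing.scale /= /hG; ring.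
have [nu Hnu] : exists nu, forall t, O t -> dG t / dg1 t - lam * A * g1 t = nu.
  apply: (is_derive0_itv ab) => t Ot; have [e00 dg10 _] := nz _ Ot.
  have d3 := is_derive_div (HG _ Ot) (Hg1 Ot) dg10; have d4 := Dg1 Ot.
  apply: is_derive_eq; rewrite /GRing.scale /=.
  suff -> : hG t * dg1 t - dG t * hg1 t = lam * A * dg1 t ^+ 3 by field.
  have [c0 _ _] := ruling_equation_coef (eqn Ot).
  move: c0; rewrite -/(m t) Hm // qA // /n /d /det3 e10 // e2E // => c0.
  have e03 : e0 t ^+ 3 != 0 by rewrite expf_neq0.
  apply: (mulfI e03); move: c0; rewrite /hG /dG.
  move: (e0 t) (dg0 t) (dg1 t) (dg2 t) (hg0 t) (hg1 t) (hg2 t) (g0 t) (g1 t).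
  move=> E0 G0 G1 G2 H0 H1 H2 c g c0.
  apply/eqP; rewrite -subr_eq0; apply/eqP.
  match type of c0 with ?l = ?r => transitivity (l - r); first ring end.
  by rewrite c0 subrr.
have [k Hk] : exists k, forall t, O t -> G t - lam * A / 2 * g1 t ^+ 2 - nu * g1 t = k.
  apply: (is_derive0_itv ab) => t Ot; have [e00 dg10 _] := nz _ Ot.
  have d3 := DG _ Ot; have d4 := Dg1 Ot.
  apply: is_derive_eq; rewrite /GRing.scale /= -(Hnu _ Ot).
  by field.
exists A, B, nu, k; split=> // t Ot; split; first exact: e2E.
by rewrite -(Hk _ Ot) /G; ring.
Qed.

(** The coefficient of [s ^+ 2] is the determinant of [e, e', e''], so [e] stays in a
plane, which the shear to [z] makes horizontal.  The coefficient of [s] says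
that [n * z' / w + lam * z] is constant.  The constant coefficient times
[w] minus the coefficient of [s] times [d] says that the top view of the point of
striction [g - (d / w) * e] is stationary. *)
Lemma turning_rulings : (forall t, O t -> w t != 0) ->
  exists l0 l1 p0 p1 C, forall t, O t ->
   let z := g2 t - l0 * g0 t - l1 * g1 t in
   let dz := dg2 t - l0 * dg0 t - l1 * dg1 t in
   [/\ e2 t = l0 * e0 t + l1 * e1 t,
       (g0 t - p0) * e1 t = (g1 t - p1) * e0 t,
       n t * dz = w t * (C - lam * z) & dz != 0].
Proof.
move=> w0.
have Dw t : O t -> is_derive t 1 w (e0 t * he1 t - e1 t * he0 t).
  move=> Ot; have d1 := De0 Ot; have d2 := De1 Ot; have d3 := He0 Ot; have d4 := He1 Ot.
  by apply: is_derive_eq; rewrite /GRing.scale /=; ring.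
have det0 t : O t -> det3 (e0 t, e1 t, e2 t) (de0 t, de1 t, de2 t) (he0 t, he1 t, he2 t) = 0.
  move=> Ot; have [_ _ /eqP] := ruling_equation_coef (eqn Ot).
  by rewrite mulf_eq0 (negbTE (n0 Ot)) /= => /eqP.
have planar N dN k : derives N dN ->
    (forall t, dN t * w t - N t * (e0 t * he1 t - e1 t * he0 t) = k t *
      det3 (e0 t, e1 t, e2 t) (de0 t, de1 t, de2 t) (he0 t, he1 t, he2 t)) ->
    exists l, forall t, O t -> N t / w t = l.
  move=> DN HN; apply: (is_derive0_itv ab) => t Ot.
  apply: (is_derive_eq (is_derive_div (DN _ Ot) (Dw _ Ot) (w0 _ Ot))).
  by rewrite HN det0 // mulr0 mul0r.
have [l0 Hl0] : exists l, forall t, O t -> (e2 t * de1 t - de2 t * e1 t) / w t = l.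
  apply: (planar _ (fun t => e2 t * he1 t - he2 t * e1 t) (fun t => - e1 t)) => [t Ot|t].
    have d1 := De1 Ot; have d2 := De2 Ot; have d3 := He1 Ot; have d4 := He2 Ot.
    by apply: is_derive_eq; rewrite /GRing.scale /=; ring.
  by rewrite /w /det3; ring.
have [l1 Hl1] : exists l, forall t, O t -> (e0 t * de2 t - de0 t * e2 t) / w t = l.
  apply: (planar _ (fun t => e0 t * he2 t - he0 t * e2 t) e0) => [t Ot|t].
    have d1 := De0 Ot; have d2 := De2 Ot; have d3 := He0 Ot; have d4 := He2 Ot.
    by apply: is_derive_eq; rewrite /GRing.scale /=; ring.
  by rewrite /w /det3; ring.
have e2E t : O t -> e2 t = l0 * e0 t + l1 * e1 t.
  move=> Ot; rewrite -(Hl0 _ Ot) -(Hl1 _ Ot); have := w0 _ Ot; rewrite /w => wt.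
  by field.
have de2E t : O t -> de2 t = l0 * de0 t + l1 * de1 t.
  move=> Ot; rewrite -(Hl0 _ Ot) -(Hl1 _ Ot); have := w0 _ Ot; rewrite /w => wt.
  by field.
have he2E t : O t -> he2 t = l0 * he0 t + l1 * he1 t.
  move=> Ot; have := det0 _ Ot; rewrite e2E // de2E // => dt.
  apply: (mulfI (w0 _ Ot)); apply/eqP; rewrite -subr_eq0; apply/eqP; rewrite -[RHS]dt.
  by rewrite /w /det3; ring.
pose Z t := g2 t - l0 * g0 t - l1 * g1 t.
pose dZ t := dg2 t - l0 * dg0 t - l1 * dg1 t.
pose hZ t := hg2 t - l0 * hg0 t - l1 * hg1 t.
have DZ t : O t -> is_derive t 1 Z (dZ t).
  move=> Ot; have d1 := Dg0 Ot; have d2 := Dg1 Ot; have d3 := Dg2 Ot.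
  by apply: is_derive_eq; rewrite /GRing.scale /= /dZ; ring.
have HZ t : O t -> is_derive t 1 dZ (hZ t).
  move=> Ot; have d1 := Hg0 Ot; have d2 := Hg1 Ot; have d3 := Hg2 Ot.
  by apply: is_derive_eq; rewrite /GRing.scale /= /hZ; ring.
have mE t : O t -> m t = - dZ t * w t.
  by move=> Ot; rewrite /m /dZ /w /det3 e2E // de2E //; ring.
have dZ0 t : O t -> dZ t != 0.
  move=> Ot; apply/eqP => z0; have := m0 Ot.
  by rewrite mE // z0 oppr0 mul0r eqxx.
pose w' t := e0 t * he1 t - e1 t * he0 t.
have c1E t : O t -> n t * (hZ t * w t - dZ t * w' t)
    + 2 * (e0 t * de0 t + e1 t * de1 t) * dZ t * w t = - lam * w t ^+ 2 * dZ t.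
  move=> Ot; have [_ c1 _] := ruling_equation_coef (eqn Ot).
  move: c1; rewrite -/(m t) mE // /det3 e2E // de2E // he2E // => c1.
  apply/eqP; rewrite -subr_eq0; apply/eqP; move: c1; rewrite /hZ /dZ /w' /w => c1.
  match type of c1 with ?l = ?r => transitivity (l - r); first ring end.
  by rewrite c1 subrr.
have c0E t : O t -> n t * (hZ t * d t - dZ t * (e0 t * hg1 t - e1 t * hg0 t))
    + 2 * (e0 t * dg0 t + e1 t * dg1 t) * dZ t * w t = - lam * d t * dZ t * w t.
  move=> Ot; have [c0 _ _] := ruling_equation_coef (eqn Ot).
  move: c0; rewrite -/(m t) mE // /det3 e2E // => c0.
  apply/eqP; rewrite -subr_eq0; apply/eqP; move: c0; rewrite /hZ /dZ /d /w => c0.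
  match type of c0 with ?l = ?r => transitivity (l - r); first ring end.
  by rewrite c0 subrr.
have Dn t : O t -> is_derive t 1 n (2 * (e0 t * de0 t + e1 t * de1 t)).
  move=> Ot; have d1 := De0 Ot; have d2 := De1 Ot.
  by apply: is_derive_eq; rewrite /GRing.scale /=; ring.
have [C HC] : exists C, forall t, O t -> n t * dZ t / w t + lam * Z t = C.
  apply: (is_derive0_itv ab) => t Ot; have wt := w0 _ Ot.
  have D : is_derive t 1 (fun t => n t * dZ t)
     (2 * (e0 t * de0 t + e1 t * de1 t) * dZ t + n t * hZ t).
    have d1 := Dn _ Ot; have d2 := HZ _ Ot.
    by apply: is_derive_eq; rewrite /GRing.scale /=; ring.
  have d1 := is_derive_div D (Dw _ Ot) wt; have d2 := DZ _ Ot.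
  apply: is_derive_eq; rewrite /GRing.scale /=.
  suff -> : (2 * (e0 t * de0 t + e1 t * de1 t) * dZ t + n t * hZ t) * w t -
    n t * dZ t * (e0 t * he1 t - e1 t * he0 t) = - lam * w t ^+ 2 * dZ t by field.
  by rewrite -c1E // /w'; ring.
pose d' t := de0 t * dg1 t + e0 t * hg1 t - de1 t * dg0 t - e1 t * hg0 t.
have Dd t : O t -> is_derive t 1 d (d' t).
  move=> Ot; have d1 := De0 Ot; have d2 := De1 Ot; have d3 := Hg0 Ot; have d4 := Hg1 Ot.
  by apply: is_derive_eq; rewrite /GRing.scale /= /d'; ring.
(* [V] is [w ^+ 2] times the derivative of a coordinate of the striction point; [K]
and [K'] say that this derivative is orthogonal and parallel to [e]. *)
pose V (dgi ei dei : R -> R) t := w t ^+ 2 * dgi t - (d' t * w t - d t * w' t) * ei t - d t * w t * dei t.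
have K t : O t -> e0 t * V dg0 e0 de0 t + e1 t * V dg1 e1 de1 t = 0.
  move=> Ot; apply: (mulfI (dZ0 _ Ot)); rewrite mulr0.
  transitivity (w t * (n t * (hZ t * d t - dZ t * (e0 t * hg1 t - e1 t * hg0 t))
    + 2 * (e0 t * dg0 t + e1 t * dg1 t) * dZ t * w t + lam * d t * dZ t * w t)
    - d t * (n t * (hZ t * w t - dZ t * w' t)
    + 2 * (e0 t * de0 t + e1 t * de1 t) * dZ t * w t + lam * w t ^+ 2 * dZ t)).
    by rewrite /V /d' /w' /w /d /n; ring.
  by rewrite c0E // c1E // !mulNr !addNr !mulr0 subrr.
have K' t : O t -> e0 t * V dg1 e1 de1 t - e1 t * V dg0 e0 de0 t = 0.
  by move=> Ot; rewrite /V /d' /w' /w /d; ring.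
have V0 t : O t -> V dg0 e0 de0 t = 0.
  move=> Ot; apply: (mulfI (n0 Ot)); rewrite mulr0.
  transitivity (e0 t * (e0 t * V dg0 e0 de0 t + e1 t * V dg1 e1 de1 t)
    - e1 t * (e0 t * V dg1 e1 de1 t - e1 t * V dg0 e0 de0 t)); first by rewrite /n; ring.
  by rewrite K // K' // !mulr0 subrr.
have V1 t : O t -> V dg1 e1 de1 t = 0.
  move=> Ot; apply: (mulfI (n0 Ot)); rewrite mulr0.
  transitivity (e1 t * (e0 t * V dg0 e0 de0 t + e1 t * V dg1 e1 de1 t)
    + e0 t * (e0 t * V dg1 e1 de1 t - e1 t * V dg0 e0 de0 t)); first by rewrite /n; ring.
  by rewrite K // K' // !mulr0 addr0.
have striction gi ei dgi dei : derives gi dgi -> derives ei dei ->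
    (forall t, O t -> V dgi ei dei t = 0) ->
    exists p, forall t, O t -> gi t - d t / w t * ei t = p.
  move=> Dgi Dei Vi; apply: (is_derive0_itv ab) => t Ot; have wt := w0 _ Ot.
  have d1 := is_derive_div (Dd _ Ot) (Dw _ Ot) wt; have d2 := Dgi _ Ot; have d3 := Dei _ Ot.
  apply: is_derive_eq; rewrite /GRing.scale /=; apply: (mulfI (expf_neq0 2 wt)).
  by rewrite mulr0 -[RHS](Vi _ Ot) /V /w'; field.
have [p0 Hp0] := striction _ _ _ _ Dg0 De0 V0; have [p1 Hp1] := striction _ _ _ _ Dg1 De1 V1.
exists l0, l1, p0, p1, C => t Ot; split; first exact: e2E.
- by rewrite -(Hp0 _ Ot) -(Hp1 _ Ot); ring.
- rewrite -(HC _ Ot) -/(Z t) -/(dZ t); have wt := w0 _ Ot.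
  by field.
- exact: dZ0.
Qed.

End ode.

(** * Isotropic similarities and the model surfaces *)

Lemma mulmx_isotropic (R : realType) (s : bool) (h1 h2 c1 c2 c3 : R) (p b : 'cV[R]_3) :
  isotropic_mx s h1 h2 c1 c2 c3 *m p + b =
  vec3 ((-1) ^+ s * (h1 * p 0 0 - h2 * p 1 0) + b 0 0) (h2 * p 0 0 + h1 * p 1 0 + b 1 0)
    (c1 * p 0 0 + c2 * p 1 0 + c3 * p 2%:R 0 + b 2%:R 0).
Proof.
have l1 : lift ord0 ord0 = 1 :> 'I_3 by apply/val_inj.
have l2 : lift ord0 (lift ord0 ord0) = 2%:R :> 'I_3 by apply/val_inj.
have E i : (isotropic_mx s h1 h2 c1 c2 c3 *m p + b) i 0 =
    isotropic_mx s h1 h2 c1 c2 c3 i 0 * p 0 0 + isotropic_mx s h1 h2 c1 c2 c3 i 1 * p 1 0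
    + isotropic_mx s h1 h2 c1 c2 c3 i 2%:R * p 2%:R 0 + b i 0.
  by rewrite [LHS]mxE [X in X + _]mxE !big_ord_recl big_ord0 addr0 l2 l1 addrA.
rewrite [LHS]vec3E !E !mxE /=.
move: (p 0 0) (p 1 0) (p 2%:R 0) (b 0 0) (b 1 0) (b 2%:R 0) => x y z b0 b1 b2.
by congr vec3; ring.
Qed.

Lemma isotropic_unitmx (R : realType) (s : bool) (h1 h2 c1 c2 c3 : R) :
  isotropic_mx s h1 h2 c1 c2 c3 \in unitmx = (h1 ^+ 2 + h2 ^+ 2 != 0) && (c3 != 0).
Proof.
have -> : isotropic_mx s h1 h2 c1 c2 c3 \in unitmx =
    ((-1) ^+ s * (h1 ^+ 2 + h2 ^+ 2) * c3 != 0).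
  rewrite unitmxE unitfE; congr (_ != 0).
  rewrite (expand_det_row _ 0) !big_ord_recl big_ord0 /cofactor !det_mx2E !mxE /=.
  by ring.
by rewrite !mulf_eq0 signr_eq0 /= negb_or.
Qed.

Lemma isotropic_similarity_intro (R : realType) (s : bool) (h1 h2 c1 c2 c3 b0 b1 b2 : R) :
  h1 ^+ 2 + h2 ^+ 2 != 0 -> c3 != 0 ->
  isotropic_similarity (fun p : 'cV[R]_3 =>
    vec3 ((-1) ^+ s * (h1 * p 0 0 - h2 * p 1 0) + b0) (h2 * p 0 0 + h1 * p 1 0 + b1)
      (c1 * p 0 0 + c2 * p 1 0 + c3 * p 2%:R 0 + b2)).
Proof.
move=> h0 c30; exists s, h1, h2, c1, c2, c3, (vec3 b0 b1 b2).
split; first by rewrite isotropic_unitmx h0.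
by move=> p; rewrite mulmx_isotropic !mxE.
Qed.

Lemma isotropic_similarity_elim (R : realType) (T : 'cV[R]_3 -> 'cV[R]_3) :
  isotropic_similarity T -> exists s h1 h2 c1 c2 c3 b0 b1 b2,
    [/\ h1 ^+ 2 + h2 ^+ 2 != 0, c3 != 0 & forall p, T p =
    vec3 ((-1) ^+ nat_of_bool s * (h1 * p 0 0 - h2 * p 1 0) + b0) (h2 * p 0 0 + h1 * p 1 0 + b1)
      (c1 * p 0 0 + c2 * p 1 0 + c3 * p 2%:R 0 + b2)].
Proof.
move=> [s [h1 [h2 [c1 [c2 [c3 [b [+ HT]]]]]]]].
rewrite isotropic_unitmx => /andP[h0 c30].
exists s, h1, h2, c1, c2, c3, (b 0 0), (b 1 0), (b 2%:R 0); split=> // p.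
by rewrite HT mulmx_isotropic.
Qed.

(** The quadratic part is [A * Y * (X + lam / 2 * Y)]: its two null lines have to be
turned to those of [x ^+ 2 + a * y ^+ 2], namely [x = b * y] and [x = - b * y] with
[b ^+ 2 = - a].  Both pairs enclose the same angle because [lam * b] is
[b ^+ 2 - 1] up to sign; for one of the signs a reflection [s] is used as well. *)
Lemma saddle_similar (R : realType) (a lam A B nu k c0 c1 : R) (S : set 'cV[R]_3) :
  a < 0 -> lam ^+ 2 * - a = (a + 1) ^+ 2 -> A != 0 -> c0 ^+ 2 + c1 ^+ 2 != 0 ->
  (forall p, S p -> let X := c0 * p 0 0 + c1 * p 1 0 in let Y := c0 * p 1 0 - c1 * p 0 0 in
     p 2%:R 0 = X * (A * Y + B) + lam * A / 2 * Y ^+ 2 + nu * Y + k) ->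
  exists T, isotropic_similarity T /\ forall p, S p -> paraboloid a (T p).
Proof.
move=> a0 lama A0 c_0 HS.
pose b := Num.sqrt (- a).
have b0 : 0 < b by rewrite sqrtr_gt0 oppr_gt0.
have ab : a = - b ^+ 2 by rewrite /b sqr_sqrtr ?opprK // oppr_ge0 ltW.
have b2 : 1 + b ^+ 2 != 0 by rewrite gt_eqF // ltr_pwDl ?ltr01 ?sqr_ge0.
clearbody b; have bn : b != 0 by rewrite gt_eqF.
have [s lb] : exists s : bool, lam * b = (-1) ^+ s * (b ^+ 2 - 1).
  have : (lam * b - (b ^+ 2 - 1)) * (lam * b + (b ^+ 2 - 1)) = 0.
    transitivity (lam ^+ 2 * b ^+ 2 - (- b ^+ 2 + 1) ^+ 2); first by ring.
    by rewrite -ab -lama ab opprK subrr.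
  move/eqP; rewrite mulf_eq0 subr_eq0 addr_eq0 => /orP[/eqP e|/eqP e].
    by exists false; rewrite mul1r.
  by exists true; rewrite mulN1r.
have le : lam = (-1) ^+ s * (b ^+ 2 - 1) / b by rewrite -lb mulfK.
pose h1 := b * c0 + (-1) ^+ s * c1; pose h2 := (-1) ^+ s * c0 - b * c1.
pose c3 := - (-1) ^+ s * 2 * b * (1 + b ^+ 2) / A.
have h0 : h1 ^+ 2 + h2 ^+ 2 != 0.
  have -> : h1 ^+ 2 + h2 ^+ 2 = (((-1) ^+ s) ^+ 2 + b ^+ 2) * (c0 ^+ 2 + c1 ^+ 2).
    by rewrite /h1 /h2; ring.
  by rewrite sqrr_sign mulf_neq0.
have c30 : c3 != 0 by rewrite /c3 !mulf_neq0 ?invr_eq0 ?oppr_eq0 ?signr_eq0 ?pnatr_eq0.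
eexists; split.
  exact: (@isotropic_similarity_intro _ s h1 h2 (c3 * (- B * c0 + nu * c1))
    (c3 * (- B * c1 - nu * c0)) c3 0 0 (- c3 * k) h0 c30).
move=> p /HS /= ->; rewrite /paraboloid /=.
exists ((-1) ^+ s * (h1 * p 0 0 - h2 * p 1 0)), (h2 * p 0 0 + h1 * p 1 0).
move: (p 0 0) (p 1 0) => x y; rewrite !addr0; congr vec3.
rewrite ab /h1 /h2 /c3 le; case: (s); rewrite ?expr0 ?expr1; field; by rewrite bn A0.
Qed.

Lemma on_ray (R : realType) (x y v : R) : x * sin v = y * cos v ->
  exists u, x = u * cos v /\ y = u * sin v.
Proof.
move=> e; exists (x * cos v + y * sin v); have cs := cos2Dsin2 v; split.
- transitivity (x * (cos v ^+ 2 + sin v ^+ 2)); first by rewrite cs mulr1.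
  transitivity (x * cos v ^+ 2 + (x * sin v) * sin v); first by ring.
  by rewrite e; ring.
- transitivity (y * (cos v ^+ 2 + sin v ^+ 2)); first by rewrite cs mulr1.
  transitivity ((y * cos v) * cos v + y * sin v ^+ 2); first by ring.
  by rewrite -e; ring.
Qed.

Lemma helicoid_similar (R : realType) (l0 l1 p0 p1 C v0 : R) (S : set 'cV[R]_3) :
  C != 0 ->
  (forall p, S p -> let v := (p 2%:R 0 - l0 * p 0 0 - l1 * p 1 0) / C + v0 in
     (p 0 0 - p0) * sin v = (p 1 0 - p1) * cos v) ->
  exists T, isotropic_similarity T /\ forall p, S p -> helicoid R (T p).
Proof.
move=> C0 HS; have h0 : (1 : R) ^+ 2 + 0 ^+ 2 != 0 by rewrite expr1n expr0n addr0 oner_neq0.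
have c30 : C^-1 != 0 by rewrite invr_eq0.
eexists; split.
  exact: (@isotropic_similarity_intro _ false 1 0 (- l0 / C) (- l1 / C) C^-1 (- p0) (- p1)
    v0 h0 c30).
move=> p /HS /=; set v := (_ / C + v0) => /on_ray [u [ux uy]].
exists u, v; rewrite -ux -uy /v.
by move: (p 0 0) (p 1 0) (p 2%:R 0) => x y z; congr vec3; rewrite ?expr0; ring.
Qed.

(** [lam] is the exponent of the model up to sign; the reflection of [x], that is,
[v |-> pi - v], reverses the sign. *)
Lemma exp_helicoid_similar (R : realType) (a lam l0 l1 p0 p1 z0 k : R)
    (S : set 'cV[R]_3) :
  a < 0 -> lam ^+ 2 * - a = (a + 1) ^+ 2 -> k != 0 ->
  (forall p, S p -> exists2 v, (p 0 0 - p0) * sin v = (p 1 0 - p1) * cos v &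
     p 2%:R 0 - l0 * p 0 0 - l1 * p 1 0 - z0 = k * expR (- lam * v)) ->
  exists T, isotropic_similarity T /\ forall p, S p -> exp_helicoid a (T p).
Proof.
move=> a0 lama k0 HS.
have h0 : (1 : R) ^+ 2 + 0 ^+ 2 != 0 by rewrite expr1n expr0n addr0 oner_neq0.
set c := (a + 1) / Num.sqrt `|a|.
have sa : 0 < Num.sqrt `|a| by rewrite sqrtr_gt0 normr_gt0 lt_eqF.
have c2 : c ^+ 2 = lam ^+ 2.
  have na : - a != 0 by rewrite oppr_eq0 lt_eqF.
  apply: (mulIf na); rewrite lama /c expr_div_n sqr_sqrtr // ltr0_norm //.
  by rewrite divfK.
have [cl|cl] : - lam = c \/ lam = c.
  have /eqP := c2; rewrite eqf_sqr => /orP[/eqP ->|/eqP ->]; [by right|by left].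
- have c30 : k^-1 != 0 by rewrite invr_eq0.
  eexists; split.
    exact: (@isotropic_similarity_intro _ false 1 0 (- l0 / k) (- l1 / k) k^-1 (- p0) (- p1)
      (- z0 / k) h0 c30).
  move=> p /HS [v /on_ray [u [ux uy]] HZ].
  exists u, v; rewrite -ux -uy -/c -cl.
  have -> : expR (- lam * v) = (p 2%:R 0 - l0 * p 0 0 - l1 * p 1 0 - z0) / k.
    by rewrite HZ // [RHS]mulrC mulKf.
  by move: (p 0 0) (p 1 0) (p 2%:R 0) => x y z; congr vec3; rewrite ?expr0; ring.
- pose k' := expR (c * pi) / k.
  have c30 : k' != 0 by rewrite mulf_neq0 ?invr_eq0 // gt_eqF // expR_gt0.
  eexists; split.
    exact: (@isotropic_similarity_intro _ true 1 0 (- l0 * k') (- l1 * k') k' p0 (- p1)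
      (- z0 * k') h0 c30).
  move=> p /HS [v /on_ray [u [ux uy]] HZ].
  exists u, (pi - v); rewrite -/c.
  have -> : expR (c * (pi - v)) = (p 2%:R 0 - l0 * p 0 0 - l1 * p 1 0 - z0) * k'.
    by rewrite HZ // /k' mulrBr expRD -cl mulNr; field.
  have -> : cos (pi - v) = - cos v by rewrite cosB cospi sinpi; ring.
  have -> : sin (pi - v) = sin v by rewrite sinB cospi sinpi; ring.
  rewrite mulrN -ux -uy.
  by move: (p 0 0) (p 1 0) (p 2%:R 0) => x y z; congr vec3; rewrite ?expr1; ring.
Qed.

(** * Integration of the equations *)

Lemma zero_on_is_derive (R : realType) (al be : R) (F : R -> R) (t l : R) :
  (forall x, al < x < be -> F x = 0) -> al < t < be -> is_derive t 1 F l -> l = 0.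
Proof.
move=> F0 tab D.
have D0 : is_derive t 1 F 0.
  have Dc : is_derive t (1 : R) (cst (0 : R)) (0 : R) by exact: is_derive_cst.
  apply: near_eq_is_derive Dc.
  near=> x; rewrite F0 //.
  have : x \in `]al, be[ by near: x; apply: near_in_itvoo; rewrite in_itv.
  by rewrite in_itv.
by rewrite -(@derive_val _ _ _ _ _ _ _ D) (@derive_val _ _ _ _ _ _ _ D0).
Unshelve. all: by end_near. Qed.

(** The direction [e] turns at speed [w / n]; so it follows any function [v] with
that derivative, once it does so at one parameter.  Indeed the square
of the component of [e] orthogonal to the angle [v], divided by [n], is constant. *)
Lemma direction_along (R : realType) (I : set R) (e0 e1 v de0 de1 dv : R -> R) t0 :
  is_interval I -> I t0 ->
  (forall t, I t -> is_derive t 1 e0 (de0 t)) ->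
  (forall t, I t -> is_derive t 1 e1 (de1 t)) ->
  (forall t, I t -> is_derive t 1 v (dv t)) ->
  (forall t, I t -> e0 t ^+ 2 + e1 t ^+ 2 != 0) ->
  (forall t, I t -> (e0 t ^+ 2 + e1 t ^+ 2) * dv t = e0 t * de1 t - e1 t * de0 t) ->
  e0 t0 * sin (v t0) = e1 t0 * cos (v t0) ->
  forall t, I t -> e0 t * sin (v t) = e1 t * cos (v t).
Proof.
move=> iI It0 D0 D1 Dv n0 Hv H0.
pose n t := e0 t ^+ 2 + e1 t ^+ 2.
pose U t := e0 t * sin (v t) - e1 t * cos (v t).
pose dU t := de0 t * sin (v t) + e0 t * (cos (v t) * dv t)
  - (de1 t * cos (v t) + e1 t * (- sin (v t) * dv t)).
have DU t : I t -> is_derive t 1 U (dU t).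
  move=> It; have d0 := D0 _ It; have d1 := D1 _ It; have d2 := Dv _ It.
  by apply: is_derive_eq; rewrite /GRing.scale /= /dU; ring.
have nU t : I t -> n t * dU t = (e0 t * de0 t + e1 t * de1 t) * U t.
  move=> It; have e := Hv _ It.
  transitivity (n t * (de0 t * sin (v t) - de1 t * cos (v t))
     + (n t * dv t) * (e0 t * cos (v t) + e1 t * sin (v t))); first by rewrite /dU; ring.
  by rewrite e /n /U; ring.
have F0 t : I t -> U t ^+ 2 / n t = U t0 ^+ 2 / n t0.
  move=> It; apply: (@is_derive0_cst _ I (fun t => U t ^+ 2 / n t)) => // {It}t It.
  have d0 := D0 _ It; have d1 := D1 _ It; have dU' := DU _ It.
  have Dn : is_derive t 1 n (2 * (e0 t * de0 t + e1 t * de1 t)).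
    by apply: is_derive_eq; rewrite /GRing.scale /=; ring.
  have DU2 : is_derive t 1 (fun t => U t ^+ 2) (2 * U t * dU t).
    by apply: is_derive_eq; rewrite /GRing.scale /=; ring.
  apply: (is_derive_eq (is_derive_div DU2 Dn (n0 _ It))).
  rewrite [X in X / _](_ : _ = 2 * U t * (n t * dU t) -
     2 * U t ^+ 2 * (e0 t * de0 t + e1 t * de1 t)); last by ring.
  by rewrite nU // [X in X / _](_ : _ = 0) ?mul0r //; ring.
move=> t It; apply/eqP; rewrite -subr_eq0 -/(U t) -sqrf_eq0.
have := F0 _ It; rewrite {2}/U H0 subrr expr0n mul0r => /eqP.
by rewrite mulf_eq0 invr_eq0 (negbTE (n0 _ It)) orbF.
Qed.

Lemma polar_angle (R : realType) (x y : R) : exists v, x * sin v = y * cos v.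
Proof.
have [->|x0] := eqVneq x 0; first by exists (pi / 2); rewrite cos_pihalf mul0r mulr0.
exists (atan (y / x)); have c0 : cos (atan (y / x)) != 0.
  by rewrite cos_atan invr_eq0 sqrtr_eq0 -ltNge ltr_pwDl ?ltr01 ?sqr_ge0.
have := atanK (y / x); rewrite /tan => /(canRL (divfK c0)) ->.
by field.
Qed.

Lemma constant_direction (R : realType) (I : set R) (e0 e1 de0 de1 : R -> R) t0 :
  is_interval I -> I t0 ->
  (forall t, I t -> is_derive t 1 e0 (de0 t)) ->
  (forall t, I t -> is_derive t 1 e1 (de1 t)) ->
  (forall t, I t -> e0 t ^+ 2 + e1 t ^+ 2 != 0) ->
  (forall t, I t -> e0 t * de1 t - e1 t * de0 t = 0) ->
  forall t, I t -> e0 t0 * e1 t - e1 t0 * e0 t = 0.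
Proof.
move=> iI It0 D0 D1 n0 w0 t It; set c0 := e0 t0; set c1 := e1 t0.
have [v Hv] := polar_angle c0 c1.
have e := @direction_along _ I e0 e1 (cst v) de0 de1 (cst 0) t0 iI It0 D0 D1 _ n0 _ Hv t It.
have {}e : e0 t * sin v = e1 t * cos v.
  by apply: e => x Ix; rewrite mulr0 -(w0 _ Ix).
have cs := cos2Dsin2 v.
rewrite -[LHS]mulr1 -cs.
transitivity ((e1 t * cos v - e0 t * sin v) * (c0 * cos v + c1 * sin v)
   + (c0 * sin v - c1 * cos v) * (e0 t * cos v + e1 t * sin v)); first by ring.
by rewrite e Hv !subrr !mul0r addr0.
Qed.

Section closed_form.
Variables (R : realType) (I : set R) (al be lam : R).
Variables (g0 g1 g2 e0 e1 e2 : R -> R).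
Hypothesis iI : is_interval I.
Hypothesis ab : al < be.
Let O t := al < t < be.
Hypothesis OI : forall t, O t -> I t.
Hypothesis g0a : forall t, I t -> analytic_at g0 t.
Hypothesis g1a : forall t, I t -> analytic_at g1 t.
Hypothesis g2a : forall t, I t -> analytic_at g2 t.
Hypothesis e0a : forall t, I t -> analytic_at e0 t.
Hypothesis e1a : forall t, I t -> analytic_at e1 t.
Hypothesis e2a : forall t, I t -> analytic_at e2 t.

Let dg0 := derive1 g0. Let dg1 := derive1 g1. Let dg2 := derive1 g2.
Let de0 := derive1 e0. Let de1 := derive1 e1. Let de2 := derive1 e2.
Let hg0 := derive1 dg0. Let hg1 := derive1 dg1. Let hg2 := derive1 dg2.
Let he0 := derive1 de0. Let he1 := derive1 de1. Let he2 := derive1 de2.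
Let n t := e0 t ^+ 2 + e1 t ^+ 2.
Let w t := e0 t * de1 t - e1 t * de0 t.
Let m t := det3 (e0 t, e1 t, e2 t) (dg0 t, dg1 t, dg2 t) (de0 t, de1 t, de2 t).

Hypothesis n0 : forall t, I t -> n t != 0.
Hypothesis m0 : forall t, O t -> m t != 0.
Hypothesis eqn : forall t, O t -> forall s,
  n t * det3 (e0 t, e1 t, e2 t)
    (dg0 t + s * de0 t, dg1 t + s * de1 t, dg2 t + s * de2 t)
    (hg0 t + s * he0 t, hg1 t + s * he1 t, hg2 t + s * he2 t)
  - 2 * (e0 t * (dg0 t + s * de0 t) + e1 t * (dg1 t + s * de1 t)) * m t
  = lam * (e0 t * dg1 t - e1 t * dg0 t + s * w t) * m t.

Let D1 (f : R -> R) : (forall t, I t -> analytic_at f t) ->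
  forall t, I t -> is_derive t 1 f (derive1 f t).
Proof. by move=> fa t It; exact/analytic_is_derive/fa. Qed.

Let a1 (f : R -> R) : (forall t, I t -> analytic_at f t) ->
  forall t, I t -> analytic_at (derive1 f) t.
Proof. by move=> fa t It; exact/analytic_derive1/fa. Qed.

Let D2 (f : R -> R) : (forall t, I t -> analytic_at f t) ->
  forall t, I t -> is_derive t 1 (derive1 f) (derive1 (derive1 f) t).
Proof. by move=> fa t It; apply: D1 => //; exact: a1. Qed.

Let mid := (al + be) / 2.
Let Omid : O mid. Proof. by rewrite /O /mid !midf_lt. Qed.

Let extend (F : R -> R) : (forall t, I t -> analytic_at F t) ->
  (forall t, O t -> F t = 0) -> forall t, I t -> F t = 0.
Proof.
move=> Fa F0 t It; apply: (@nbhs_singleton _ t (fun t => F t = 0)).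
by apply: (@identity_theorem _ I F al be).
Qed.

(** [parallel_rulings] in coordinates rotated so that [e] points along the first
axis. *)
Lemma parallel_closed_form : (forall t, I t -> w t = 0) ->
  exists A B nu k c0 c1, [/\ A != 0, c0 ^+ 2 + c1 ^+ 2 != 0 & forall t s, I t ->
   let X := c0 * (g0 t + s * e0 t) + c1 * (g1 t + s * e1 t) in
   let Y := c0 * (g1 t + s * e1 t) - c1 * (g0 t + s * e0 t) in
   g2 t + s * e2 t = X * (A * Y + B) + lam * A / 2 * Y ^+ 2 + nu * Y + k].
Proof.
move=> w0; pose c0 := e0 mid; pose c1 := e1 mid.
have Imid := OI Omid.
have c_0 : c0 ^+ 2 + c1 ^+ 2 != 0 by exact: n0.
pose rx (f0 f1 : R -> R) t := c0 * f0 t + c1 * f1 t.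
pose ry (f0 f1 : R -> R) t := c0 * f1 t - c1 * f0 t.
pose E0 := rx e0 e1; pose E1 := ry e0 e1; pose G0 := rx g0 g1; pose G1 := ry g0 g1.
have E10 t : I t -> E1 t = 0.
  exact: (@constant_direction _ I e0 e1 de0 de1 mid iI Imid (D1 e0a) (D1 e1a) n0 w0).
have lin (f0 f1 df0 df1 : R -> R) (t : R) : is_derive t 1 f0 (df0 t) -> is_derive t 1 f1 (df1 t) ->
    is_derive t 1 (rx f0 f1) (rx df0 df1 t) /\ is_derive t 1 (ry f0 f1) (ry df0 df1 t).
  by move=> d0 d1; rewrite /rx /ry; split; apply: is_derive_eq; rewrite /GRing.scale /=; ring.
have lin1 t (Ot : O t) := lin _ _ _ _ t (D1 g0a (OI Ot)) (D1 g1a (OI Ot)).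
have lin2 t (Ot : O t) := lin _ _ _ _ t (D1 e0a (OI Ot)) (D1 e1a (OI Ot)).
have lin3 t (Ot : O t) := lin _ _ _ _ t (D2 g0a (OI Ot)) (D2 g1a (OI Ot)).
have lin4 t (Ot : O t) := lin _ _ _ _ t (D2 e0a (OI Ot)) (D2 e1a (OI Ot)).
have dE10 t : O t -> ry de0 de1 t = 0.
  move=> Ot; have [_ d] := lin2 _ Ot.
  by apply: (zero_on_is_derive _ Ot d) => x /OI /E10.
have hE10 t : O t -> ry he0 he1 t = 0.
  move=> Ot; have [_ d] := lin4 _ Ot.
  by apply: (zero_on_is_derive _ Ot d) => x /dE10.
have Hn t : O t -> E0 t ^+ 2 + E1 t ^+ 2 != 0.
  move=> Ot; have -> : E0 t ^+ 2 + E1 t ^+ 2 = (c0 ^+ 2 + c1 ^+ 2) * n t.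
    by rewrite /E0 /E1 /rx /ry /n; ring.
  by rewrite mulf_neq0 // n0 //; exact: OI.
have Hm t : O t -> det3 (E0 t, E1 t, e2 t) (rx dg0 dg1 t, ry dg0 dg1 t, dg2 t)
    (rx de0 de1 t, ry de0 de1 t, de2 t) != 0.
  move=> Ot; rewrite (_ : det3 _ _ _ = (c0 ^+ 2 + c1 ^+ 2) * m t).
    by rewrite mulf_neq0 // m0.
  by rewrite /E0 /E1 /rx /ry /m /det3; ring.
have Heq t : O t -> forall s, (E0 t ^+ 2 + E1 t ^+ 2) * det3 (E0 t, E1 t, e2 t)
    (rx dg0 dg1 t + s * rx de0 de1 t, ry dg0 dg1 t + s * ry de0 de1 t, dg2 t + s * de2 t)
    (rx hg0 hg1 t + s * rx he0 he1 t, ry hg0 hg1 t + s * ry he0 he1 t, hg2 t + s * he2 t)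
  - 2 * (E0 t * (rx dg0 dg1 t + s * rx de0 de1 t) + E1 t * (ry dg0 dg1 t + s * ry de0 de1 t)) *
    det3 (E0 t, E1 t, e2 t) (rx dg0 dg1 t, ry dg0 dg1 t, dg2 t)
      (rx de0 de1 t, ry de0 de1 t, de2 t) =
  lam * (E0 t * ry dg0 dg1 t - E1 t * rx dg0 dg1 t
     + s * (E0 t * ry de0 de1 t - E1 t * rx de0 de1 t)) *
    det3 (E0 t, E1 t, e2 t) (rx dg0 dg1 t, ry dg0 dg1 t, dg2 t)
      (rx de0 de1 t, ry de0 de1 t, de2 t).
  move=> Ot s; have := eqn Ot s.
  have -> : E0 t ^+ 2 + E1 t ^+ 2 = (c0 ^+ 2 + c1 ^+ 2) * n t.
    by rewrite /E0 /E1 /rx /ry /n; ring.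
  have -> : det3 (E0 t, E1 t, e2 t) (rx dg0 dg1 t, ry dg0 dg1 t, dg2 t)
     (rx de0 de1 t, ry de0 de1 t, de2 t) = (c0 ^+ 2 + c1 ^+ 2) * m t.
    by rewrite /E0 /E1 /rx /ry /m /det3; ring.
  set P := n t * _ - _; set Q := lam * _ * _ => PQ.
  transitivity ((c0 ^+ 2 + c1 ^+ 2) ^+ 2 * P).
    rewrite /P /det3 /E0 /E1 /rx /ry.
    move: (n t) (m t) (e0 t) (e1 t) (e2 t) (dg0 t) (dg1 t) (dg2 t) (de0 t) (de1 t) (de2 t)
      (hg0 t) (hg1 t) (hg2 t) (he0 t) (he1 t) (he2 t) => *; ring.
  by rewrite PQ /Q /E0 /E1 /rx /ry /w; ring.
have [A [B [nu [k [A0 HO]]]]] := @parallel_rulings R al be lam G0 G1 g2 E0 E1 e2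
  (rx dg0 dg1) (ry dg0 dg1) dg2 (rx de0 de1) (ry de0 de1) de2
  (rx hg0 hg1) (ry hg0 hg1) hg2 (rx he0 he1) (ry he0 he1) he2 ab
  (fun t Ot => proj1 (lin1 t Ot)) (fun t Ot => proj2 (lin1 t Ot))
  (fun t Ot => D1 g2a (OI Ot))
  (fun t Ot => proj1 (lin2 t Ot)) (fun t Ot => D1 e2a (OI Ot))
  (fun t Ot => proj1 (lin3 t Ot)) (fun t Ot => proj2 (lin3 t Ot))
  (fun t Ot => D2 g2a (OI Ot))
  (fun t Ot => proj1 (lin4 t Ot)) (fun t Ot => D2 e2a (OI Ot))
  Hn Hm Heq (fun t Ot => E10 t (OI Ot)) dE10 hE10.
exists A, B, nu, k, c0, c1; split=> // t s It /=.
have G0a x : I x -> analytic_at G0 x.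
  by move=> Ix; have := g0a Ix; have := g1a Ix => ? ?; rewrite /G0 /rx; analytic.
have G1a x : I x -> analytic_at G1 x.
  by move=> Ix; have := g0a Ix; have := g1a Ix => ? ?; rewrite /G1 /ry; analytic.
have E0a x : I x -> analytic_at E0 x.
  by move=> Ix; have := e0a Ix; have := e1a Ix => ? ?; rewrite /E0 /rx; analytic.
have F1 : e2 t - E0 t * (A * G1 t + B) = 0.
  apply: (@extend (fun t => e2 t - E0 t * (A * G1 t + B))) => // x.
    by move=> Ix; have := G1a _ Ix; have := E0a _ Ix; have := e2a Ix => ? ? ?; analytic.
  by move=> /HO [-> _]; rewrite subrr.
have F2 : g2 t - G0 t * (A * G1 t + B) - (lam * A / 2 * G1 t ^+ 2 + nu * G1 t + k) = 0.
  apply: (@extend (fun t => g2 t - G0 t * (A * G1 t + B) -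
     (lam * A / 2 * G1 t ^+ 2 + nu * G1 t + k))) => // x.
    by move=> Ix; have := G1a _ Ix; have := G0a _ Ix; have := g2a Ix => ? ? ?; analytic.
  by move=> /HO [_ ->]; rewrite subrr.
have YE : c0 * (g1 t + s * e1 t) - c1 * (g0 t + s * e0 t) = G1 t.
  by rewrite -[RHS](addr0 (G1 t)) -(mulr0 s) -(E10 _ It) /G1 /E1 /ry; ring.
have XE : c0 * (g0 t + s * e0 t) + c1 * (g1 t + s * e1 t) = G0 t + s * E0 t.
  by rewrite /G0 /E0 /rx; ring.
rewrite YE XE (subr0_eq F1).
by rewrite -[g2 t](subrK (G0 t * (A * G1 t + B))) (subr0_eq F2); ring.
Qed.

(** For [lam = 0] the angle is an affine function of the height [Z].  Otherwise
[Z1 = Z - C / lam] satisfies [n * Z1' = - lam * w * Z1]; so it has no zeros, and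
[v = - ln (Z1 ^+ 2) / (2 * lam)] has the derivative [w / n] required of the angle. *)
Lemma turning_closed_form : (forall t, O t -> w t != 0) ->
  exists l0 l1 p0 p1,
   (lam = 0 /\ exists C v0, C != 0 /\ forall t s, I t ->
      let x := g0 t + s * e0 t in let y := g1 t + s * e1 t in
      let v := (g2 t + s * e2 t - l0 * x - l1 * y) / C + v0 in
      (x - p0) * sin v = (y - p1) * cos v) \/
   (lam != 0 /\ exists z0 k, k != 0 /\ forall t s, I t ->
      let x := g0 t + s * e0 t in let y := g1 t + s * e1 t in
      exists2 v, (x - p0) * sin v = (y - p1) * cos v &
      g2 t + s * e2 t - l0 * x - l1 * y - z0 = k * expR (- lam * v)).
Proof.
move=> w0.
have [l0 [l1 [p0 [p1 [C HO]]]]] := @turning_rulings R al be lam g0 g1 g2 e0 e1 e2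
  dg0 dg1 dg2 de0 de1 de2 hg0 hg1 hg2 he0 he1 he2 ab
  (fun t Ot => D1 g0a (OI Ot)) (fun t Ot => D1 g1a (OI Ot)) (fun t Ot => D1 g2a (OI Ot))
  (fun t Ot => D1 e0a (OI Ot)) (fun t Ot => D1 e1a (OI Ot)) (fun t Ot => D1 e2a (OI Ot))
  (fun t Ot => D2 g0a (OI Ot)) (fun t Ot => D2 g1a (OI Ot)) (fun t Ot => D2 g2a (OI Ot))
  (fun t Ot => D2 e0a (OI Ot)) (fun t Ot => D2 e1a (OI Ot)) (fun t Ot => D2 e2a (OI Ot))
  (fun t Ot => n0 (OI Ot)) m0 eqn w0.
have Imid := OI Omid.
pose Z t := g2 t - l0 * g0 t - l1 * g1 t.
pose dZ t := dg2 t - l0 * dg0 t - l1 * dg1 t.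
have DZ t : I t -> is_derive t 1 Z (dZ t).
  move=> It; have d0 := D1 g0a It; have d1 := D1 g1a It; have d2 := D1 g2a It.
  by apply: is_derive_eq; rewrite /GRing.scale /= /dZ /dg0 /dg1 /dg2; ring.
have E2 t : I t -> e2 t - (l0 * e0 t + l1 * e1 t) = 0.
  move=> It; apply: (@extend (fun t => e2 t - (l0 * e0 t + l1 * e1 t))) => // x.
    by move=> Ix; have := e0a Ix; have := e1a Ix; have := e2a Ix => ? ? ?; analytic.
  by move=> /HO [-> _ _ _]; rewrite subrr.
have P t : I t -> (g0 t - p0) * e1 t - (g1 t - p1) * e0 t = 0.
  move=> It; apply: (@extend (fun t => (g0 t - p0) * e1 t - (g1 t - p1) * e0 t)) => // x.
    move=> Ix; have := e0a Ix; have := e1a Ix; have := g0a Ix; have := g1a Ix => ? ? ? ?.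
    by analytic.
  by move=> /HO [_ -> _ _]; rewrite subrr.
pose F t := n t * dZ t - w t * (C - lam * Z t).
have Fa t : I t -> analytic_at F t.
  move=> It; have := e0a It; have := e1a It; have := g0a It; have := g1a It.
  have := g2a It => a5 a4 a3 a2 a1'.
  by rewrite /F /n /dZ /w /Z /de1 /de0 /dg0 /dg1 /dg2; analytic.
have F0 t : O t -> F t = 0 by move=> /HO [_ _ e _]; rewrite /F e subrr.
have FI t : I t -> n t * dZ t = w t * (C - lam * Z t).
  by move=> It; apply/eqP; rewrite -subr_eq0; apply/eqP; exact: (extend Fa F0).
have ZE t s : I t -> g2 t + s * e2 t - l0 * (g0 t + s * e0 t) - l1 * (g1 t + s * e1 t) = Z t.
  by move=> It; rewrite (subr0_eq (E2 _ It)) /Z; ring.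
have ray t s v : I t -> e0 t * sin v = e1 t * cos v ->
    (g0 t + s * e0 t - p0) * sin v = (g1 t + s * e1 t - p1) * cos v.
  move=> It ev; apply: (mulfI (n0 It)); apply/eqP; rewrite -subr_eq0; apply/eqP.
  have pe := P _ It.
  transitivity ((n t * s + (g0 t - p0) * e0 t + (g1 t - p1) * e1 t) * (e0 t * sin v - e1 t * cos v)
     + ((g0 t - p0) * e1 t - (g1 t - p1) * e0 t) * (e1 t * sin v + e0 t * cos v)).
    rewrite /n; ring.
  by rewrite ev pe subrr mulr0 mul0r addr0.
exists l0, l1, p0, p1.
have [lam0|lam0] := eqVneq lam 0; [left|right]; split=> //.
  have [_ _ cm dz0] := HO _ Omid.
  have C0 : C != 0.
    apply/eqP => c0; move: cm; rewrite lam0 c0 mul0r subr0 mulr0 => /eqP.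
    by rewrite mulf_eq0 (negbTE (n0 Imid)) (negbTE dz0).
  have [v1 Hv1] := polar_angle (e0 mid) (e1 mid).
  exists C, (v1 - Z mid / C); split=> // t s It /=; rewrite ZE //; apply: ray => //.
  apply: (@direction_along _ I e0 e1 (fun t => Z t / C + (v1 - Z mid / C)) de0 de1
    (fun t => dZ t / C) mid iI Imid (D1 e0a) (D1 e1a)) => //.
  - move=> x Ix; have d := DZ _ Ix.
    by apply: is_derive_eq; rewrite /GRing.scale /=; ring.
  - by move=> x Ix; rewrite -/(n x) mulrA FI // lam0 mul0r subr0 mulfK.
  - by rewrite addrC subrK.
pose z0 := C / lam; pose Z1 t := Z t - z0.
have FI1 t : I t -> n t * dZ t = - lam * w t * Z1 t.
  by move=> It; rewrite FI // /Z1 /z0; field.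
have Za t : I t -> analytic_at Z1 t.
  move=> It; have := g0a It; have := g1a It; have := g2a It => ? ? ?.
  by rewrite /Z1 /Z; analytic.
have DZ1 x : I x -> is_derive x 1 Z1 (dZ x).
  by move=> Ix; have d := DZ _ Ix; apply: is_derive_eq; rewrite subr0.
have Z10 t : I t -> Z1 t != 0.
  move=> It; apply/eqP => Z1t.
  (* The coefficient [- lam * w / n] is bounded on the compact interval [J], so one
     zero of [Z1] forces [Z1 = 0] on [I], against [z' != 0] at [mid]. *)
  have allZ x : I x -> Z1 x = 0.
    move=> Ix; pose J := [set y | Num.min t x <= y <= Num.max t x].
    have iJ : is_interval J.
      move=> y z /= /andP[y1 _] /andP[_ z1] u /andP[yu uz].
      by rewrite /J /= (le_trans y1 yu) (le_trans uz z1).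
    have JI y : J y -> I y.
      rewrite /J /=; have [_|_] := leP t x => h; [exact: iI It Ix _ h|exact: iI Ix It _ h].
    have [||c _ Hc] := @EVT_max R (fun y => `|- lam * w y / n y|) (Num.min t x) (Num.max t x).
    - by rewrite ge_min !le_max !lexx.
    - apply: continuous_in_subspaceT => y; rewrite inE /= in_itv /= => /JI Iy.
      have := e0a Iy; have := e1a Iy => ? ?.
      apply: cvg_norm; apply: (@continuousM _ _ (fun y => - lam * w y) (fun y => (n y)^-1)).
        by apply: analytic_continuous; rewrite /w /de1 /de0; analytic.
      apply: continuousV; first exact: n0.
      by apply: analytic_continuous; rewrite /n; analytic.
    apply: (@linear_ode_zero _ J Z1 dZ `|- lam * w c / n c| t iJ) => //.
    - by rewrite /J /= ge_min le_max !lexx.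
    - by move=> y /JI; exact: DZ1.
    - move=> y Jy; have Iy := JI _ Jy; have -> : dZ y = - lam * w y / n y * Z1 y.
        by apply: (mulfI (n0 Iy)); rewrite FI1 // /n; field; exact: n0.
      by rewrite normrM ler_wpM2r // Hc.
    - by rewrite /J /= ge_min le_max !lexx !orbT.
  have [_ _ _ dz0] := HO _ Omid; move/eqP: dz0; apply.
  by apply: (zero_on_is_derive _ Omid (DZ1 _ Imid)) => x /OI /allZ.
(* The square makes the logarithm independent of the sign of [Z1]. *)
have [v1 Hv1] := polar_angle (e0 mid) (e1 mid).
pose L t := - ln (Z1 t ^+ 2) / (2 * lam).
pose v t := L t + (v1 - L mid).
have Dv t : I t -> is_derive t 1 v (- dZ t / (lam * Z1 t)).
  move=> It; have zt := Z10 _ It.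
  have d1 := DZ1 _ It.
  have d2 : is_derive t 1 (fun x => Z1 x ^+ 2) (2 * Z1 t * dZ t).
    by apply: is_derive_eq; rewrite /GRing.scale /=; ring.
  have z2 : 0 < Z1 t ^+ 2 by rewrite exprn_even_gt0.
  have d3 := @is_derive1_comp R (@ln R) (fun x => Z1 x ^+ 2) t _ _ (is_derive1_ln z2) d2.
  rewrite /comp in d3.
  apply: is_derive_eq; rewrite /GRing.scale /=; field.
  by rewrite lam0 zt.
have nv t : I t -> (e0 t ^+ 2 + e1 t ^+ 2) * (- dZ t / (lam * Z1 t)) =
    e0 t * de1 t - e1 t * de0 t.
  move=> It; have zt := Z10 _ It; rewrite -/(n t) -/(w t).
  transitivity (- (n t * dZ t) / (lam * Z1 t)); first by ring.
  by rewrite FI1 //; field; rewrite lam0 zt.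
exists z0, (Z1 mid * expR (lam * v mid)); split.
  by rewrite mulf_neq0 ?Z10 // gt_eqF // expR_gt0.
move=> t s It /=; exists (v t).
  apply: ray => //; apply: (@direction_along _ I e0 e1 v de0 de1 _ mid iI Imid
    (D1 e0a) (D1 e1a) Dv n0 nv) => //.
  by rewrite /v addrC subrK.
rewrite ZE // -/(Z1 t).
have -> : Z1 mid * expR (lam * v mid) = Z1 t * expR (lam * v t).
  apply: (@is_derive0_cst _ I (fun t => Z1 t * expR (lam * v t))) => // x Ix.
  have d1 := DZ1 _ Ix.
  have d2 := Dv _ Ix; have zx := Z10 _ Ix.
  apply: is_derive_eq; rewrite /GRing.scale /=; field.
  by rewrite lam0 zx.
by rewrite -mulrA -expRD mulNr subrr expR0 mulr1.
Unshelve. all: by end_near. Qed.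

End closed_form.

(** * Surfaces of constant ratio are models *)

Lemma vertical_plane_not_admissible (R : realType) (S : set 'cV[R]_3) p (m0 m1 : R) :
  analytic_surface S -> admissible S -> S p -> m0 != 0 \/ m1 != 0 ->
  (forall q, S q -> m0 * (q 0 0 - p 0 0) + m1 * (q 1 0 - p 1 0) = 0) -> False.
Proof.
move=> surf adm Sp m S0; apply: (adm p Sp).
apply: (@vertical_tangent _ S p (cst m0) (cst m1)) => //; exact: cst_continuous.
Qed.

Theorem ratio_ruled_surface (R : realType) (a : R) (S : set 'cV[R]_3) :
  a < 0 -> analytic_surface S -> admissible S -> ruled S -> constant_ratio a S ->
  exists T, isotropic_similarity T /\
    [\/ forall p, S p -> paraboloid a (T p),
        a = -1 /\ (forall p, S p -> helicoid R (T p)) |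
        a <> -1 /\ (forall p, S p -> exp_helicoid a (T p))].
Proof.
move=> a0 surf adm [I [gam [eps [J [iI gama epsa HJ SE]]]]] ratio.
have [[p0 Sp0]|empty] := pselect (exists p, S p); last first.
  (* Any similarity will do for an empty surface. *)
  have [//|T [HT _]] := @helicoid_similar R 0 0 0 0 1 0 set0 (oner_neq0 _).
  by exists T; split=> //; apply: Or31 => p Sp; case: empty; exists p.
have SP q : S q <-> exists t s, [/\ I t, J t s & q = gam t + s *: eps t] by rewrite SE.
(* A single ruling lies in a vertical plane. *)
have [I2|I1] := pselect (exists x y, [/\ I x, I y & x < y]); last first.
  exfalso; have [t0 [s0 [It0 Js0 p0E]]] := (SP p0).1 Sp0.
  have same t : I t -> t = t0.
    by move=> It; case: (ltgtP t t0) => // h; case: I1; [exists t, t0|exists t0, t].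
  have line q : S q -> exists s, forall i, q i 0 - p0 i 0 = s * eps t0 i 0.
    move=> /SP [t [s [It Js ->]]]; rewrite (same _ It); exists (s - s0) => i.
    by rewrite p0E !mxE; ring.
  have [e0|e0] := eqVneq (eps t0 0 0) 0.
    apply: (@vertical_plane_not_admissible _ S p0 1 0) => //.
      by left; exact: oner_neq0.
    by move=> q /line [s Hs]; rewrite Hs e0; ring.
  apply: (@vertical_plane_not_admissible _ S p0 (eps t0 1 0) (- eps t0 0 0)) => //.
    by right; rewrite oppr_eq0.
  by move=> q /line [s Hs]; rewrite !Hs; ring.
have /choice [g Hg] : forall i, exists h, (forall t, I t -> h t = gam t i 0) /\
    forall t, I t -> analytic_at h t.
  by move=> i; exact: (analytic_extension iI I2 (gama i)).
have /choice [e He] : forall i, exists h, (forall t, I t -> h t = eps t i 0) /\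
    forall t, I t -> analytic_at h t.
  by move=> i; exact: (analytic_extension iI I2 (epsa i)).
have ga t : I t -> forall i, analytic_at (g i) t by move=> It i; apply: (Hg i).2.
have ea t : I t -> forall i, analytic_at (e i) t by move=> It i; apply: (He i).2.
have pointE t s : I t -> gam t + s *: eps t = ruling_point g e t s.
  move=> It; apply/colP => i; rewrite !mxE (Hg i).1 // (He i).1 //.
have HJ' t : I t -> is_interval (J t) /\ exists s1 s2, [/\ J t s1, J t s2 & s1 < s2].
  by move=> /HJ [].
have IJS t s : I t -> J t s -> S (ruling_point g e t s).
  by move=> It Js; apply/SP; exists t, s; rewrite pointE.
have enz t : I t -> exists i, e i t != 0.
  move=> It; have [en _ _] := HJ _ It; apply: contrapT => no; move/eqP: en; apply.
  apply/colP => i; rewrite [RHS]mxE -(He i).1 //; apply/eqP/negPn/negP => h.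
  by apply: no; exists i.
have SR q : S q -> exists t s, I t /\ q = ruling_point g e t s.
  by move=> /SP [t [s [It _ ->]]]; exists t, s; rewrite pointE.
have n0 t : I t -> e 0 t ^+ 2 + e 1 t ^+ 2 != 0.
  by move=> It; rewrite gt_eqF //; exact: (top_norm2_gt0 a0 ratio HJ' IJS enz It).
have D1 (f : 'I_3 -> R -> R) i : (forall t, I t -> forall i, analytic_at (f i) t) ->
    forall t, I t -> is_derive t 1 (f i) (derive1 (f i) t).
  by move=> fa t It; exact/analytic_is_derive/fa.
have [[t1 It1 turn]|noturn] := pselect (exists2 t, I t & wr e t != 0 \/ drift g e t != 0);
    last first.
  exfalso; have [t0 [s0 [It0 p0E]]] := SR _ Sp0.
  have w0 t : I t -> wr e t = 0.
    by move=> It; apply/eqP/negPn/negP => h; apply: noturn; exists t => //; left.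
  have d0 t : I t -> drift g e t = 0.
    by move=> It; apply/eqP/negPn/negP => h; apply: noturn; exists t => //; right.
  (* The top views of all rulings lie on one line. *)
  have dir := @constant_direction _ I (e 0) (e 1) _ _ t0 iI It0 (D1 e 0 ea) (D1 e 1 ea) n0 w0.
  pose c0 := e 0 t0; pose c1 := e 1 t0.
  have base t : I t -> c0 * g 1 t - c1 * g 0 t = c0 * g 1 t0 - c1 * g 0 t0.
    move=> It; apply: (@is_derive0_cst _ I (fun t => c0 * g 1 t - c1 * g 0 t)) => // x Ix.
    have h0 := D1 g 0 ga x Ix; have h1 := D1 g 1 ga x Ix.
    apply: is_derive_eq; rewrite /GRing.scale /=.
    have := d0 _ Ix; have := dir _ Ix; have := n0 _ Ix; rewrite /drift -/c0 -/c1.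
    move: (derive1 (g 0) x) (derive1 (g 1) x) (e 0 x) (e 1 x) c0 c1 => f0 f1 E0 E1 k0 k1.
    move=> nz dir0 dr0; apply: (mulfI nz); rewrite mulr0.
    transitivity ((k0 * E0 + k1 * E1) * (E0 * f1 - E1 * f0)
      + (k0 * E1 - k1 * E0) * (E0 * f0 + E1 * f1)); first by ring.
    by rewrite dir0 dr0 mulr0 mul0r addr0.
  have nz : - c1 != 0 \/ c0 != 0.
    have [c00|] := eqVneq c0 0; last by right.
    left; rewrite oppr_eq0; apply/eqP => c10; move/eqP: (n0 _ It0); apply.
    by rewrite -/c0 -/c1 c00 c10 expr0n addr0.
  apply: (vertical_plane_not_admissible surf adm Sp0 nz) => q /SR [t [s [It ->]]].
  rewrite p0E !mxE; have := dir _ It; have := base _ It; rewrite -/c0 -/c1.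
  clear base dir nz; move: (g 0 t) (g 1 t) (g 0 t0) (g 1 t0) (e 0 t) (e 1 t) c0 c1 => G0 G1 H0 H1 E0 E1 k0 k1.
  move=> b d; transitivity ((k0 * G1 - k1 * G0) - (k0 * H1 - k1 * H0)
    + s * (k0 * E1 - k1 * E0)); first by ring.
  by rewrite b d mulr0 subrr addr0.
have [al [be [lam [ab lam2 HO wO]]]] := ruling_equation a0 ratio iI I2 ga ea HJ' IJS
  (ex_intro2 _ _ t1 It1 turn).
have OI t : al < t < be -> I t by move=> /HO [].
have m0 t : al < t < be -> Mf g e t != 0 by move=> /HO [].
have eqn t : al < t < be -> forall s, Tf g e t s = lam * Df g e t s * Mf g e t.
  by move=> /HO [].
have fa (f : 'I_3 -> R -> R) i : (forall t, I t -> forall i, analytic_at (f i) t) ->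
    forall t, I t -> analytic_at (f i) t by move=> H t It; exact: H.
case: wO => w0.
  have [A [B [nu [k [c0 [c1 [A0 c_0 H]]]]]]] := @parallel_closed_form R I al be lam
    (g 0) (g 1) (g 2%:R) (e 0) (e 1) (e 2%:R) iI ab OI (fa g 0 ga) (fa g 1 ga) (fa g 2%:R ga)
    (fa e 0 ea) (fa e 1 ea) (fa e 2%:R ea) n0 m0 eqn w0.
  have [|T [HT TS]] := @saddle_similar R a lam A B nu k c0 c1 S a0 lam2 A0 c_0.
    by move=> q /SR [t [s [It ->]]]; have := H t s It; rewrite !mxE.
  by exists T; split=> //; apply: Or31.
have [l0 [l1 [q0 [q1 [[lam0 [C [v0 [C0 H]]]]|[lam0 [z0 [k [k0 H]]]]]]]]] :=
  @turning_closed_form R I al be lam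
    (g 0) (g 1) (g 2%:R) (e 0) (e 1) (e 2%:R) iI ab OI (fa g 0 ga) (fa g 1 ga) (fa g 2%:R ga)
    (fa e 0 ea) (fa e 1 ea) (fa e 2%:R ea) n0 m0 eqn w0.
  have am1 : a = -1.
    move: lam2; rewrite lam0 expr0n mul0r => /esym/eqP; rewrite sqrf_eq0 addr_eq0.
    by move/eqP.
  have [|T [HT TS]] := @helicoid_similar R l0 l1 q0 q1 C v0 S C0.
    by move=> q /SR [t [s [It ->]]]; have := H t s It; rewrite !mxE.
  by exists T; split=> //; apply: Or32.
have an1 : a <> -1.
  move=> am1; move/eqP: lam2; rewrite am1 opprK mulr1 addNr expr0n sqrf_eq0.
  by rewrite (negbTE lam0).
have [|T [HT TS]] := @exp_helicoid_similar R a lam l0 l1 q0 q1 z0 k S a0 lam2 k0.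
  by move=> q /SR [t [s [It ->]]]; have := H t s It; rewrite !mxE.
by exists T; split=> //; apply: Or33.
Qed.

(** * Sums and quadratic polynomials as double power series *)

Lemma power_series2D (R : realType) (f1 f2 : 'cV[R]_2 -> R) w c d r s :
  power_series2_at f1 w c r -> power_series2_at f2 w d s ->
  power_series2_at (fun x => f1 x + f2 x) w (fun i j => c i j + d i j) (Num.min r s).
Proof.
move=> [r0 cr fc] [s0 ds gd]; split; first by rewrite lt_min r0.
  move=> rho rho0; rewrite lt_min => /andP[rr rs].
  have [B HB] := cr _ rho0 rr; have [B' HB'] := ds _ rho0 rs.
  exists (B + B') => N; apply: le_trans (lerD (HB N) (HB' N)).
  rewrite -big_split /=; apply: ler_sum => k _; rewrite -mulrDl ler_wpM2r ?exprn_ge0 //.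
  rewrite !(ger0_norm (hnorm_ge0 _ _)) /hnorm -big_split /=; apply: ler_sum => i _.
  exact: ler_normD.
move=> h; rewrite lt_min => /andP[hr hs].
set u := series _.
have -> : u = series (fun k => hpart c k (h 0 0) (h 1 0)) +
    series (fun k => hpart d k (h 0 0) (h 1 0)).
  apply/funext => N; rewrite /u fctE /series /= -big_split; apply: eq_bigr => k _.
  by rewrite /hpart -big_split; apply: eq_bigr => i _; rewrite /=; ring.
exact: cvgD (fc _ hr) (gd _ hs).
Qed.

Lemma power_series2Z (R : realType) (f : 'cV[R]_2 -> R) w c r (l : R) :
  power_series2_at f w c r -> power_series2_at (fun x => l * f x) w (fun i j => l * c i j) r.
Proof.
move=> [r0 cr fc]; split=> //.
  move=> rho rho0 rr; have [B HB] := cr _ rho0 rr.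
  exists (`|l| * B) => N; apply: le_trans (ler_wpM2l (normr_ge0 l) (HB N)).
  rewrite mulr_sumr; apply: ler_sum => k _; rewrite mulrA ler_wpM2r ?exprn_ge0 //.
  rewrite !(ger0_norm (hnorm_ge0 _ _)) /hnorm mulr_sumr; apply: ler_sum => i _.
  by rewrite normrM.
move=> h /fc H; set u := series _.
have -> : u = (fun N => l * series (fun k => hpart c k (h 0 0) (h 1 0)) N).
  apply/funext => N; rewrite /u /series /= mulr_sumr; apply: eq_bigr => k _.
  by rewrite /hpart mulr_sumr; apply: eq_bigr => i _; rewrite /=; ring.
by apply: cvgM => //; exact: cvg_cst.
Qed.

Definition quadratic_coef (R : realType) (q00 q10 q01 q20 q11 q02 : R) (i j : nat) : R :=
  match i, j with
  | 0%N, 0%N => q00 | 1%N, 0%N => q10 | 0%N, 1%N => q01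
  | 2%N, 0%N => q20 | 1%N, 1%N => q11 | 0%N, 2%N => q02
  | _, _ => 0
  end.

Lemma power_series2_quadratic (R : realType) (f : 'cV[R]_2 -> R) w
    (q00 q10 q01 q20 q11 q02 : R) :
  (forall h : 'cV[R]_2, f (w + h) = q00 + q10 * h 0 0 + q01 * h 1 0 + q20 * h 0 0 ^+ 2
     + q11 * h 0 0 * h 1 0 + q02 * h 1 0 ^+ 2) ->
  power_series2_at f w (quadratic_coef q00 q10 q01 q20 q11 q02) 1.
Proof.
move=> fE; set c := quadratic_coef _ _ _ _ _ _.
have c0 k i : (2 < k)%N -> (i <= k)%N -> c i (k - i)%N = 0.
  case: i => [|[|[|i]]]; rewrite ?subn0; case: k => [|[|[|k]]] //.
have hp0 k x y : hpart c k.+3 x y = 0.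
  by apply: big1 => i _; rewrite c0 ?mul0r // -ltnS.
have hn0 k : hnorm c k.+3 = 0.
  by apply: big1 => i _; rewrite c0 ?normr0 // -ltnS.
split=> [//|rho rho0 _|h _].
  exists (\sum_(k < 3) `|hnorm c k| * rho ^+ k) => N.
  apply: (@le_trans _ _ (\sum_(k < N + 3) `|hnorm c k| * rho ^+ k)).
    rewrite big_split_ord /= lerDl; apply: sumr_ge0 => k _.
    by rewrite mulr_ge0 ?exprn_ge0.
  rewrite addnC big_split_ord /= [X in _ + X]big1 ?addr0 // => k _.
  by rewrite hn0 normr0 mul0r.
rewrite fE; set u := series _.
suff e : (fun n => u (n + 3)%N) = cst (q00 + q10 * h 0 0 + q01 * h 1 0 + q20 * h 0 0 ^+ 2
     + q11 * h 0 0 * h 1 0 + q02 * h 1 0 ^+ 2).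
  have cu : (fun n => u (n + 3)%N) @ \oo --> q00 + q10 * h 0 0 + q01 * h 1 0
      + q20 * h 0 0 ^+ 2 + q11 * h 0 0 * h 1 0 + q02 * h 1 0 ^+ 2.
    by rewrite e; exact: cvg_cst.
  by move: cu; rewrite (cvg_shiftn 3 u).
apply/funext => n; rewrite /u /series /= big_mkord addnC big_split_ord /=.
rewrite [X in _ + X]big1 ?addr0 => [|k _]; last by rewrite hp0.
by rewrite !big_ord_recl big_ord0 /bump /= hpart0 hpart1 hpart2 /c /=; ring.
Qed.

(** * The power series of helical surfaces *)

(** The coefficients of a form of some degree, after multiplication by the linear form
[l0 * x + l1 * y]. *)
Definition mul_linear (R : realType) (l0 l1 : R) (c : nat -> R) (i : nat) : R :=
  (if i is i'.+1 then l0 * c i' else 0) + l1 * c i.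

Definition homogeneous (R : realType) (k : nat) (c : nat -> R) (x y : R) :=
  \sum_(i < k.+1) c i * x ^+ i * y ^+ (k - i).

Lemma mul_linearE (R : realType) (l0 l1 : R) k c x y : c k.+1 = 0 ->
  homogeneous k.+1 (mul_linear l0 l1 c) x y = (l0 * x + l1 * y) * homogeneous k c x y.
Proof.
move=> ck; rewrite /homogeneous /mul_linear.
rewrite (eq_bigr (fun i : 'I_k.+2 => (if (i : nat) is i'.+1 then l0 * c i' else 0) * x ^+ i * y ^+ (k.+1 - i)
   + l1 * c i * x ^+ i * y ^+ (k.+1 - i))); last by move=> i _; rewrite !mulrDl.
rewrite big_split /= mulrDl; congr (_ + _).
  rewrite big_ord_recl !mul0r add0r mulr_sumr; apply: eq_bigr => i _.
  by rewrite /= /bump /= ?add1n subSS exprS; ring.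
rewrite big_ord_recr /= ck !mulr0 !mul0r addr0 mulr_sumr; apply: eq_bigr => i _.
have ik : (i <= k)%N by rewrite -ltnS.
by rewrite subSn // exprS; ring.
Qed.

Definition coef_norm (R : realType) (k : nat) (c : nat -> R) := \sum_(i < k.+1) `|c i|.

Lemma coef_norm_mul_linear (R : realType) (l0 l1 : R) k c : c k.+1 = 0 ->
  coef_norm k.+1 (mul_linear l0 l1 c) <= (`|l0| + `|l1|) * coef_norm k c.
Proof.
move=> ck; rewrite /coef_norm /mul_linear.
apply: (@le_trans _ _ (\sum_(i < k.+2) (`|if (i : nat) is i'.+1 then l0 * c i' else 0| + `|l1 * c i|))).
  by apply: ler_sum => i _; exact: ler_normD.
rewrite big_split /= mulrDl lerD //.
  rewrite big_ord_recl normr0 add0r mulr_sumr; apply: ler_sum => i _.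
  by rewrite /= /bump /= ?add1n normrM.
rewrite big_ord_recr /= ck mulr0 normr0 addr0 mulr_sumr; apply: ler_sum => i _.
by rewrite normrM.
Qed.

Section helical_series.
Variables (R : realType) (p0 p1 q0 q1 kap b0 b1 : R).

(** Homogeneous parts of [g (v0 + atan (q / (1 + p)))], where [p] and [q] are the
linear forms with coefficients [p0, p1] and [q0, q1], [g' = kap * g + d],
[g v0 = b0] and [g' v0 = b1].  The recursion is the equation
[((1 + t * p) ^+ 2 + (t * q) ^+ 2) * y' = q * (kap * y + d)] of the restriction [y] to
a ray, read off degree by degree.  As it has two steps, two consecutive parts are
computed together. *)
Fixpoint helical_pair (k : nat) : (nat -> R) * (nat -> R) :=
  if k is k'.+1 then
    let: (A, A1) := helical_pair k' in
    (A1, fun i => (kap * mul_linear q0 q1 A1 i - 2 * k'.+1%:R * mul_linear p0 p1 A1 i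
       - k'%:R * (mul_linear p0 p1 (mul_linear p0 p1 A) i
                  + mul_linear q0 q1 (mul_linear q0 q1 A) i)) / k'.+2%:R)
  else (fun i => if i is 0%N then b0 else 0,
        mul_linear q0 q1 (fun i => if i is 0%N then b1 else 0)).

Definition helical_part k := (helical_pair k).1.

Lemma helical_part1 i :
  helical_part 1 i = mul_linear q0 q1 (fun i => if i is 0%N then b1 else 0) i.
Proof. by []. Qed.

Lemma helical_partSS k i : helical_part k.+2 i =
  (kap * mul_linear q0 q1 (helical_part k.+1) i
   - 2 * k.+1%:R * mul_linear p0 p1 (helical_part k.+1) i
   - k%:R * (mul_linear p0 p1 (mul_linear p0 p1 (helical_part k)) i
             + mul_linear q0 q1 (mul_linear q0 q1 (helical_part k)) i)) / k.+2%:R.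
Proof.
by rewrite /helical_part [helical_pair k.+2]/= [helical_pair k.+1]/=; case: (helical_pair k).
Qed.

Lemma helical_part_high k i : (k < i)%N -> helical_part k i = 0.
Proof.
suff H : forall k, (forall i, (k < i)%N -> helical_part k i = 0) /\
    (forall i, (k.+1 < i)%N -> helical_part k.+1 i = 0) by exact: (H k).1.
elim=> {k i} [|k [IH0 IH1]].
  split=> [[|i]//|i]; rewrite helical_part1 /mul_linear; case: i => [|[|i]] //= _.
  by rewrite !mulr0 addr0.
split=> // i ki; rewrite helical_partSS /mul_linear.
case: i ki => [|[|i]] // ki.
have k0 : (k < i)%N by [].
have k1 : (k < i.+1)%N by exact: ltnW.
have k2 : (k < i.+2)%N by exact: ltnW.
have k3 : (k.+1 < i.+2)%N by exact: ltnW.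
rewrite /= (IH1 i.+1) // (IH1 i.+2) // (IH0 i) // (IH0 i.+1) // (IH0 i.+2) //.
by rewrite !(mulr0, addr0, subr0, mul0r).
Qed.

Let rho := `|p0| + `|p1| + `|q0| + `|q1|.
Let K := (`|kap| + 4) * rho.
Let B := `|b0| + `|b1|.

(** The factors [k] of the recursion are compensated by its denominator [k + 2]. *)
Lemma coef_norm_helical k : coef_norm k (helical_part k) <= B * K ^+ k.
Proof.
have rho0 : 0 <= rho by rewrite !addr_ge0.
have K0 : 0 <= K by rewrite mulr_ge0 // addr_ge0.
have B0 : 0 <= B by rewrite addr_ge0.
have pr : `|p0| + `|p1| <= rho.
  by rewrite /rho -addrA lerDl addr_ge0.
have qr : `|q0| + `|q1| <= rho.
  by rewrite /rho -addrA lerDr addr_ge0.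
have rK : rho <= K by rewrite /K ler_peMl //; have := normr_ge0 kap; lra.
have N0 j (c : nat -> R) : 0 <= coef_norm j c by exact: sumr_ge0.
suff H : forall k, coef_norm k (helical_part k) <= B * K ^+ k /\
    coef_norm k.+1 (helical_part k.+1) <= B * K ^+ k.+1 by exact: (H k).1.
elim=> {k} [|k [IH0 IH1]].
  split; first by rewrite /coef_norm big_ord_recl big_ord0 addr0 expr0 mulr1 lerDl.
  apply: (le_trans (coef_norm_mul_linear _ _ _)) => //.
  rewrite /coef_norm big_ord_recl big_ord0 addr0 expr1 mulrC ler_pM //.
    by rewrite lerDr.
  exact: le_trans qr rK.
split=> //.
set A1 := helical_part k.+1; set A := helical_part k.
have A1h : A1 k.+2 = 0 by exact: helical_part_high.
have Ah : A k.+1 = 0 by exact: helical_part_high.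
have Ah2 : A k.+2 = 0 by exact: helical_part_high.
have lh l0 l1 : mul_linear l0 l1 A k.+2 = 0 by rewrite /mul_linear Ah Ah2 !mulr0 addr0.
have nQ := le_trans (coef_norm_mul_linear q0 q1 A1h) (ler_wpM2r (N0 k.+1 A1) qr).
have nP := le_trans (coef_norm_mul_linear p0 p1 A1h) (ler_wpM2r (N0 k.+1 A1) pr).
have two l0 l1 : `|l0| + `|l1| <= rho ->
    coef_norm k.+2 (mul_linear l0 l1 (mul_linear l0 l1 A)) <= rho * (rho * coef_norm k A).
  move=> lr; apply: (le_trans (coef_norm_mul_linear _ _ (lh _ _))).
  apply: ler_pM => //.
  apply: (le_trans (coef_norm_mul_linear _ _ Ah)); exact: ler_wpM2r.
have nPP := two _ _ pr; have nQQ := two _ _ qr.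
have k2 : 0 < k.+2%:R :> R by rewrite ltr0n.
apply: (@le_trans _ _ ((`|kap| * coef_norm k.+2 (mul_linear q0 q1 A1)
  + 2 * k.+1%:R * coef_norm k.+2 (mul_linear p0 p1 A1)
  + k%:R * (coef_norm k.+2 (mul_linear p0 p1 (mul_linear p0 p1 A))
            + coef_norm k.+2 (mul_linear q0 q1 (mul_linear q0 q1 A)))) / k.+2%:R)).
  rewrite /coef_norm -big_split /= !mulr_sumr -!big_split mulr_suml.
  apply: ler_sum => i _; rewrite helical_partSS normrM normfV normr_nat ler_wpM2r ?invr_ge0 ?ler0n //.
  apply: (le_trans (ler_normB _ _)); apply: lerD.
    apply: (le_trans (ler_normB _ _)); apply: lerD; first by rewrite normrM.
    by rewrite normrM normrM !normr_nat.
  rewrite normrM normr_nat ler_wpM2l ?ler0n //; exact: ler_normD.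
rewrite ler_pdivrMr //.
have M1 : coef_norm k.+2 (mul_linear q0 q1 A1) <= rho * (B * K ^+ k.+1).
  by apply: (le_trans nQ); rewrite ler_wpM2l.
have M2 : coef_norm k.+2 (mul_linear p0 p1 A1) <= rho * (B * K ^+ k.+1).
  by apply: (le_trans nP); rewrite ler_wpM2l.
have M3 : coef_norm k.+2 (mul_linear p0 p1 (mul_linear p0 p1 A)) <= rho * (rho * (B * K ^+ k)).
  by apply: (le_trans nPP); rewrite !ler_wpM2l.
have M4 : coef_norm k.+2 (mul_linear q0 q1 (mul_linear q0 q1 A)) <= rho * (rho * (B * K ^+ k)).
  by apply: (le_trans nQQ); rewrite !ler_wpM2l.
have T1 : `|kap| * coef_norm k.+2 (mul_linear q0 q1 A1) <= `|kap| * (rho * (B * K ^+ k.+1)).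
  by rewrite ler_wpM2l.
have T2 : 2 * k.+1%:R * coef_norm k.+2 (mul_linear p0 p1 A1) <= 2 * k.+1%:R * (rho * (B * K ^+ k.+1)).
  by rewrite ler_wpM2l // mulr_ge0 ?ler0n.
have T3 : k%:R * (coef_norm k.+2 (mul_linear p0 p1 (mul_linear p0 p1 A))
    + coef_norm k.+2 (mul_linear q0 q1 (mul_linear q0 q1 A)))
   <= k%:R * (2 * (rho * (rho * (B * K ^+ k)))).
  by rewrite ler_wpM2l ?ler0n // mulr_natl mulr2n lerD.
apply: (le_trans (lerD (lerD T1 T2) T3)).
have E : B * K ^+ k.+2 * k.+2%:R - (`|kap| * (rho * (B * K ^+ k.+1))
    + 2 * k.+1%:R * (rho * (B * K ^+ k.+1)) + k%:R * (2 * (rho * (rho * (B * K ^+ k))))) =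
   (B * K ^+ k) * rho ^+ 2 * (k.+2%:R * (`|kap| + 4) ^+ 2 -
      (`|kap| + 2 * k.+1%:R) * (`|kap| + 4) - 2 * k%:R).
  by rewrite !exprS /K; ring.
rewrite -subr_ge0 E mulr_ge0 ?mulr_ge0 ?exprn_ge0 //.
rewrite -(natr1 k.+1) -(natr1 k); have := ler0n R k; have := normr_ge0 kap.
move: (k%:R : R) (`|kap|) => x y y0 x0.
have -> : (x + 1 + 1) * (y + 4) ^+ 2 - (y + 2 * (x + 1)) * (y + 4) - 2 * x =
   x * (y ^+ 2 + 6 * y + 6) + (y ^+ 2 + 10 * y + 24) by ring.
by rewrite addr_ge0 ?mulr_ge0 ?addr_ge0 ?sqr_ge0 ?mulr_ge0.
Qed.

End helical_series.

(** * Local graphs of helical surfaces *)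

Lemma geometric_coef_bounded (R : realType) (a : nat -> R) (B K r : R) :
  0 <= B -> 0 <= K -> (forall k, `|a k| <= B * K ^+ k) -> K * r <= 1 -> coef_bounded a r.
Proof.
move=> B0 K0 aB Kr rho rho0 rhor; set x := K * rho.
have x0 : 0 <= x by rewrite mulr_ge0.
have x1 : x < 1.
  have [k0|Kn0] := eqVneq K 0; first by rewrite /x k0 mul0r ltr01.
  by apply: lt_le_trans Kr; rewrite ltr_pM2l // lt_def Kn0.
have y0 : 0 < 1 - x by rewrite subr_gt0.
exists (B / (1 - x)) => N.
apply: (@le_trans _ _ (B * \sum_(k < N) x ^+ k)).
  rewrite mulr_sumr; apply: ler_sum => k _; rewrite /x exprMn mulrA.
  by rewrite ler_wpM2r ?exprn_ge0.
rewrite ler_wpM2l // -[_^-1]mul1r ler_pdivlMr //.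
have -> : (\sum_(k < N) x ^+ k) * (1 - x) = 1 - x ^+ N.
  by rewrite -[RHS]opprB subrX1; ring.
by rewrite gerBl exprn_ge0.
Qed.

Section helical_expansion.
Variables (R : realType) (g : R -> R) (kap d v0 p0 p1 q0 q1 : R) (w : 'cV[R]_2).
Hypothesis Dg : forall x : R, is_derive x 1 g (kap * g x + d).

Let b0 := g v0.
Let b1 := kap * g v0 + d.
Let A := helical_part p0 p1 q0 q1 kap b0 b1.
Let rho := `|p0| + `|p1| + `|q0| + `|q1|.
Let K := (`|kap| + 4) * rho.
Let B := `|b0| + `|b1|.
(* Half the radius given by the bound [B * K ^+ k]: the point of interest, [t = 1] on
   a ray, then lies well inside the disc [`|t| < 2] of convergence. *)
Let r := (2 * (K + 1))^-1.

Definition helical_coef (i j : nat) := A (i + j) i.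

Let K0 : 0 <= K. Proof. by rewrite mulr_ge0 ?addr_ge0. Qed.
Let B0 : 0 <= B. Proof. by rewrite addr_ge0. Qed.
Let r0 : 0 < r. Proof. by rewrite invr_gt0 mulr_gt0 // ltr_wpDl. Qed.
Let Kr2 : K * r * 2 <= 1.
Proof.
have k1 : 0 < K + 1 by rewrite ltr_wpDl.
have -> : K * r * 2 = K / (K + 1) by rewrite /r; field; rewrite gt_eqF.
by rewrite ler_pdivrMr // mul1r lerDl.
Qed.

Lemma helical_hpart k x y : hpart helical_coef k x y = homogeneous k (A k) x y.
Proof.
apply: eq_bigr => i _; have ik : (i <= k)%N by rewrite -ltnS.
by rewrite /helical_coef subnKC.
Qed.

Lemma helical_hnorm k : hnorm helical_coef k <= B * K ^+ k.
Proof.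
apply: le_trans (coef_norm_helical p0 p1 q0 q1 kap b0 b1 k).
apply: ler_sum => i _; have ik : (i <= k)%N by rewrite -ltnS.
by rewrite /helical_coef subnKC.
Qed.

Section ray.
Variables x y : R.
Let p := p0 * x + p1 * y.
Let q := q0 * x + q1 * y.
Let b k := homogeneous k (A k) x y.

Lemma ray_coef0 : b 0%N = g v0.
Proof. by rewrite /b /homogeneous big_ord_recl big_ord0 !expr0 !mulr1 addr0. Qed.

Lemma ray_coef1 : b 1%N = q * (kap * g v0 + d).
Proof.
rewrite /b /homogeneous !big_ord_recl big_ord0 /A !helical_part1 /mul_linear /= /q.
by rewrite /b1; ring.
Qed.

Lemma ray_recurrence k : k.+2%:R * b k.+2 = kap * q * b k.+1
  - 2 * k.+1%:R * p * b k.+1 - k%:R * (p ^+ 2 + q ^+ 2) * b k.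
Proof.
have A1h : A k.+1 k.+2 = 0 by exact: helical_part_high.
have Ah : A k k.+1 = 0 by exact: helical_part_high.
have Ah2 : A k k.+2 = 0 by exact: helical_part_high.
have lh l0 l1 : mul_linear l0 l1 (A k) k.+2 = 0 by rewrite /mul_linear Ah Ah2 !mulr0 addr0.
have k2 : k.+2%:R != 0 :> R by rewrite pnatr_eq0.
transitivity (kap * homogeneous k.+2 (mul_linear q0 q1 (A k.+1)) x y
  - 2 * k.+1%:R * homogeneous k.+2 (mul_linear p0 p1 (A k.+1)) x y
  - k%:R * (homogeneous k.+2 (mul_linear p0 p1 (mul_linear p0 p1 (A k))) x y
     + homogeneous k.+2 (mul_linear q0 q1 (mul_linear q0 q1 (A k))) x y)).
  rewrite /b /homogeneous mulr_sumr -big_split /= !mulr_sumr -!sumrB.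
  apply: eq_bigr => i _; rewrite {1}/A helical_partSS -/A.
  move: (mul_linear _ _ _ _) (mul_linear _ _ _ _) (mul_linear _ _ _ _) (mul_linear _ _ _ _).
  move=> m1 m2 m3 m4; move: (x ^+ i) (y ^+ (k.+2 - i)) (k.+2%:R : R) (k.+1%:R : R) (k%:R : R) k2.
  by move=> X Y c2 c1 c0 c20; field.
rewrite (mul_linearE q0 q1 x y A1h) (mul_linearE p0 p1 x y A1h).
rewrite (mul_linearE p0 p1 x y (lh p0 p1)) (mul_linearE q0 q1 x y (lh q0 q1)).
rewrite (mul_linearE p0 p1 x y Ah) (mul_linearE q0 q1 x y Ah) -/(b k) -/(b k.+1) -/p -/q.
by move: (k.+1%:R : R) (k%:R : R) => c1 c0; ring.
Qed.

Variable m : R.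
Hypotheses (xm : `|x| <= m) (ym : `|y| <= m) (mr : m < r).

Let phi t := limn (pseries b t).
Let dphi t := limn (pseries (pseries_diffs b) t).

Lemma ray_bounded : coef_bounded b 2.
Proof.
have m0 : 0 <= m by apply: le_trans xm.
apply: (@geometric_coef_bounded _ _ B (K * m)) => //; first by rewrite mulr_ge0.
  move=> k; apply: (le_trans (hpart_le (fun i _ => A k i) k xm ym)); rewrite exprMn mulrA.
  by rewrite ler_wpM2r ?exprn_ge0 // coef_norm_helical.
apply: le_trans Kr2; rewrite ler_wpM2r // ler_wpM2l //; exact: ltW.
Qed.

Lemma ray_power_series : power_series_at phi 0 b 2.
Proof.
split=> // t; rewrite subr0 => t2.
exact: (coef_bounded_cvg ray_bounded t2).
Qed.

Lemma ray_is_derive (t : R) : `|t| < 2 -> is_derive t 1 phi (dphi t).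
Proof.
move=> t2; have := @power_series_is_derive _ _ _ _ _ t ray_power_series.
by rewrite subr0; exact.
Qed.

(** For partial sums the equation is exact up to a shift of the indices, so it can be
proved by induction and passed to the limit. *)
Lemma ray_equation (t : R) : `|t| < 2 ->
  ((1 + t * p) ^+ 2 + (t * q) ^+ 2) * dphi t = q * (kap * phi t + d).
Proof.
move=> t2.
pose D N := pseries (pseries_diffs b) t N; pose S N := pseries b t N.
have Dr N : D N.+1 = D N + N.+1%:R * b N.+1 * t ^+ N.
  by rewrite /D /pseries /series /= big_nat_recr.
have Sr N : S N.+1 = S N + b N * t ^+ N.
  by rewrite /S /pseries /series /= big_nat_recr.
have D00 : D 0%N = 0 by rewrite /D /pseries /series /= big_geq.
have S00 : S 0%N = 0 by rewrite /S /pseries /series /= big_geq.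
have partial N : D N.+2 - b 1%N + 2 * p * t * D N.+1 + (p ^+ 2 + q ^+ 2) * t ^+ 2 * D N
    - kap * q * (S N.+2 - b 0%N) = 0.
  elim: N => [|N IH].
    have := ray_recurrence 0; rewrite !mul0r subr0 => rec.
    rewrite !Dr !Sr D00 S00 !expr0 !expr1 !add0r.
    transitivity (t * (2%:R * b 2%N - kap * q * b 1%N + 2 * 1%:R * p * b 1%N)); first by ring.
    by rewrite rec; ring.
  have := ray_recurrence N.+1 => rec.
  rewrite -[RHS]IH.
  apply/eqP; rewrite -subr_eq0; apply/eqP.
  transitivity (t ^+ N.+2 * (N.+3%:R * b N.+3 - (kap * q * b N.+2
    - 2 * N.+2%:R * p * b N.+2 - N.+1%:R * (p ^+ 2 + q ^+ 2) * b N.+1))).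
    rewrite (Dr N.+2) (Dr N.+1) (Dr N) (Sr N.+2) (exprS t N.+1) (exprS t N).
    move: (D N) (S N.+2) (b N.+3) (b N.+2) (b N.+1) (b 1%N) (b 0%N)
      (N.+3%:R : R) (N.+2%:R : R) (N.+1%:R : R) (t ^+ N) => *.
    by ring.
  by rewrite rec subrr mulr0.
have cD : D @ \oo --> dphi t.
  exact: (coef_bounded_cvg (pseries_diffs_bounded ray_bounded) t2).
have cS : S @ \oo --> phi t by exact: (coef_bounded_cvg ray_bounded t2).
have cD1 : (fun N => D N.+1) @ \oo --> dphi t by rewrite (cvg_shiftS D).
have cD2 : (fun N => D N.+2) @ \oo --> dphi t by rewrite (cvg_shiftS (fun N => D N.+1)).
have cS2 : (fun N => S N.+2) @ \oo --> phi t.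
  by rewrite (cvg_shiftS (fun N => S N.+1)) (cvg_shiftS S).
have cc (k : R) : (fun _ : nat => k) @ \oo --> k by exact: cvg_cst.
have lim : (fun N => D N.+2 - b 1%N + 2 * p * t * D N.+1 + (p ^+ 2 + q ^+ 2) * t ^+ 2 * D N
    - kap * q * (S N.+2 - b 0%N)) @ \oo -->
    dphi t - b 1%N + 2 * p * t * dphi t + (p ^+ 2 + q ^+ 2) * t ^+ 2 * dphi t
    - kap * q * (phi t - b 0%N).
  apply: cvgB.
    apply: cvgD; last by apply: cvgM.
    apply: cvgD; last by apply: cvgM.
    by apply: cvgB.
  by apply: cvgM => //; apply: cvgB.
have e0 := funext partial; rewrite e0 in lim.
have := cvg_unique _ lim (cc 0); rewrite ray_coef1 ray_coef0 => e.
have {}e := e (@norm_hausdorff _ _).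
transitivity (dphi t - q * (kap * g v0 + d) + 2 * p * t * dphi t
  + (p ^+ 2 + q ^+ 2) * t ^+ 2 * dphi t - kap * q * (phi t - g v0)
  + q * (kap * phi t + d)); first by ring.
by rewrite e add0r.
Qed.

(** The sum of the series and the closed form solve the same linear equation along the
ray with the same initial value.  The bound on [p] keeps [1 + t * p] away from zero. *)
Lemma ray_closed_form : `|p| < 1 / 2 -> phi 1 = g (v0 + atan (q / (1 + p))).
Proof.
move=> p12; pose n t := (1 + t * p) ^+ 2 + (t * q) ^+ 2.
pose psi t := g (v0 + atan (t * q / (1 + t * p))).
pose I := [set t : R | 0 <= t <= 1].
have iI : is_interval I.
  move=> s t /= /andP[s0 _] /andP[_ t1] z /andP[sz zt].
  by rewrite /I /= (le_trans s0 sz) (le_trans zt t1).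
have pos t : I t -> 1 / 2 <= 1 + t * p.
  move=> /andP[t0 t1]; have : `|t * p| <= `|p| by rewrite normrM ler_piMl // ger0_norm.
  by rewrite ler_norml => /andP[h _]; lra.
have npos t : I t -> 1 / 4 <= n t.
  move=> It; have h := pos _ It; rewrite /n.
  have := sqr_ge0 (t * q); have : (1 / 2) ^+ 2 <= (1 + t * p) ^+ 2.
    by apply: lerXn2r; rewrite ?qualifE /= //; lra.
  lra.
have t2 t : I t -> `|t| < 2 by move=> /andP[t0 t1]; rewrite ger0_norm //; lra.
have Dpsi t : I t -> is_derive t 1 psi ((kap * psi t + d) * (q / n t)).
  move=> It; have h := pos _ It.
  have nz : 1 + t * p != 0 by rewrite gt_eqF //; lra.
  have nn : n t != 0 by have := npos _ It => ?; rewrite gt_eqF //; lra.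
  have d1 : is_derive t 1 (fun t => t * q) q.
    by apply: is_derive_eq; rewrite /GRing.scale /=; ring.
  have d2 : is_derive t 1 (fun t => 1 + t * p) p.
    by apply: is_derive_eq; rewrite /GRing.scale /=; ring.
  have d3 := is_derive_div d1 d2 nz.
  have d4 := @is_derive1_comp R (@atan R) (fun t => t * q / (1 + t * p)) t _ _
    (is_derive1_atan _) d3.
  have d5 : is_derive t 1 (fun t => v0 + atan (t * q / (1 + t * p))) (q / n t).
    rewrite /comp in d4; apply: is_derive_eq; rewrite add0r.
    move: nn nz; rewrite /n; have -> : q * (1 + t * p) - t * q * p = q by ring.
    move: (1 + t * p) (t * q) => u v nn nz.
    have -> : 1 + (v / u) ^+ 2 = (u ^+ 2 + v ^+ 2) / u ^+ 2 by field.
    by rewrite invf_div; field; rewrite nz nn.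
  have d6 := @is_derive1_comp R g (fun t => v0 + atan (t * q / (1 + t * p))) t _ _ (Dg _) d5.
  exact: d6.
have Dy t : I t -> is_derive t 1 (fun t => phi t - psi t)
    (kap * q / n t * (phi t - psi t)).
  move=> It; have d1 := ray_is_derive (t2 _ It); have d2 := Dpsi _ It.
  have nn : n t != 0 by have := npos _ It => ?; rewrite gt_eqF //; lra.
  have e := ray_equation (t2 _ It).
  apply: is_derive_eq; have -> : dphi t = q * (kap * phi t + d) / n t.
    by rewrite -e mulrC mulKf.
  by field.
have I0 : I 0 by rewrite /I /= lexx ler01.
have I1 : I 1 by rewrite /I /= lexx ler01.
have zero := @linear_ode_zero R I (fun t => phi t - psi t) _ (`|kap * q| * 4) 0 iI I0 Dy.
have : phi 1 - psi 1 = 0.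
  apply: zero => //.
    move=> t It; rewrite normrM ler_wpM2r // normrM ler_wpM2l // normfV.
    have h := npos _ It; have n_0 : 0 < n t by lra.
    rewrite gtr0_norm // -[X in _ <= X]invrK lef_pV2 ?qualifE /= ?invr_gt0 //; lra.
  have -> : phi 0 = g v0.
    by rewrite -ray_coef0 (power_series_coef0 ray_power_series).
  by rewrite /psi !mul0r atan0 addr0 subrr.
by move/subr0_eq => ->; rewrite /psi !mul1r.
Qed.

End ray.

Lemma helical_expansion : exists r, power_series2_at (fun w' =>
    g (v0 + atan ((q0 * (w' - w) 0 0 + q1 * (w' - w) 1 0) /
                  (1 + (p0 * (w' - w) 0 0 + p1 * (w' - w) 1 0))))) w helical_coef r.
Proof.
exists r; split=> //.
  apply: (@geometric_coef_bounded _ _ B K) => //.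
    by move=> k; rewrite ger0_norm ?hnorm_ge0 // helical_hnorm.
  have kr : 0 <= K * r by rewrite mulr_ge0 // ltW.
  by have := Kr2; move: (K * r) kr => z z0 z2; lra.
move=> h hr; have -> : w + h - w = h by rewrite addrAC subrr add0r.
have h0 := coord_le_norm h 0 0; have h1 := coord_le_norm h 1 0.
rewrite -(ray_closed_form h0 h1 hr).
  have [_ /(_ 1)] := ray_power_series h0 h1 hr.
  rewrite subr0 normr1 => /(_ (ltr1n _ 2)); apply: cvg_trans.
  have -> : series (fun k => hpart helical_coef k (h 0 0) (h 1 0)) =
    pseries (fun k => homogeneous k (A k) (h 0 0) (h 1 0)) 1.
    apply/funext => N; rewrite /pseries /series /=; apply: eq_bigr => k _.
    by rewrite expr1n mulr1 helical_hpart.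
  by [].
have rK : rho <= K by rewrite /K ler_peMl ?addr_ge0 //; have := normr_ge0 kap; lra.
apply: (@le_lt_trans _ _ (K * `|h|)).
  apply: (@le_trans _ _ (rho * `|h|)); last by rewrite ler_wpM2r.
  apply: (le_trans (ler_normD _ _)); rewrite !normrM.
  have := ler_wpM2l (normr_ge0 p0) h0; have := ler_wpM2l (normr_ge0 p1) h1.
  have := mulr_ge0 (normr_ge0 q0) (normr_ge0 h); have := mulr_ge0 (normr_ge0 q1) (normr_ge0 h).
  by rewrite /rho !mulrDl; lra.
have k1 : 0 < K + 1 by rewrite ltr_wpDl.
have h12 : (K + 1) * `|h| < 1 / 2.
  have -> : 1 / 2 = (K + 1) * r by rewrite /r; field; rewrite gt_eqF.
  by rewrite ltr_pM2l.
by have := normr_ge0 h; rewrite mulrDl mul1r in h12; lra.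
Qed.

Lemma helical_coef2 :
  [/\ helical_coef 2 0 = (kap * q0 - 2 * p0) * (b1 * q0) / 2,
      helical_coef 1 1 = (kap * (q0 * (b1 * q1) + q1 * (b1 * q0))
                          - 2 * (p0 * (b1 * q1) + p1 * (b1 * q0))) / 2 &
      helical_coef 0 2 = (kap * q1 - 2 * p1) * (b1 * q1) / 2].
Proof.
by split; rewrite /helical_coef /A helical_partSS /mul_linear !helical_part1 /mul_linear /=;
  field.
Qed.

End helical_expansion.

(** * The models have constant ratio *)

Lemma ratio_coef_scale (R : realType) (a l : R) (c d : nat -> nat -> R) : l != 0 ->
  (forall i j, (i + j = 2)%N -> d i j = l * c i j) -> ratio_coef a c -> ratio_coef a d.
Proof.
move=> l0 dc [rat neg]; rewrite /ratio_coef !dc //; split.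
  transitivity (l ^+ 2 * (a * (2 * c 2%N 0%N + 2 * c 0%N 2%N) ^+ 2)); first by ring.
  by rewrite rat; ring.
rewrite (_ : _ - _ = l ^+ 2 * (2 * c 2%N 0%N * (2 * c 0%N 2%N) - c 1%N 1%N ^+ 2)).
  by rewrite pmulr_rlt0 // exprn_even_gt0.
by ring.
Qed.

(** Passing from a local graph of the image under a similarity, written in the
coordinates of [S], to a local graph of [S]: the third coordinate changes by an
affine function and a scale factor only. *)
Lemma similar_local_graph (R : realType) (a : R) (S : set 'cV[R]_3) p
    (F : 'cV[R]_2 -> R) c r (c1 c2 c3 b : R) (W : set 'cV[R]_3) :
  S p -> c3 != 0 -> power_series2_at F (top_view p) c r -> ratio_coef a c ->
  nbhs p W ->
  (forall q, (S `&` W) q -> c1 * q 0 0 + c2 * q 1 0 + c3 * q 2%:R 0 + b = F (top_view q)) ->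
  exists f d s, [/\ local_graph S p f, power_series2_at f (top_view p) d s &
    ratio_coef a d].
Proof.
move=> Sp c30 Fc rat Wp graph.
pose aff (x : 'cV[R]_2) := - (c1 * x 0 0 + c2 * x 1 0 + b).
have affE (h : 'cV[R]_2) : aff (top_view p + h) = aff (top_view p) + - c1 * h 0 0
    + - c2 * h 1 0 + 0 * h 0 0 ^+ 2 + 0 * h 0 0 * h 1 0 + 0 * h 1 0 ^+ 2.
  have E i : (top_view p + h) i 0 = top_view p i 0 + h i 0 by rewrite mxE.
  rewrite /aff !E; move: (top_view p 0 0) (top_view p 1 0) => x y; ring.
have fs := power_series2Z c3^-1 (power_series2D Fc (power_series2_quadratic affE)).
exists (fun x => c3^-1 * (F x + aff x)), (fun i j => c3^-1 *
  (c i j + quadratic_coef (aff (top_view p)) (- c1) (- c2) 0 0 0 i j)), (Num.min r 1).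
split=> //; last first.
  apply: ratio_coef_scale rat; first by exact: (invr_neq0 c30).
  by case=> [|[|[|i]]] [|[|[|j]]] //= _; rewrite addr0.
split=> //; first by apply/analytic_at2P; eexists; eexists; exact: fs.
exists (interior W); split; [exact: open_interior|exact: Wp|].
move=> q [Sq /interior_subset Wq].
have := graph q (conj Sq Wq); rewrite /aff /height => <-; rewrite top_viewE vec2_0 vec2_1.
by move: (q 0 0) (q 1 0) (q 2%:R 0) => x y z; field.
Qed.

Lemma paraboloid_constant_ratio (R : realType) (a : R) (S : set 'cV[R]_3) T :
  a < 0 -> isotropic_similarity T -> (forall p, S p -> paraboloid a (T p)) ->
  constant_ratio a S.
Proof.
move=> a0 /isotropic_similarity_elim [s [h1 [h2 [c1 [c2 [c3 [b0 [b1 [b2 [h0 c30 HT]]]]]]]]]] HS.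
apply: coef_constant_ratio => // p Sp.
pose sg : R := (-1) ^+ nat_of_bool s.
have sg2 : sg ^+ 2 = 1 by rewrite /sg sqrr_sign.
pose X (x : 'cV[R]_2) := sg * (h1 * x 0 0 - h2 * x 1 0) + b0.
pose Y (x : 'cV[R]_2) := h2 * x 0 0 + h1 * x 1 0 + b1.
pose F x := X x ^+ 2 + a * Y x ^+ 2.
set w := top_view p.
have Fc : power_series2_at F w (quadratic_coef (F w)
    (2 * X w * (sg * h1) + a * (2 * Y w * h2)) (2 * X w * - (sg * h2) + a * (2 * Y w * h1))
    (h1 ^+ 2 + a * h2 ^+ 2) (2 * (- h1 * h2 + a * (h2 * h1))) (h2 ^+ 2 + a * h1 ^+ 2)) 1.
  apply: power_series2_quadratic => h.
  have E i : (w + h) i 0 = w i 0 + h i 0 by rewrite mxE.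
  rewrite /F /X /Y !E; move: (w 0 0) (w 1 0) (h 0 0) (h 1 0) => x y k l.
  transitivity ((sg * (h1 * x - h2 * y) + b0) ^+ 2
    + 2 * (sg * (h1 * x - h2 * y) + b0) * (sg * (h1 * k - h2 * l))
    + sg ^+ 2 * (h1 * k - h2 * l) ^+ 2
    + a * (h2 * (x + k) + h1 * (y + l) + b1) ^+ 2); first by ring.
  by rewrite sg2; ring.
apply: (@similar_local_graph R a S p F _ 1 c1 c2 c3 b2 setT Sp c30 Fc).
- rewrite /ratio_coef /=; split; first by ring.
  rewrite (_ : _ - _ = 4 * (h1 ^+ 2 + h2 ^+ 2) ^+ 2 * a); last by ring.
  by rewrite pmulr_rlt0 // mulr_gt0 // exprn_even_gt0.
- exact: filterT.
move=> q [/HS [x [y e]] _]; move: e; rewrite HT => /vec3_inj [eX eY ->].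
by rewrite /F /X /Y top_viewE !vec2_0 !vec2_1 /sg eX eY.
Qed.

Lemma affine_continuous (R : realType) (k0 k1 k2 k : R) p :
  {for p, continuous (fun q : 'cV[R]_3 => k0 * q 0 0 + k1 * q 1 0 + k2 * q 2%:R 0 + k)}.
Proof.
have lin (l : R) i : {for p, continuous (fun q : 'cV[R]_3 => l * q i 0)}.
  by apply: continuousM; [exact: cst_continuous|exact: coord_continuous].
apply: continuousD; last exact: cst_continuous.
by apply: continuousD; [apply: continuousD|]; exact: lin.
Qed.

(** With [v] recovered from the height by [ginv], the coordinates of [T q] satisfy
[X * sin v = Y * cos v].  At a point with [u = 0] this relation makes the tangent plane
vertical, by [vertical_tangent].  At the other points the linear forms
of [helical_expansion] are chosen so that [1 + p] and [q] are the coordinates of the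
image along and across the direction [v0], divided by [u0]; their gradients are
orthogonal and of equal length, so that the Hessian has trace [b * kap * h] and
determinant [- (b * h) ^+ 2]. *)
Lemma helical_constant_ratio (R : realType) (a kap d : R) (g ginv : R -> R)
    (S : set 'cV[R]_3) T :
  a < 0 -> a * kap ^+ 2 = - (a + 1) ^+ 2 ->
  (forall x : R, is_derive x 1 g (kap * g x + d)) -> (forall x, kap * g x + d != 0) ->
  (forall x, ginv (g x) = x) -> (forall x, {for g x, continuous ginv}) ->
  analytic_surface S -> admissible S -> isotropic_similarity T ->
  (forall p, S p -> exists u v, T p = vec3 (u * cos v) (u * sin v) (g v)) ->
  constant_ratio a S.
Proof.
move=> a0 akap Dg g10 gK ginvc surf adm.
move=> /isotropic_similarity_elim [s [h1 [h2 [c1 [c2 [c3 [b0 [b1 [b2 [h0 c30 HT]]]]]]]]]] HS.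
apply: coef_constant_ratio => // p Sp.
pose sg : R := (-1) ^+ nat_of_bool s.
have sg2 : sg ^+ 2 = 1 by rewrite /sg sqrr_sign.
pose Z (q : 'cV[R]_3) := c1 * q 0 0 + c2 * q 1 0 + c3 * q 2%:R 0 + b2.
have Zc : {for p, continuous Z} by exact: affine_continuous.
have [u0 [v0]] := HS p Sp; rewrite HT -/sg => /vec3_inj [eX eY eZ].
pose V q := ginv (Z q).
have Vp : V p = v0 by rewrite /V /Z eZ gK.
have Vc : {for p, continuous V}.
  have Zp : Z p = g v0 by rewrite /Z eZ.
  have gc : {for Z p, continuous ginv} by rewrite Zp; exact: ginvc.
  exact: (continuous_comp Zc gc).
have cs0 := cos2Dsin2 v0.
(* Otherwise [p] lies on the axis. *)
have u00 : u0 != 0.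
  apply/eqP => u00; apply: (adm p Sp).
  have sc : {for p, continuous (fun q => sin (V q))}.
    by apply: (continuous_comp Vc); exact: continuous_sin.
  have ccs : {for p, continuous (fun q => cos (V q))}.
    by apply: (continuous_comp Vc); exact: continuous_cos.
  have kc (f : 'cV[R]_3 -> R) (k : R) : {for p, continuous f} -> {for p, continuous (fun q => k * f q)}.
    by move=> fc; apply: continuousM => //; exact: cst_continuous.
  apply: (@vertical_tangent _ S p (fun q => sg * h1 * sin (V q) - h2 * cos (V q))
    (fun q => - (sg * h2) * sin (V q) - h1 * cos (V q)) surf Sp).
  - by apply: continuousB; exact: kc.
  - by apply: continuousB; exact: kc.
  - rewrite Vp.
    have [m0|m0] := eqVneq (sg * h1 * sin v0 - h2 * cos v0) 0; last by left.
    have [m1|m1] := eqVneq (- (sg * h2) * sin v0 - h1 * cos v0) 0; last by right.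
    exfalso; move/eqP: h0; apply.
    transitivity ((sg * h1 * sin v0 - h2 * cos v0) ^+ 2
      + (- (sg * h2) * sin v0 - h1 * cos v0) ^+ 2); last by rewrite m0 m1 expr0n addr0.
    transitivity (sg ^+ 2 * (h1 ^+ 2 + h2 ^+ 2) * sin v0 ^+ 2
       + (h1 ^+ 2 + h2 ^+ 2) * cos v0 ^+ 2); last by ring.
    by rewrite sg2 mul1r -mulrDr [sin _ ^+ 2 + _]addrC cs0 mulr1.
  - move=> q Sq; have [u [v]] := HS q Sq; rewrite HT -/sg => /vec3_inj [qX qY qZ].
    have -> : V q = v by rewrite /V /Z qZ gK.
    rewrite u00 !mul0r in eX eY.
    transitivity ((sg * (h1 * q 0 0 - h2 * q 1 0) + b0) * sin v
       - (h2 * q 0 0 + h1 * q 1 0 + b1) * cos v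
       - ((sg * (h1 * p 0 0 - h2 * p 1 0) + b0) * sin v
       - (h2 * p 0 0 + h1 * p 1 0 + b1) * cos v)); first by ring.
    by rewrite eX eY qX qY; ring.
pose w := top_view p.
pose p0 := (sg * h1 * cos v0 + h2 * sin v0) / u0.
pose p1 := (- (sg * h2) * cos v0 + h1 * sin v0) / u0.
pose q0 := (- (sg * h1) * sin v0 + h2 * cos v0) / u0.
pose q1 := (sg * h2 * sin v0 + h1 * cos v0) / u0.
have [r Fc] := @helical_expansion R g kap d v0 p0 p1 q0 q1 w Dg.
set F := (X in power_series2_at X) in Fc.
pose W := [set q : 'cV[R]_3 | `|V q - v0| < pi / 2 /\
   1 + (p0 * (q 0 0 - p 0 0) + p1 * (q 1 0 - p 1 0)) != 0].
apply: (@similar_local_graph R a S p F _ r c1 c2 c3 b2 W Sp c30 Fc).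
- have [e20 e11 e02] := @helical_coef2 R g kap d v0 p0 p1 q0 q1.
  rewrite /ratio_coef e20 e11 e02; set b := kap * g v0 + d.
  have bn : b != 0 by exact: g10.
  pose h := (h1 ^+ 2 + h2 ^+ 2) / u0 ^+ 2.
  have h_0 : h != 0 by rewrite mulf_neq0 // invr_eq0 expf_neq0.
  have qq : q0 ^+ 2 + q1 ^+ 2 = h.
    rewrite /h; transitivity ((sg ^+ 2 * (h1 ^+ 2 + h2 ^+ 2) * sin v0 ^+ 2
       + (h1 ^+ 2 + h2 ^+ 2) * cos v0 ^+ 2) / u0 ^+ 2); first by rewrite /q0 /q1; field.
    by rewrite sg2 mul1r -mulrDr [sin _ ^+ 2 + _]addrC cs0 mulr1.
  have pq : p0 * q0 + p1 * q1 = 0.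
    transitivity ((1 - sg ^+ 2) * (h1 ^+ 2 + h2 ^+ 2) * sin v0 * cos v0 / u0 ^+ 2).
      by rewrite /q0 /q1 /p0 /p1; field.
    by rewrite sg2 subrr !mul0r.
  have cross : p0 * q1 - p1 * q0 = sg * h.
    transitivity (sg * (h1 ^+ 2 + h2 ^+ 2) * (cos v0 ^+ 2 + sin v0 ^+ 2) / u0 ^+ 2).
      by rewrite /q0 /q1 /p0 /p1; field.
    by rewrite cs0 mulr1 /h mulrA.
  have tr : 2 * ((kap * q0 - 2 * p0) * (b * q0) / 2) + 2 * ((kap * q1 - 2 * p1) * (b * q1) / 2)
      = b * kap * h.
    transitivity (b * (kap * (q0 ^+ 2 + q1 ^+ 2) - 2 * (p0 * q0 + p1 * q1))); first by field.
    by rewrite qq pq; ring.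
  have det : 2 * ((kap * q0 - 2 * p0) * (b * q0) / 2) * (2 * ((kap * q1 - 2 * p1) * (b * q1) / 2))
     - ((kap * (q0 * (b * q1) + q1 * (b * q0)) - 2 * (p0 * (b * q1) + p1 * (b * q0))) / 2) ^+ 2
     = - (b * h) ^+ 2.
    transitivity (- b ^+ 2 * (p0 * q1 - p1 * q0) ^+ 2); first by field.
    by rewrite cross exprMn sg2; ring.
  rewrite tr det; split.
    transitivity (a * kap ^+ 2 * (b * h) ^+ 2); first by ring.
    by rewrite akap; ring.
  by rewrite oppr_lt0 exprn_even_gt0 // mulf_neq0.
- have n1 : \forall q \near p, `|V q - v0| < pi / 2.
    have : V q @[q --> p] --> v0 by rewrite -Vp; exact: Vc.
    move=> /cvgrPdist_lt /(_ (pi / 2)) H.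
    have /H : 0 < pi / 2 :> R by rewrite divr_gt0 // pi_gt0.
    by apply: filterS => q; rewrite distrC.
  have n2 : nbhs p [set q : 'cV[R]_3 |
      1 + (p0 * (q 0 0 - p 0 0) + p1 * (q 1 0 - p 1 0)) != 0].
    pose L (q : 'cV[R]_3) := 1 + (p0 * (q 0 0 - p 0 0) + p1 * (q 1 0 - p 1 0)).
    have Lc : {for p, continuous L}.
      have -> : L = fun q : 'cV[R]_3 => p0 * q 0 0 + p1 * q 1 0 + 0 * q 2%:R 0
        + (1 - p0 * p 0 0 - p1 * p 1 0) by apply/funext => q; rewrite /L; ring.
      exact: affine_continuous.
    have N0 : nbhs (L p) [set y : R | y != 0].
      apply: open_nbhs_nbhs; split; first exact: open_neq.
      by rewrite /L /= !subrr !mulr0 !addr0 oner_neq0.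
    exact: (Lc _ N0).
  by apply: filterS2 n1 n2 => q.
move=> q [Sq [Vq nz]]; have [u [v]] := HS q Sq; rewrite HT -/sg => /vec3_inj [qX qY qZ].
have Vv : V q = v by rewrite /V /Z qZ gK.
rewrite Vv in Vq; rewrite qZ /F.
have -> : (top_view q - w) 0 0 = q 0 0 - p 0 0 by rewrite /w !top_viewE !mxE.
have -> : (top_view q - w) 1 0 = q 1 0 - p 1 0 by rewrite /w !top_viewE !mxE.
have pE : 1 + (p0 * (q 0 0 - p 0 0) + p1 * (q 1 0 - p 1 0)) = u / u0 * cos (v - v0).
  rewrite cosB; transitivity (1 + (((sg * (h1 * q 0 0 - h2 * q 1 0) + b0)
     - (sg * (h1 * p 0 0 - h2 * p 1 0) + b0)) * cos v0
     + ((h2 * q 0 0 + h1 * q 1 0 + b1) - (h2 * p 0 0 + h1 * p 1 0 + b1)) * sin v0) / u0).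
    by rewrite /p0 /p1; field.
  rewrite eX eY qX qY.
  transitivity (1 + (u * (cos v * cos v0 + sin v * sin v0)
     - u0 * (cos v0 ^+ 2 + sin v0 ^+ 2)) / u0); first by field.
  by rewrite cs0; field.
have qE : q0 * (q 0 0 - p 0 0) + q1 * (q 1 0 - p 1 0) = u / u0 * sin (v - v0).
  rewrite sinB; transitivity ((- ((sg * (h1 * q 0 0 - h2 * q 1 0) + b0)
     - (sg * (h1 * p 0 0 - h2 * p 1 0) + b0)) * sin v0
     + ((h2 * q 0 0 + h1 * q 1 0 + b1) - (h2 * p 0 0 + h1 * p 1 0 + b1)) * cos v0) / u0).
    by rewrite /q0 /q1; field.
  by rewrite eX eY qX qY; field.
rewrite pE in nz; rewrite pE qE.
have [uu cn] : u / u0 != 0 /\ cos (v - v0) != 0.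
  by move: nz; rewrite mulf_eq0 negb_or => /andP[].
have -> : u / u0 * sin (v - v0) / (u / u0 * cos (v - v0)) = tan (v - v0).
  by rewrite /tan -mulf_div divff // mul1r.
rewrite tanK ?subrKC //.
by rewrite in_itv /=; move: Vq; rewrite ltr_norml.
Unshelve. all: by end_near. Qed.

Theorem theorem17 (R : realType) (a : R) (ha : a < 0) (S : set 'cV[R]_3)
    (hsurf : analytic_surface S) (hadm : admissible S) (hruled : ruled S) :
  constant_ratio a S <->
  exists B : set 'cV[R]_3, isotropic_similar S B /\
    [\/ B `<=` paraboloid a,
        a = -1 /\ B `<=` helicoid R |
        a <> -1 /\ B `<=` exp_helicoid a].
Proof.
split=> [ratio|[B [[T [HT TS]] HB]]].
  have [T [HT H]] := ratio_ruled_surface ha hsurf hadm hruled ratio.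
  exists (T @` S); split; first by exists T.
  case: H => [H|[am H]|[am H]]; [apply: Or31|apply: Or32|apply: Or33]; try split=> //;
    by move=> _ [p Sp <-]; exact: H.
have TB p : S p -> B (T p) by move=> Sp; rewrite -TS; exists p.
case: HB => [HB|[am HB]|[am HB]].
- by apply: (paraboloid_constant_ratio ha HT) => p Sp; exact: HB (TB _ Sp).
- apply: (@helical_constant_ratio R a 0 1 id id S T) => //.
  + by rewrite am addNr !expr0n /= mulr0 oppr0.
  + by move=> x; apply: is_derive_eq; rewrite mul0r add0r.
  + by move=> x; rewrite mul0r add0r oner_neq0.
  + by move=> x; exact: cvg_id.
  + by move=> p Sp; have [u [v ->]] := HB _ (TB _ Sp); exists u, v.
pose c := (a + 1) / Num.sqrt `|a|.
have sa : 0 < Num.sqrt `|a| by rewrite sqrtr_gt0 normr_gt0 lt_eqF.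
have c0 : c != 0.
  rewrite mulf_neq0 ?invr_eq0 ?(gt_eqF sa) //.
  by rewrite addr_eq0; apply/eqP.
apply: (@helical_constant_ratio R a c 0 (fun v => expR (c * v)) (fun z => ln z / c) S T) => //.
- rewrite /c expr_div_n sqr_sqrtr // ltr0_norm //; field.
  by rewrite lt_eqF.
- by move=> x; apply: is_derive_eq; rewrite /GRing.scale /=; ring.
- by move=> x; rewrite addr0 mulf_neq0 // gt_eqF // expR_gt0.
- by move=> x; rewrite expRK mulrC mulKf.
- move=> x; apply: continuousM; last exact: cst_continuous.
  by apply: continuous_ln; exact: expR_gt0.
by move=> p Sp; have [u [v ->]] := HB _ (TB _ Sp); exists u, v.
Qed.
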